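(* Let $-\infty\leqslant a<b\leqslant\infty$ and let $f$ be an $\mathbb{R}$-valued measurable function on $(a,b)$. The following statements are equivalent. (a) $ID(\mathbb{R}^d)=\mathfrak D^0(\Phi_f)$. (b) $ID(\mathbb{R}^d)=\mathfrak D(\Phi_{f,\mathrm{es}})$. (c) $ID_0(\mathbb{R}^d)\subset\mathfrak D^0(\Phi_f)$. (d) $ID_0(\mathbb{R}^d)\subset\mathfrak D(\Phi_{f,\mathrm{es}})$. (e) $\int_a^b1_{\{f(s)\neq0\}}ds<\infty$ and $\int_a^bf(s)^2ds<\infty$.
   Context: $ID(\mathbb{R}^d)$ ($d$ fixed) is the class of infinitely divisible distributions on $\mathbb{R}^d$. For $\mu\in ID(\mathbb{R}^d)$, $C_\mu$ is the unique complex-valued continuous function on $\mathbb{R}^d$ with $C_\mu(0)=0$ and $\widehat\mu(z)=e^{C_\mu(z)}$; $\mu$ has Lévy–Khintchine triplet $(A,\nu,\gamma)$ if $$C_\mu(z)=-\tfrac12\langle z,Az\rangle+\int_{\mathbb{R}^d}\Big(e^{i\langle z,x\rangle}-1-\frac{i\langle z,x\rangle}{1+|x|^2}\Big)\nu(dx)+i\langle\gamma,z\rangle,$$ with $A$ symmetric nonnegative-definite, $\nu(\{0\})=0$, $\int(|x|^2\wedge1)\nu(dx)<\infty$, $\gamma\in\mathbb{R}^d$. $ID_0(\mathbb{R}^d)$ is the class of $\mu\in ID(\mathbb{R}^d)$ with $A=0$ (purely non-Gaussian). Random measure. $X^{(\mu)}=\{X^{(\mu)}(B)\colon B\text{ bounded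 Borel in }\mathbb{R}\}$ is the (unique in law) $\mathbb{R}^d$-valued homogeneous independently scattered random measure on $\mathbb{R}$ such that $X^{(\mu)}((t,t+1])$ has distribution $\mu$ for all $t$: (1) for disjoint bounded Borel sets $B_1,B_2,\dots$ with bounded union, $\sum_n X^{(\mu)}(B_n)$ converges a.s. and equals $X^{(\mu)}(\bigcup_n B_n)$ a.s.; (2) values on finitely many disjoint sets are independent; (3) $X^{(\mu)}(\{t\})=0$ a.s.; and the law of $X^{(\mu)}(B+t)$ equals that of $X^{(\mu)}(B)$. Integrals. Let $\mathcal B^0_{(a,b)}$ be the class of Borel sets $B\subset(a,b)$ with $\inf B>a$, $\sup B<b$. For a simple function $f=\sum_{j=1}^n r_j1_{B_j}$ ($B_j$ disjoint Borel in $(a,b)$, $r_j\in\mathbb{R}$), $\int_B f\,dX^{(\mu)}=\sum_j r_jX^{(\mu)}(B\cap B_j)$ for $B\in\mathcal B^0_{(a,b)}$. A measurable $f\colon(a,b)\to\mathbb{R}$ belongs to $\mathbf L_{(a,b)}(X^{(\mu)})$ (locally $X^{(\mu)}$-integrable) if there are simple $f_n\to f$ Lebesgue-a.e. such that $\int_B f_n\,dX^{(\mu)}$ converges in probability for every $B\in\mathcal B^0_{(a,b)}$; the limit is $\int_B f(s)X^{(\mu)}(ds)$, and $\int_p^q$ is the integral over $(p,q]$, $a<p<q<b$. Domains. $\mathfrak D(\Phi_{f,\mathrm{es}})$ is the class of $\mu\in ID(\mathbb{R}^d)$ with $f\in\mathbf L_{(a,b)}(X^{(\mu)})$ for which there is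 a nonrandom $\mathbb{R}^d$-valued function $g(p,q)$ such that $\int_p^q f(s)X^{(\mu)}(ds)-g(p,q)$ converges in probability as $p\downarrow a$, $q\uparrow b$. $\mathfrak D^0(\Phi_f)$ is the class of $\mu\in ID(\mathbb{R}^d)$ with $f\in\mathbf L_{(a,b)}(X^{(\mu)})$ and $\int_a^b|C_\mu(f(s)z)|ds<\infty$ for all $z\in\mathbb{R}^d$. *)

(* Defs.v *)
From HB Require Import structures.
From mathcomp Require Import all_boot all_order all_algebra complex.
From mathcomp Require Import all_classical all_reals all_analysis.

Set Implicit Arguments.
Unset Strict Implicit.
Unset Printing Implicit Defensive.

Import Order.TTheory GRing.Theory Num.Theory.
Import numFieldNormedType.Exports.

Local Open Scope classical_set_scope.
Local Open Scope ring_scope.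
Local Open Scope complex_scope.

(* R^d is 'rV[R]_d with its Borel sigma-algebra. *)
HB.instance Definition _ (R : realType) (m n : nat) :=
  let G : set (set 'M[R]_(m, n)) := open in
  @isMeasurable.Build (sigma_display G) 'M[R]_(m, n) <<s G >>
    (@sigma_algebra0 _ setT G) (@sigma_algebraC _ G)
    (@sigma_algebra_bigcup _ setT G).

Section euclidean.
Variables (R : realType) (d : nat).

Definition dot (x y : 'rV[R]_d) : R := \sum_(i < d) x ord0 i * y ord0 i.

(* The library norm on 'rV[R]_d is the sup norm, hence this definition. *)
Definition enorm (x : 'rV[R]_d) : R := Num.sqrt (dot x x).

End euclidean.

Section complex_valued.
Variable R : realType.

Definition cexp (w : R[i]) : R[i] :=
  (expR (complex.Re w))%:C * (cos (complex.Im w) +i* sin (complex.Im w)).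

Definition cmod (w : R[i]) : R := ComplexField.Normc.normc w.

(* Meaningful when the real and imaginary parts of g are integrable. *)
Definition cintegral d (T : measurableType d) (m : {measure set T -> \bar R})
    (g : T -> R[i]) : R[i] :=
  (\int[m]_x complex.Re (g x)) +i* (\int[m]_x complex.Im (g x)).

Definition ccontinuous (T : topologicalType) (g : T -> R[i]) : Prop :=
  continuous (fun x => complex.Re (g x)) /\
  continuous (fun x => complex.Im (g x)).

End complex_valued.

Section infinitely_divisible.
Variables (R : realType) (d : nat).
Notation Rd := 'rV[R]_d.
Notation law := (probability Rd R).

(* n-fold convolution power: the step from m is
   B |-> \int m (B - x) nu(dx) = \int \int 1_B(x + y) m(dy) nu(dx). *)
Definition conv_pow (nu : law) (n : nat) : set Rd -> \bar R :=
  iter n (fun (m : set Rd -> \bar R) (B : set Rd) =>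
            (\int[nu]_x m [set y | B (x + y)%R])%E) (\d_ (0 : Rd)).

Definition ID : set law :=
  [set mu | forall n, (0 < n)%N -> exists nu : law,
     forall B : set Rd, measurable B -> mu B = conv_pow nu n B].

Definition charfun (mu : law) (z : Rd) : R[i] :=
  cintegral mu (fun x => cexp (0 +i* dot z x)).

Definition is_cumulant (mu : law) (C : Rd -> R[i]) : Prop :=
  [/\ ccontinuous C, C 0 = 0 & forall z, charfun mu z = cexp (C z)].

(* C_mu, which exists and is unique for mu in ID (the default 0 is only used
   for laws without such a function). *)
Definition cumulant (mu : law) : Rd -> R[i] :=
  xget (fun=> 0) [set C | is_cumulant mu C].

Definition has_triplet (mu : law) (A : 'M[R]_d)
    (nu : {measure set Rd -> \bar R}) (gamma : Rd) : Prop :=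
  [/\ A^T = A /\ (forall z : Rd, 0 <= dot z (z *m A^T)),
      nu [set 0] = 0%E,
      (\int[nu]_x (Num.min (enorm x ^+ 2) 1)%:E < +oo)%E
    & forall z, cumulant mu z =
        - (2^-1 * dot z (z *m A^T))%:C
        + cintegral nu (fun x => cexp (0 +i* dot z x) - 1
            - (0 +i* (dot z x / (1 + enorm x ^+ 2))))
        + (0 +i* dot gamma z)].

Definition ID0 : set law :=
  [set mu | ID mu /\ exists nu gamma, has_triplet mu 0 nu gamma].

End infinitely_divisible.
Arguments ID R d : clear implicits.
Arguments ID0 R d : clear implicits.

Definition bounded_borel (R : realType) (B : set R) : Prop :=
  measurable B /\ bounded_set B.

(* A probability space with a family of R^d-valued random variables indexed
   by sets; only the values on bounded Borel sets are meaningful. *)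
Record set_indexed_rvs (R : realType) (d : nat) := SetIndexedRVs {
  rm_disp : measure_display;
  rm_space : measurableType rm_disp;
  rm_prob : probability rm_space R;
  rm_val :> set R -> {RV rm_prob >-> 'rV[R]_d}
}.

Section random_measure.
Variables (R : realType) (d : nat).
Notation Rd := 'rV[R]_d.
Notation law := (probability Rd R).

(* X is a realization of X^(mu): an R^d-valued homogeneous independently
   scattered random measure on R whose value on ]t, t + 1] has law mu. *)
Record is_random_measure (mu : law) (X : set_indexed_rvs R d) : Prop := {
  rm_sigma_additive : forall B : nat -> set R,
    (forall n, bounded_borel (B n)) -> trivIset setT B ->
    bounded_set (\bigcup_n B n) ->
    {ae rm_prob X, forall w,
      (fun n => \sum_(k < n) X (B k) w) @ \oo --> X (\bigcup_n B n) w};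
  rm_independent : forall (n : nat) (B : 'I_n -> set R),
    (forall j, bounded_borel (B j)) -> trivIset setT B ->
    forall A : 'I_n -> set Rd, (forall j, measurable (A j)) ->
    rm_prob X (\bigcap_j (X (B j) @^-1` A j)) =
      (\prod_(j < n) rm_prob X (X (B j) @^-1` A j))%E;
  rm_no_atom : forall t, {ae rm_prob X, forall w, X [set t] w = 0};
  rm_homogeneous : forall (B : set R) (t : R), bounded_borel B ->
    forall A : set Rd, measurable A ->
    distribution (rm_prob X) (X [set s + t | s in B]) A =
      distribution (rm_prob X) (X B) A;
  rm_unit_law : forall (t : R) (A : set Rd), measurable A ->
    distribution (rm_prob X) (X [set` `]t, t + 1]]) A = mu A
}.

End random_measure.

Section stochastic_integral.
Variables (R : realType) (d : nat) (a b : \bar R).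
Notation Rd := 'rV[R]_d.

Definition oitv : set R := [set s | (a < s%:E < b)%E].

(* The class B^0_(a,b). With inf = +oo and sup = -oo it contains set0. *)
Definition inner_borel (B : set R) : Prop :=
  [/\ measurable B, B `<=` oitv,
      (a < ereal_inf (EFin @` B))%E & (ereal_sup (EFin @` B) < b)%E].

Record simple_fun := SimpleFun {
  sf_size : nat;
  sf_coef : 'I_sf_size -> R;
  sf_set : 'I_sf_size -> set R;
  sf_measurable : forall j, measurable (sf_set j);
  sf_sub : forall j, sf_set j `<=` oitv;
  sf_disjoint : trivIset setT sf_set
}.

Definition sf_eval (h : simple_fun) (s : R) : R :=
  \sum_(j < sf_size h) sf_coef j * \1_(sf_set j) s.

Variable X : set_indexed_rvs R d.

Definition simple_integral (h : simple_fun) (B : set R)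
    (w : rm_space X) : Rd :=
  \sum_(j < sf_size h) sf_coef j *: X (B `&` sf_set j) w.

Definition cvg_in_prob (I : Type) (F : set_system I)
    (Y : I -> rm_space X -> Rd) (Z : rm_space X -> Rd) : Prop :=
  forall e : R, 0 < e ->
    (fun i => rm_prob X [set w | e <= enorm (Y i w - Z w)]) @ F --> 0%E.

(* J B is a version of \int_B f dX for every B in B^0_(a,b); such a version
   is determined up to almost sure equality by f and X. *)
Definition is_integral (f : R -> R)
    (J : set R -> {RV rm_prob X >-> Rd}) : Prop :=
  exists h : nat -> simple_fun,
    {ae lebesgue_measure, forall s : R, oitv s ->
       (fun n => sf_eval (h n) s) @ \oo --> f s} /\
    forall B, inner_borel B ->
      cvg_in_prob \oo (fun n => simple_integral (h n) B) (J B).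

Definition locally_integrable (f : R -> R) : Prop :=
  exists J, is_integral f J.

(* The filter "p decreases to a and q increases to b". *)
Definition ends_filter : set_system (R * R) :=
  [set E | exists p0 q0 : R, [/\ oitv p0, oitv q0, p0 < q0 &
     forall p q, oitv p -> oitv q -> p < p0 -> q0 < q -> E (p, q)]].

Definition essentially_integrable (f : R -> R) : Prop :=
  exists J, is_integral f J /\
  exists (g : R -> R -> Rd) (Z : {RV rm_prob X >-> Rd}),
    cvg_in_prob ends_filter
      (fun pq w => J [set` `]pq.1, pq.2]] w - g pq.1 pq.2) Z.

End stochastic_integral.

Section domains.
Variables (R : realType) (d : nat).
Notation law := (probability 'rV[R]_d R).
(* X mu plays the role of X^(mu). *)
Variables (X : law -> set_indexed_rvs R d) (a b : \bar R) (f : R -> R).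

Definition D_es : set law :=
  [set mu | ID R d mu /\ locally_integrable a b (X mu) f /\
            essentially_integrable a b (X mu) f].

Definition D0 : set law :=
  [set mu | [/\ ID R d mu, locally_integrable a b (X mu) f &
     forall z : 'rV[R]_d,
       (\int[lebesgue_measure]_(s in oitv a b)
          (cmod (cumulant mu (f s *: z)))%:E < +oo)%E]].

End domains.

(* Main.v *)
From HB Require Import structures.
Require Import Defs.
From mathcomp Require Import all_boot all_order all_algebra complex.
From mathcomp Require Import all_classical all_reals all_analysis.
From mathcomp Require Import measurable_realfun ring lra.

(** Write [lam] for Lebesgue measure.  The proof rests on the exponent of the
    random measure: for each direction [z] there is a continuous [c] with
    [c 0 = 0] such that [dot z (X B)] has characteristic function
    [exp (lam B * c s)] at [s], for every bounded Borel set [B]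
    ([levy_exponent]).  It is obtained from the semigroup [t -> X (]0, t])], whose
    characteristic functions are close to one for small [t], so that the
    principal logarithm is available; the cumulant of [mu], when it exists, is
    this exponent ([cumulant_ray]).  Doubling the argument multiplies
    [1 - cos] by at most four, hence [- Re (c (2 s)) <= 4 * - Re (c s)], and
    [|c s| <= e + K s^2] for each [e > 0] ([quadratic_growth]).

    If [f] is square integrable and vanishes outside a set of finite measure, the
    bound [|c s| <= 1_(s <> 0) + K s^2] makes the cumulant integrable along [f]
    ([cumulant_integrable]).  Moreover the truncation inequality
    [m (|Y| >= 2) <= 2 sup_(0 <= s <= 1) int (1 - cos (s Y)) dm] bounds the tails
    of elementary integrals by [e lam (g <> 0) + K int g^2] ([elementary_tail]);
    as convergence in probability is complete, the integrals of the
    discretisations of [f] converge, over each inner set and also over the whole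
    interval ([sufficient_locally_integrable],
    [sufficient_essentially_integrable]).

    Conversely, let [a k > 0] and [l k >= 0] with [sum l k min (a k ^ 2, 1)]
    finite.  There is a law in [ID0] with cumulant [- psi (z_0)], where
    [psi u = sum l k (1 - cos (a k u))] ([jump_law_ID0]): combinations of the
    masses of disjoint intervals under the random measure of a compound Poisson
    law converge in probability to a variable with this exponent, and dividing
    all [l k] by [n] yields the roots that infinite divisibility asks for,
    because characteristic functions determine laws on the line
    ([cfun_injective]).  For this law, membership in either domain forces
    [int psi (f s) ds] to be finite.  For the domain of absolute convergence this
    is its definition.  For essential convergence, the centring contributes a
    mere phase; so along intervals exhausting the domain the characteristic
    functions [exp (- int psi (u f))] stay away from zero for some [u = 2^-m], and
    the doubling inequality removes [u] ([essential_bound],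
    [jump_exponent_double]).

    The freedom in [a] and [l] gives a uniform bound: if
    [G t = int (1 - cos (t f)) <= K min (t^2, 1)] failed for every [K], jump sizes
    and intensities could be chosen to make [int psi (f)] infinite.  Large [t]
    in this bound control [lam (f <> 0)] by the truncation inequality, and small
    [t] control [int f^2], since [1 - cos x >= x^2 / 8] for [|x| <= 1]
    ([necessity_of_jump_condition]). *)

Set Implicit Arguments.
Unset Strict Implicit.
Unset Printing Implicit Defensive.

Import Order.TTheory GRing.Theory Num.Theory.
Import numFieldNormedType.Exports.

Local Open Scope classical_set_scope.
Local Open Scope ring_scope.
Local Open Scope complex_scope.

Local Notation Re := complex.Re.
Local Notation Im := complex.Im.
Local Notation lam := (@lebesgue_measure _).

(** * Elementary bounds for sine and cosine *)

Section trig_bounds.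
Variable R : realType.
Implicit Types x : R.

Lemma normr_sin_le x : `|sin x| <= `|x|.
Proof.
wlog x0 : x / 0 <= x => [H|].
  case: (leP 0 x) => [x0|x0]; first exact: H.
  rewrite -normrN -sinN -(normrN x) H// oppr_ge0 ltW//.
have [->|xn0] := eqVneq x 0; first by rewrite sin0 normr0.
have xp : 0 < x by rewrite lt_neqAle eq_sym xn0.
have [c _] : exists2 c, c \in `]0, x[%R & sin x - sin 0 = cos c * (x - 0).
  apply: (@MVT _ sin cos) => //.
  exact/continuous_subspaceT/continuous_sin.
rewrite sin0 !subr0 => ->; rewrite normrM -[leRHS]mul1r ler_pM//.
exact: cos_max.
Qed.

Lemma one_sub_cosE x : 1 - cos x = 2 * sin (x / 2) ^+ 2.
Proof.
have -> : cos x = cos (x / 2 + x / 2) by congr cos; field.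
rewrite cosD; have := cos2Dsin2 (x / 2); move: (cos _) (sin _) => c s.
by rewrite !expr2 => h; lra.
Qed.

Lemma one_sub_cos_ge0 x : 0 <= 1 - cos x.
Proof. by rewrite subr_ge0 cos_le1. Qed.

Lemma one_sub_cos_le2 x : 1 - cos x <= 2.
Proof. by have := cos_geN1 x; lra. Qed.

Lemma one_sub_cos_le_sqr x : 1 - cos x <= x ^+ 2.
Proof.
have := normr_sin_le (x / 2); rewrite -ler_sqr ?nnegrE// !real_normK ?num_real//.
rewrite one_sub_cosE !expr2 => h.
have := sqr_ge0 x; rewrite expr2; nra.
Qed.

(** [1 - cos (2 x) = 2 (1 - cos x) (1 + cos x)]. *)
Lemma one_sub_cos_double x : 1 - cos (2 * x) <= 4 * (1 - cos x).
Proof.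
have -> : cos (2 * x) = cos (x + x) by congr cos; ring.
rewrite cosD; have := cos2Dsin2 x; have := cos_le1 x; have := cos_geN1 x.
move: (cos _) (sin _) => c s.
by rewrite !expr2 => h1 h2 h3; nra.
Qed.

Lemma normr_one_sub_cos_le x : `|1 - cos x| <= 2 * `|x|.
Proof.
rewrite ger0_norm ?one_sub_cos_ge0//.
have [h|h] := lerP `|x| 1.
  apply: (le_trans (one_sub_cos_le_sqr x)); rewrite -real_normK ?num_real//.
  by have := normr_ge0 x; rewrite expr2; nra.
by apply: (le_trans (one_sub_cos_le2 x)); lra.
Qed.

(** By the mean value theorem [sin (x / 2) = (x / 2) cos c] with [|c| <= 1 / 2],
    and then [cos c >= 3 / 4]. *)
Lemma one_sub_cos_ge x : `|x| <= 1 -> x ^+ 2 / 8 <= 1 - cos x.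
Proof.
wlog x0 : x / 0 <= x => [H|].
  case: (leP 0 x) => [x0|x0]; first exact: H.
  rewrite -normrN -cosN -(sqrrN x) => h.
  by apply: H => //; rewrite oppr_ge0 ltW//.
rewrite ger0_norm// => x1.
have [->|xn0] := eqVneq x 0; first by rewrite cos0 expr0n/= mul0r subrr.
have xp : 0 < x by rewrite lt_neqAle eq_sym xn0.
pose y := x / 2.
have [c] : exists2 c, c \in `]0, y[%R & sin y - sin 0 = cos c * (y - 0).
  apply: (@MVT _ sin cos) => //; rewrite ?divr_gt0//.
  exact/continuous_subspaceT/continuous_sin.
rewrite sin0 !subr0 in_itv/= => /andP[c0 cy] e.
rewrite one_sub_cosE -/y e.
have c2 : c ^+ 2 <= 1 / 4 by rewrite expr2; rewrite /y in cy; nra.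
have := one_sub_cos_le_sqr c => h.
have cc : 3 / 4 <= cos c by lra.
have yp : 0 < y by rewrite divr_gt0.
have -> : x = 2 * y by rewrite /y; field.
have : 9 / 16 <= cos c * cos c by nra.
by rewrite !expr2 => ?; nra.
Qed.

End trig_bounds.

(** * Expectations of bounded real and complex functions *)

Section bounded_measurable.
Context d (T : measurableType d) (R : realType) (P : probability T R).
Implicit Types f g : T -> R.

(** All random variables integrated below are bounded, so this condition, stable
    under the ring operations, stands for integrability. *)
Definition bmeas f := measurable_fun setT f /\ exists K : R, forall x, `|f x| <= K.

Lemma bmeas_integrable f : bmeas f -> P.-integrable setT (EFin \o f).
Proof.
move=> [mf [K fK]]; apply: measurable_bounded_integrable => //.
  exact: le_lt_trans (probability_le1 P measurableT) (ltry _).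
exists K; split; first exact: num_real.
by move=> x Kx y _ /=; exact: le_trans (fK y) (ltW Kx).
Qed.

Lemma bmeas_cst (c : R) : bmeas (fun=> c).
Proof. by split => //; exists `|c|. Qed.

Lemma bmeasD f g : bmeas f -> bmeas g -> bmeas (fun x => f x + g x).
Proof.
move=> [mf [K fK]] [mg [L gL]]; split; first exact: measurable_funD.
by exists (K + L) => x; rewrite (le_trans (ler_normD _ _))// lerD.
Qed.

Lemma bmeasM f g : bmeas f -> bmeas g -> bmeas (fun x => f x * g x).
Proof.
move=> [mf [K fK]] [mg [L gL]]; split; first exact: measurable_funM.
by exists (K * L) => x; rewrite normrM ler_pM.
Qed.

Lemma bmeasN f : bmeas f -> bmeas (fun x => - f x).
Proof.
move=> [mf [K fK]]; split; first exact: measurableT_comp.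
by exists K => x; rewrite normrN.
Qed.

Lemma bmeas_norm f : bmeas f -> bmeas (fun x => `|f x|).
Proof.
move=> [mf [K fK]]; split; last by exists K => x; rewrite normr_id.
by apply: measurableT_comp => //; exact: normr_measurable.
Qed.

Lemma bmeasB f g : bmeas f -> bmeas g -> bmeas (fun x => f x - g x).
Proof. by move=> mf mg; apply: bmeasD => //; exact: bmeasN. Qed.

Lemma bmeas_cos f : measurable_fun setT f -> bmeas (fun x => cos (f x)).
Proof.
move=> mf; split; last by exists 1 => x; exact: cos_max.
apply: measurableT_comp => //; apply: continuous_measurable_fun.
exact: continuous_cos.
Qed.

Lemma bmeas_sin f : measurable_fun setT f -> bmeas (fun x => sin (f x)).
Proof.
move=> mf; split; last by exists 1 => x; exact: sin_max.
apply: measurableT_comp => //; apply: continuous_measurable_fun.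
exact: continuous_sin.
Qed.

Lemma bmeas_indic (A : set T) : measurable A -> bmeas (\1_A : T -> R).
Proof.
move=> mA; split; first exact: measurable_indic.
by exists 1 => x; rewrite indicE; case: (_ \in _); rewrite ?normr1 ?normr0.
Qed.

Lemma RintegralD_bmeas f g : bmeas f -> bmeas g ->
  \int[P]_x (f x + g x) = \int[P]_x f x + \int[P]_x g x.
Proof. by move=> ? ?; rewrite RintegralD//; exact: bmeas_integrable. Qed.

Lemma RintegralB_bmeas f g : bmeas f -> bmeas g ->
  \int[P]_x (f x - g x) = \int[P]_x f x - \int[P]_x g x.
Proof. by move=> ? ?; rewrite RintegralB//; exact: bmeas_integrable. Qed.

Lemma RintegralZ_bmeas c f : bmeas f ->
  \int[P]_x (c * f x) = c * \int[P]_x f x.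
Proof. by move=> ?; rewrite RintegralZl//; exact: bmeas_integrable. Qed.

Lemma Rintegral_prob_cst (c : R) : \int[P]_x c = c.
Proof.
rewrite Rintegral_cst//.
by rewrite [X in fine X](_ : _ = 1%E) ?mulr1//; exact: probability_setT.
Qed.

Lemma Rintegral_prob_indic (A : set T) : measurable A ->
  \int[P]_x (\1_A x : R) = fine (P A).
Proof. by move=> mA; rewrite /Rintegral integral_indic// setIT. Qed.

Lemma le_Rintegral_bmeas f g : bmeas f -> bmeas g -> (forall x, f x <= g x) ->
  \int[P]_x f x <= \int[P]_x g x.
Proof. by move=> ? ? ?; apply: le_Rintegral => //; exact: bmeas_integrable. Qed.

Lemma Rintegral_bounded_cvg (f_ : nat -> T -> R) f (K : R) :
  (forall n, measurable_fun setT (f_ n)) -> measurable_fun setT f ->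
  (forall n x, `|f_ n x| <= K) ->
  {ae P, forall x, f_ ^~ x @ \oo --> f x} ->
  (fun n => \int[P]_x f_ n x) @ \oo --> \int[P]_x f x.
Proof.
move=> mf_ mf fK ff.
have [] := @dominated_convergence _ _ _ P setT measurableT
  (fun n => EFin \o f_ n) (EFin \o f) (EFin \o cst K).
- by move=> n; exact/measurable_EFinP.
- exact/measurable_EFinP.
- by apply: filterS ff => x fx _; apply/cvg_EFin => //; exact: nearW.
- by apply: bmeas_integrable; exact: bmeas_cst.
- by apply: aeW => x n _; rewrite /= lee_fin.
move=> intf _; rewrite -[X in _ --> X](@fineK _ (\int[P]_x (f x)%:E)%E).
  by move=> /fine_cvgP[_ h]; exact: h.
exact: integrable_fin_num.
Qed.

Lemma eq_Rintegral_ae f g : measurable_fun setT f -> measurable_fun setT g ->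
  {ae P, forall x, f x = g x} -> \int[P]_x f x = \int[P]_x g x.
Proof.
move=> mf mg fg; congr fine; apply: ae_eq_integral => //.
- exact/measurable_EFinP.
- exact/measurable_EFinP.
by apply: filterS fg => x fx _; rewrite fx.
Qed.

End bounded_measurable.

Lemma measurable_ge d (T : measurableType d) (R : realType) (f : T -> R) (e : R) :
  measurable_fun setT f -> measurable [set w | e <= f w].
Proof.
move=> mf; rewrite (_ : mkset _ = setT `&` f @^-1` `[e, +oo[%classic).
  by apply: mf => //; exact: measurable_itv.
by rewrite setTI; apply/seteqP; split => w /=; rewrite in_itv/= andbT.
Qed.

Lemma measurable_fun_norm d (T : measurableType d) (R : realType) (f : T -> R) :
  measurable_fun setT f -> measurable_fun setT (fun w => `|f w|).
Proof. by move=> mf; apply: measurableT_comp => //; exact: normr_measurable. Qed.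

Section complex_expectation.
Variable R : realType.

Lemma complex_eqP (x y : R[i]) : Re x = Re y -> Im x = Im y -> x = y.
Proof. by case: x y => [a b] [c e] /= -> ->. Qed.

Lemma cReM (x y : R[i]) : Re (x * y) = Re x * Re y - Im x * Im y.
Proof. by case: x y => [a b] [c e]. Qed.

Lemma cImM (x y : R[i]) : Im (x * y) = Re x * Im y + Im x * Re y.
Proof. by case: x y => [a b] [c e]. Qed.

Lemma cReD (x y : R[i]) : Re (x + y) = Re x + Re y.
Proof. by case: x y => [a b] [c e]. Qed.

Lemma cImD (x y : R[i]) : Im (x + y) = Im x + Im y.
Proof. by case: x y => [a b] [c e]. Qed.

Lemma cexpE (x : R[i]) :
  cexp x = (expR (Re x) * cos (Im x)) +i* (expR (Re x) * sin (Im x)).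
Proof. by apply: complex_eqP; rewrite /cexp ?cReM ?cImM/= mul0r ?subr0 ?addr0. Qed.

Lemma cexp0 : cexp (0 : R[i]) = 1.
Proof. by rewrite cexpE/= cos0 sin0 expR0 mulr1 mulr0. Qed.

Lemma cexpD (x y : R[i]) : cexp (x + y) = cexp x * cexp y.
Proof.
rewrite !cexpE cReD cImD cosD sinD expRD.
by apply: complex_eqP; rewrite ?cReM ?cImM/=; ring.
Qed.

Lemma cexp_sum (I : Type) (r : seq I) (Q : pred I) (h : I -> R[i]) :
  cexp (\sum_(i <- r | Q i) h i) = \prod_(i <- r | Q i) cexp (h i).
Proof. by apply: (big_morph _ cexpD cexp0). Qed.

Lemma cexp_neq0 (x : R[i]) : cexp x != 0.
Proof.
apply/eqP => h; have := cexpD x (- x); rewrite h mul0r subrr cexp0.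
by move/eqP; rewrite oner_eq0.
Qed.

Context d (T : measurableType d) (P : probability T R).

Definition cbmeas (g : T -> R[i]) :=
  bmeas (fun x => Re (g x)) /\ bmeas (fun x => Im (g x)).

Lemma cbmeas_cst c : cbmeas (fun=> c).
Proof. by split; exact: bmeas_cst. Qed.

Lemma cbmeasM f g : cbmeas f -> cbmeas g -> cbmeas (fun x => f x * g x).
Proof.
move=> [f1 f2] [g1 g2]; split.
  by under eq_fun do rewrite cReM; apply: bmeasB; exact: bmeasM.
by under eq_fun do rewrite cImM; apply: bmeasD; exact: bmeasM.
Qed.

Lemma cbmeas_prod (I : Type) (r : seq I) (Q : pred I) (h : I -> T -> R[i]) :
  (forall i, cbmeas (h i)) -> cbmeas (fun x => \prod_(i <- r | Q i) h i x).
Proof.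
move=> mh; elim: r => [|i r IH].
  by under eq_fun do rewrite big_nil; exact: cbmeas_cst.
under eq_fun do rewrite big_cons.
by case: (Q i) => //; exact: cbmeasM.
Qed.

Lemma cbmeas_real (f : T -> R) : bmeas f -> cbmeas (fun x => (f x)%:C).
Proof. by move=> mf; split => //=; exact: bmeas_cst. Qed.

Lemma cbmeas_cis (f : T -> R) : measurable_fun setT f -> cbmeas (fun x => cexp (0 +i* f x)).
Proof.
move=> mf; split.
  under eq_fun do rewrite cexpE/= expR0 mul1r; exact: bmeas_cos.
under eq_fun do rewrite cexpE/= expR0 mul1r; exact: bmeas_sin.
Qed.

Lemma cintegral_cst c : cintegral P (fun=> c) = c.
Proof. by apply: complex_eqP; rewrite /= Rintegral_prob_cst. Qed.

Lemma cintegralMl c g : cbmeas g ->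
  cintegral P (fun x => c * g x) = c * cintegral P g.
Proof.
move=> [g1 g2]; apply: complex_eqP; rewrite ?cReM ?cImM/=.
  under eq_Rintegral do rewrite cReM.
  rewrite RintegralB_bmeas ?RintegralZ_bmeas//.
  - by apply: bmeasM => //; exact: bmeas_cst.
  - by apply: bmeasM => //; exact: bmeas_cst.
under eq_Rintegral do rewrite cImM.
rewrite RintegralD_bmeas ?RintegralZ_bmeas//.
- by apply: bmeasM => //; exact: bmeas_cst.
- by apply: bmeasM => //; exact: bmeas_cst.
Qed.

Lemma eq_cintegral_ae f g : cbmeas f -> cbmeas g ->
  {ae P, forall x, f x = g x} -> cintegral P f = cintegral P g.
Proof.
move=> [[mf1 _] [mf2 _]] [[mg1 _] [mg2 _]] fg.
by congr (_ +i* _); apply: eq_Rintegral_ae => //; apply: filterS fg => x ->.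
Qed.

End complex_expectation.

(** * Discretisation of a measurable function *)

(** The cell of index [j] is where [j <= (f + N) N < j + 1]; on it [f] is replaced
    by its least possible value.  The cells tile [- N <= f < N], and zero is such a
    least value, so that the discretisation vanishes wherever [f] does. *)
Section discretisation.
Context d (T : measurableType d) (R : realType).
Variables (D : set T) (mD : measurable D) (f : T -> R).
Hypothesis mf : measurable_fun D f.
Variable n : nat.
Local Notation N := (n.+1%:R : R).

Definition step_set (j : 'I_((2 * n.+1 * n.+1)%N)) : set T :=
  D `&` [set x | j%:R <= (f x + N) * N < j.+1%:R].

Definition step_coef (j : 'I_((2 * n.+1 * n.+1)%N)) : R := j%:R / N - N.

Definition step_fun (x : T) : R := \sum_j step_coef j * \1_(step_set j) x.

Lemma measurable_step_set j : measurable (step_set j).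
Proof.
rewrite /step_set.
have -> : [set x | j%:R <= (f x + N) * N < j.+1%:R] =
   (fun x => (f x + N) * N) @^-1` `[j%:R, j.+1%:R[%classic.
  by apply/seteqP; split=> x /=; rewrite in_itv.
have m : measurable_fun D (fun x => (f x + N) * N).
  apply: measurable_funM; last exact: measurable_cst.
  by apply: measurable_funD => //; exact: measurable_cst.
exact: m.
Qed.

Lemma step_set_inj x j k : step_set j x -> step_set k x -> j = k.
Proof.
move=> [_ /andP[j1 j2]] [_ /andP[k1 k2]]; apply: val_inj => /=.
have := le_lt_trans j1 k2; have := le_lt_trans k1 j2.
by rewrite !ltr_nat !ltnS => kj jk; apply/eqP; rewrite eqn_leq jk.
Qed.

Lemma trivIset_step_set : trivIset setT step_set.
Proof. by move=> i j _ _ [x [xi xj]]; exact: step_set_inj xi xj. Qed.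

Lemma step_funE x j : step_set j x -> step_fun x = step_coef j.
Proof.
move=> xj; rewrite /step_fun (bigD1 j)//= big1 => [|k kj].
  by rewrite indicE mem_set// mulr1 addr0.
rewrite indicE memNset ?mulr0// => xk.
by move: kj; rewrite (step_set_inj xk xj) eqxx.
Qed.

Lemma step_fun_out x : (forall j, ~ step_set j x) -> step_fun x = 0.
Proof. by move=> xj; apply: big1 => j _; rewrite indicE memNset ?mulr0. Qed.

Lemma step_set_cover x : D x -> - N <= f x < N -> exists j, step_set j x.
Proof.
move=> Dx /andP[f1 f2].
have h0 : 0 <= (f x + N) * N by rewrite mulr_ge0//; lra.
have jb : (Num.truncn ((f x + N) * N) < 2 * n.+1 * n.+1)%N.
  rewrite -(ltr_nat R); apply: (le_lt_trans (_ : _ <= (f x + N) * N)).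
    by rewrite truncn_le.
  rewrite natrM ltr_pM2r// natrM; lra.
exists (Ordinal jb); split => //=.
by apply/truncn_itv.
Qed.

Lemma step_fun_near x : D x -> - N <= f x < N -> `|f x - step_fun x| <= N^-1.
Proof.
move=> Dx xN; have [j xj] := step_set_cover Dx xN.
rewrite (step_funE xj) /step_coef; case: xj => _ /=/andP[j1 j2].
have Np : 0 < N by [].
have -> : f x - (j%:R / N - N) = ((f x + N) * N - j%:R) / N by field; exact: lt0r_neq0.
rewrite normrM (@ger0_norm _ N^-1) ?invr_ge0// ler_piMl ?invr_ge0//.
by rewrite ger0_norm; move: j2; rewrite -natr1; lra.
Qed.

Lemma step_fun_le x : D x -> `|step_fun x| <= `|f x| + N^-1.
Proof.
move=> Dx; have [xN|xN] := boolP (- N <= f x < N).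
  rewrite -lerBlDl; apply: le_trans (step_fun_near Dx xN).
  by rewrite distrC (le_trans _ (ler_dist_dist _ _))// ler_norm.
rewrite step_fun_out ?normr0 ?addr_ge0// => j [_ /= /andP[j1 j2]].
move/negP: xN; apply.
have Np : 0 < N by [].
have h0 : 0 <= (f x + N) * N by apply: le_trans j1.
have h1 : (f x + N) * N < 2 * N * N.
  apply: (lt_le_trans j2); rewrite -!natrM ler_nat.
  exact: ltn_ord.
apply/andP; split; first by move: h0; rewrite pmulr_lge0//; lra.
by move: h1; rewrite ltr_pM2r//; lra.
Qed.

Lemma step_fun0 x : f x = 0 -> step_fun x = 0.
Proof.
move=> fx; have [[j xj]|h] := pselect (exists j, step_set j x); last first.
  by apply: step_fun_out => j xj; apply: h; exists j.
rewrite (step_funE xj) /step_coef; case: xj => _ /=; rewrite fx add0r.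
rewrite -natrM ler_nat ltr_nat ltnS => h.
have -> : j = (n.+1 * n.+1)%N :> nat by apply/eqP; rewrite eqn_leq.
by rewrite natrM mulfK ?subrr.
Qed.

Lemma measurable_step_fun : measurable_fun setT step_fun.
Proof.
apply: measurable_sum => j; apply: measurable_funM; first exact: measurable_cst.
exact/measurable_indic/measurable_step_set.
Qed.

End discretisation.

Arguments step_set {d T R} D f n j.
Arguments step_coef R {n} j.

Lemma step_fun_cvg d (T : measurableType d) (R : realType) (D : set T)
  (f : T -> R) x : D x -> (fun n => step_fun D f n x) @ \oo --> f x.
Proof.
move=> Dx; apply/cvgrPdist_le => /= e e0.
near=> n; apply: le_trans (_ : n.+1%:R^-1 <= e); last first.
  by apply: ltW; near: n; exact: (near_infty_natSinv_lt (PosNum e0)).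
apply: step_fun_near => //.
have : `|f x| < n.+1%:R.
  apply: lt_trans (_ : n%:R < _); last by rewrite ltr_nat.
  near: n; exact: nbhs_infty_gtr.
by rewrite ltr_norml => /andP[h1 h2]; rewrite h2 (ltW h1).
Unshelve. all: by end_near. Qed.

(** * Independence and characteristic functions *)

Section independence.
Context d d' (T : measurableType d) (T' : measurableType d') (R : realType).
Variable P : probability T R.

Lemma bmeas_comp (Y : T -> T') (g : T' -> R) :
  measurable_fun setT Y -> bmeas g -> bmeas (fun w => g (Y w)).
Proof.
by move=> mY [mg [K gK]]; split; [exact: measurableT_comp | exists K].
Qed.

Lemma cbmeas_comp (Y : T -> T') (g : T' -> R[i]) :
  measurable_fun setT Y -> cbmeas g -> cbmeas (fun w => g (Y w)).
Proof.
move=> mY [g1 g2].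
by split; [exact: (bmeas_comp mY g1) | exact: (bmeas_comp mY g2)].
Qed.

(** Linearity extends the hypothesis to the discretisations of [g], and dominated
    convergence to [g]. *)
Lemma Rintegral_factor (G : T -> R) (Y : T -> T') (a : R) :
  bmeas G -> measurable_fun setT Y ->
  (forall A, measurable A ->
     \int[P]_w (G w * \1_A (Y w)) = a * \int[P]_w (\1_A (Y w))) ->
  forall g, bmeas g -> \int[P]_w (G w * g (Y w)) = a * \int[P]_w g (Y w).
Proof.
move=> bG mY GA g bg.
have step n : \int[P]_w (G w * step_fun setT g n (Y w)) =
              a * \int[P]_w step_fun setT g n (Y w).
  have m j : bmeas (fun w => \1_(step_set setT g n j) (Y w) : R).
    apply: (bmeas_comp mY); apply: bmeas_indic; apply: measurable_step_set => //.
    by case: bg.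
  have ex (H : T -> R) : bmeas H -> \int[P]_w (H w * step_fun setT g n (Y w)) =
     \sum_j step_coef R j * \int[P]_w (H w * \1_(step_set setT g n j) (Y w)).
    move=> bH.
    have hs (s : seq 'I_(2 * n.+1 * n.+1)) : bmeas (fun w => \sum_(j <- s)
         (step_coef R j * (H w * \1_(step_set setT g n j) (Y w)))) /\
         \int[P]_w \sum_(j <- s) (step_coef R j * (H w * \1_(step_set setT g n j) (Y w)))
         = \sum_(j <- s) step_coef R j *
             \int[P]_w (H w * \1_(step_set setT g n j) (Y w)).
      elim: s => [|j s [IH1 IH2]].
        split; first by under eq_fun do rewrite big_nil; exact: bmeas_cst.
        by under eq_Rintegral do rewrite big_nil; rewrite Rintegral_prob_cst big_nil.
      have b1 : bmeas (fun w =>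
          step_coef R j * (H w * \1_(step_set setT g n j) (Y w))).
        by apply: bmeasM; [exact: bmeas_cst|exact: bmeasM].
      split; first by under eq_fun do rewrite big_cons; exact: bmeasD.
      under eq_Rintegral do rewrite big_cons.
      by rewrite RintegralD_bmeas// IH2 big_cons RintegralZ_bmeas//; exact: bmeasM.
    have [_ <-] := hs (index_enum _); apply: eq_Rintegral => w _.
    rewrite /step_fun mulr_sumr; apply: eq_bigr => j _.
    by rewrite mulrCA.
  have := ex _ bG => ->.
  have e1 : \int[P]_w step_fun setT g n (Y w) =
            \int[P]_w (1 * step_fun setT g n (Y w)).
    by apply: eq_Rintegral => w _; rewrite mul1r.
  rewrite e1 (ex (fun=> 1)); last exact: bmeas_cst.
  rewrite mulr_sumr; apply: eq_bigr => j _.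
  rewrite GA; last by apply: measurable_step_set => //; case: bg.
  rewrite mulrCA; congr (_ * (_ * _)).
  by apply: eq_Rintegral => w _; rewrite mul1r.
have [mg [K gK]] := bg; have [mG [L GL]] := bG.
have gY n : measurable_fun setT (fun w => step_fun setT g n (Y w)).
  by apply: (measurableT_comp _ mY); exact: measurable_step_fun.
have gb n w : `|step_fun setT g n (Y w)| <= K + 1.
  rewrite (le_trans (step_fun_le _ _ _))// lerD// invf_le1// ler1n//.
have c1 : (fun n => \int[P]_w (G w * step_fun setT g n (Y w))) @ \oo -->
          \int[P]_w (G w * g (Y w)).
  apply: (@Rintegral_bounded_cvg _ _ _ _ _ _ (L * (K + 1))).
  - by move=> n; exact: measurable_funM.
  - by apply: measurable_funM => //; exact: measurableT_comp.
  - by move=> n w; rewrite normrM ler_pM.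
  - by apply: aeW => w; apply: cvgM; [exact: cvg_cst|exact: step_fun_cvg].
have c2 : (fun n => a * \int[P]_w step_fun setT g n (Y w)) @ \oo -->
          a * \int[P]_w g (Y w).
  apply: cvgM; first exact: cvg_cst.
  apply: (@Rintegral_bounded_cvg _ _ _ _ _ _ (K + 1)) => //.
  - exact: measurableT_comp.
  - by apply: aeW => w; exact: step_fun_cvg.
have e : (fun n => \int[P]_w (G w * step_fun setT g n (Y w))) =
         (fun n => a * \int[P]_w step_fun setT g n (Y w)) by apply/funext.
by rewrite e in c1; apply: (cvg_unique _ c1 c2).
Qed.

Lemma cintegral_factor (G : T -> R[i]) (Y : T -> T') (a : R[i]) :
  cbmeas G -> measurable_fun setT Y ->
  (forall A, measurable A ->
     cintegral P (fun w => G w * (\1_A (Y w))%:C) =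
     a * cintegral P (fun w => (\1_A (Y w))%:C)) ->
  forall g, cbmeas g ->
    cintegral P (fun w => G w * g (Y w)) = a * cintegral P (fun w => g (Y w)).
Proof.
move=> [bG1 bG2] mY GA g [bg1 bg2].
have key A : measurable A ->
    \int[P]_w (Re (G w) * \1_A (Y w)) = Re a * \int[P]_w (\1_A (Y w)) /\
    \int[P]_w (Im (G w) * \1_A (Y w)) = Im a * \int[P]_w (\1_A (Y w)).
  move=> mA; have := congr1 (@complex.Im R) (GA A mA); have := congr1 (@complex.Re R) (GA A mA).
  rewrite cReM cImM/= Rintegral_prob_cst !mulr0 subr0 add0r.
  move=> <- <-; split; apply: eq_Rintegral => w _.
    by rewrite cReM/= mulr0 subr0.
  by rewrite cImM/= mulr0 add0r.
have e1 := Rintegral_factor bG1 mY (fun A mA => (key A mA).1).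
have e2 := Rintegral_factor bG2 mY (fun A mA => (key A mA).2).
have cg1 := bmeas_comp mY bg1; have cg2 := bmeas_comp mY bg2.
apply: complex_eqP; rewrite ?cReM ?cImM/=.
  under eq_Rintegral do rewrite cReM.
  rewrite RintegralB_bmeas; [|exact: bmeasM..].
  by rewrite (e1 _ bg1) (e2 _ bg2).
under eq_Rintegral do rewrite cImM.
rewrite RintegralD_bmeas; [|exact: bmeasM..].
by rewrite (e1 _ bg2) (e2 _ bg1).
Qed.

Lemma cintegral_indep n (Y : 'I_n -> T -> T') :
  (forall j, measurable_fun setT (Y j)) ->
  (forall A : 'I_n -> set T', (forall j, measurable (A j)) ->
    P (\bigcap_j (Y j @^-1` A j)) = (\prod_(j < n) P (Y j @^-1` A j))%E) ->
  forall g : 'I_n -> T' -> R[i], (forall j, cbmeas (g j)) ->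
  cintegral P (fun w => \prod_j g j (Y j w)) =
  \prod_j cintegral P (fun w => g j (Y j w)).
Proof.
move=> mY ind.
have mpre j (A : set T') : measurable A -> measurable (Y j @^-1` A).
  by move=> mA; rewrite -[X in measurable X]setTI; exact: mY.
(* Induction on the number [k] of indices at which the function may still be
   arbitrary instead of an indicator. *)
suff H k : forall g : 'I_n -> T' -> R[i], (forall j, cbmeas (g j)) ->
    (forall j : 'I_n, (k <= j)%N -> exists A, measurable A /\
       g j = fun y => (\1_A y)%:C) ->
    cintegral P (fun w => \prod_j g j (Y j w)) =
    \prod_j cintegral P (fun w => g j (Y j w)).
  by move=> g bg; apply: (H n) => // j; rewrite leqNgt ltn_ord.
elim: k => [|k IH] g bg gA.
  have {}gA j : exists A, measurable A /\ g j = fun y => (\1_A y)%:C by exact: gA.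
  have /choice[A HA] := gA.
  have mA j : measurable (A j) by case: (HA j).
  have gE j : g j = fun y => (\1_(A j) y)%:C by case: (HA j).
  have -> : (fun w => \prod_j g j (Y j w)) =
            fun w => ((\1_(\bigcap_j (Y j @^-1` A j)) w : R)%:C).
    apply/funext => w.
    under eq_bigr => j _ do rewrite gE.
    rewrite indicE; have [h|h] := boolP (w \in _).
      apply: big1 => j _; rewrite indicE mem_set//.
      by move/set_mem: h => /(_ j); exact.
    have [j jw] : exists j, ~ A j (Y j w).
      apply/existsNP => h'; move/negP: h; apply; apply/mem_set => j _; exact: h'.
    by rewrite (bigD1 j)//= indicE memNset// mul0r.
  have mI : measurable (\bigcap_j (Y j @^-1` A j)).
    by apply: fin_bigcap_measurable => // j _; exact: mpre.
  have e j : cintegral P (fun w => g j (Y j w)) = (fine (P (Y j @^-1` A j)))%:C.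
    rewrite gE; apply: complex_eqP => /=; last exact: Rintegral_prob_cst.
    rewrite -Rintegral_prob_indic; last exact: mpre.
    by apply: eq_Rintegral => w _.
  under [RHS]eq_bigr => j _ do rewrite e.
  rewrite -(rmorph_prod (real_complex R)).
  apply: complex_eqP => /=; last exact: Rintegral_prob_cst.
  rewrite Rintegral_prob_indic// ind//.
  have fp j : P (Y j @^-1` A j) = (fine (P (Y j @^-1` A j)))%:E.
    by rewrite fineK// fin_num_measure//; exact: mpre.
  rewrite (_ : (\prod_(j < n) _)%E = (\prod_(j < n) fine (P (Y j @^-1` A j)))%:E)//.
  by rewrite -prodEFin; apply: eq_bigr.
have [kn|nk] := ltnP k n; last first.
  apply: IH => // j kj; exfalso.
  by have := ltn_ord j; rewrite ltnNge (leq_trans nk kj).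
pose i := Ordinal kn.
pose u (A : set T') (j : 'I_n) := if j == i then (fun y => (\1_A y)%:C) else g j.
have indc A : measurable A -> cbmeas (fun y : T' => (\1_A y : R)%:C).
  by move=> mA; apply: cbmeas_real; exact: bmeas_indic.
have D1 (h : 'I_n -> T' -> R[i]) : (fun w => \prod_j h j (Y j w)) =
    fun w => (\prod_(j | j != i) h j (Y j w)) * h i (Y i w).
  by apply/funext => w; rewrite (bigD1 i)//= mulrC.
rewrite D1 (@cintegral_factor (fun w => \prod_(j | j != i) g j (Y j w)) (Y i)
  (\prod_(j | j != i) cintegral P (fun w => g j (Y j w))))//.
- by rewrite [RHS](bigD1 i)//= mulrC.
- by apply: cbmeas_prod => j; exact: cbmeas_comp.
move=> A mA.
have bu j : cbmeas (u A j) by rewrite /u; case: ifP => // _; exact: indc.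
have -> : (fun w => (\prod_(j | j != i) g j (Y j w)) * (\1_A (Y i w))%:C) =
          (fun w => \prod_j u A j (Y j w)).
  rewrite D1; apply/funext => w; rewrite {2}/u eqxx; congr (_ * _).
  by apply: eq_bigr => j /negbTE ji; rewrite /u ji.
have -> : (\prod_(j | j != i) cintegral P (fun w => g j (Y j w))) *
          cintegral P (fun w => (\1_A (Y i w))%:C) =
          \prod_j cintegral P (fun w => u A j (Y j w)).
  rewrite [RHS](bigD1 i)//= [RHS]mulrC {2}/u eqxx; congr (_ * _).
  by apply: eq_bigr => j /negbTE ji; rewrite /u ji.
apply: IH => // j kj; rewrite /u; case: ifP => [_|ji]; first by exists A.
apply: gA; rewrite ltn_neqAle kj andbT eq_sym.
by apply: contraFN ji => /eqP jk; apply/eqP/val_inj.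
Qed.

End independence.

(** * Borel structure of Euclidean space *)

Section euclidean_measurability.
Variables (R : realType) (d : nat).
Notation Rd := 'rV[R]_d.

Lemma continuous_measurable_rV (f : Rd -> R) :
  continuous f -> measurable_fun setT f.
Proof.
move=> /continuousP cf; apply: (measurability _ (RGenOpens.measurableE R)).
move=> _ [_ [a [b ->] <-]]; rewrite setTI; apply: sub_sigma_algebra.
exact/cf/interval_open.
Qed.

Lemma measurable_coord i : measurable_fun setT (fun x : Rd => x ord0 i).
Proof. by apply: continuous_measurable_rV; exact: coord_continuous. Qed.

(** Open sets are countable unions of open boxes with rational centre and
    radius, so the Borel structure of R^d is generated by the coordinates. *)
Lemma measurable_fun_rV d0 (T : measurableType d0) (f : T -> Rd) :
  (forall i, measurable_fun setT (fun w => f w ord0 i)) -> measurable_fun setT f.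
Proof.
move=> mf; apply: (@measurability _ _ _ _ setT f open erefl).
move=> _ [A oA <-]; rewrite setTI.
pose box (q : 'rV[rat]_d * rat) : set Rd :=
  [set x | forall i, `|x ord0 i - ratr (q.1 ord0 i)| < ratr q.2].
pose F (q : 'rV[rat]_d * rat) : set T :=
  if pselect (box q `<=` A) then f @^-1` box q else set0.
have -> : f @^-1` A = \bigcup_q F q.
  apply/seteqP; split=> w /=; last first.
    by move=> [q _]; rewrite /F; case: pselect => // sA; exact: sA.
  move=> Afw; have /nbhs_ballP[e /= e0 eA] : nbhs (f w) A by exact: open_nbhs_nbhs.
  have [r] := @rat_in_itvoo R 0 (e / 2) (divr_gt0 e0 (ltr0Sn _ 1)).
  rewrite in_itv/= => /andP[r0 re].
  have /choice[q Hq] : forall i, exists q : rat, `|f w ord0 i - ratr q| < ratr r.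
    move=> i; have [|q] := @rat_in_itvoo R (f w ord0 i - ratr r) (f w ord0 i + ratr r).
      by lra.
    by rewrite in_itv/= => /andP[q1 q2]; exists q; rewrite ltr_norml; apply/andP; split; lra.
  exists (\row_i q i, r) => //; rewrite /F.
  have fb : box (\row_i q i, r) (f w) by move=> i /=; rewrite mxE; exact: Hq.
  case: pselect => // h; exfalso; apply: h => x xb; apply: eA; split => // i j.
  rewrite (ord1 i) /ball/=; have := xb j; have := fb j; rewrite /= mxE => h1 h2.
  rewrite (_ : f w ord0 j - x ord0 j =
    (f w ord0 j - ratr (q j)) - (x ord0 j - ratr (q j))); last by ring.
  by apply: le_lt_trans (ler_normB _ _) _; lra.
apply: countable_bigcupT_measurable => [|q]; first exact: countableP.
rewrite /F; case: (pselect _) => /= [sA|_]; last exact: measurable0.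
have -> : f @^-1` box q = \bigcap_i ((fun w => f w ord0 i - ratr (q.1 ord0 i)) @^-1`
    [set y | `|y| < ratr q.2]).
  by apply/seteqP; split => [w h i _|w h i]; exact: h.
apply: fin_bigcap_measurable => // i _.
have m : measurable_fun setT (fun w => f w ord0 i - ratr (q.1 ord0 i)).
  by apply: measurable_funB => //; exact: measurable_cst.
rewrite -[X in measurable X]setTI; apply: m => //.
rewrite (_ : mkset _ = `](- ratr q.2), (ratr q.2)[%classic)//.
by apply/seteqP; split => y /=; rewrite in_itv/= ltr_norml.
Qed.

Lemma dotZl (c : R) (x y : Rd) : dot (c *: x) y = c * dot x y.
Proof. by rewrite /dot mulr_sumr; apply: eq_bigr => i _; rewrite mxE mulrA. Qed.

Lemma dotZr (c : R) (x y : Rd) : dot x (c *: y) = c * dot x y.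
Proof. by rewrite /dot mulr_sumr; apply: eq_bigr => i _; rewrite mxE mulrCA. Qed.

Lemma dotDr (x y z : Rd) : dot x (y + z) = dot x y + dot x z.
Proof. by rewrite /dot -big_split; apply: eq_bigr => i _; rewrite mxE mulrDr. Qed.

Lemma dot0r (x : Rd) : dot x 0 = 0.
Proof. by rewrite /dot big1// => i _; rewrite mxE mulr0. Qed.

Lemma dot_sumr (x : Rd) (I : Type) (r : seq I) (Q : pred I) (h : I -> Rd) :
  dot x (\sum_(i <- r | Q i) h i) = \sum_(i <- r | Q i) dot x (h i).
Proof. by apply: (big_morph _ (dotDr x) (dot0r x)). Qed.

Lemma dot_delta (i : 'I_d) (x : Rd) : dot (delta_mx ord0 i) x = x ord0 i.
Proof.
rewrite /dot (bigD1 i)//= big1 => [|j ji]; rewrite mxE eqxx/=.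
  by rewrite eqxx mul1r addr0.
by rewrite (negbTE ji) mul0r.
Qed.

Lemma measurable_dot d0 (T : measurableType d0) (z : Rd) (f : T -> Rd) :
  measurable_fun setT f -> measurable_fun setT (fun w => dot z (f w)).
Proof.
move=> mf; apply: measurable_sum => i; apply: measurable_funM; first exact: measurable_cst.
by apply: (measurableT_comp (measurable_coord i)).
Qed.

Lemma cvg_coord (u : nat -> Rd) (l : Rd) i :
  u @ \oo --> l -> (fun n => u n ord0 i) @ \oo --> l ord0 i.
Proof. move=> ul; apply: (@cvg_comp _ _ _ u (fun M : Rd => M ord0 i) _ _ _ ul).
exact: coord_continuous. Qed.

Lemma cvg_dot (z : Rd) (u : nat -> Rd) (l : Rd) :
  u @ \oo --> l -> (fun n => dot z (u n)) @ \oo --> dot z l.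
Proof.
move=> ul; apply: (@cvg_big _ _ +%R 0 xpredT); first exact: add_continuous.
by move=> i _; apply: cvgM; [exact: cvg_cst | exact: cvg_coord].
Qed.

End euclidean_measurability.

(** * Bounded Borel sets *)

Section bounded_borel.
Variable R : realType.
Implicit Types A B : set R.

Lemma bounded_borel0 : @bounded_borel R set0.
Proof. by split => //; exists 0; split => // x _ y []. Qed.

Lemma bounded_borel_sub A B : measurable A -> A `<=` B -> bounded_borel B ->
  bounded_borel A.
Proof.
move=> mA AB [_ [M [Mr h]]]; split => //; exists M; split => // x Mx y Ay.
by apply: h => //; exact: AB.
Qed.

Lemma bounded_borelU A B : bounded_borel A -> bounded_borel B ->
  bounded_borel (A `|` B).
Proof.
move=> [mA [M [Mr hA]]] [mB [N [Nr hB]]]; split; first exact: measurableU.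
exists (Num.max M N); split; first exact: num_real.
by move=> x; rewrite gt_max => /andP[Mx Nx] y [/hA|/hB]; exact.
Qed.

Lemma bounded_borel_itv (x y : R) b1 b2 :
  bounded_borel [set` Interval (BSide b1 x) (BSide b2 y)].
Proof.
split => //; exists (Num.max `|x| `|y|); split; first exact: num_real.
move=> M; rewrite gt_max => /andP[xM yM] z /=; rewrite in_itv/= => /andP[xz zy].
have {}xz : x <= z by case: b1 xz => // /ltW.
have {}zy : z <= y by case: b2 zy => // /ltW.
rewrite ler_norml; apply/andP; split.
  by move: xM; rewrite ltr_norml; lra.
by move: yM; rewrite ltr_norml; lra.
Qed.

Lemma bounded_borel_set1 (x : R) : bounded_borel [set x].
Proof. by rewrite -set_itv1; exact: bounded_borel_itv. Qed.

Lemma bounded_borel_bigsetU (I : Type) (r : seq I) (Q : pred I) (F : I -> set R) :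
  (forall i, bounded_borel (F i)) ->
  bounded_borel (\big[setU/set0]_(i <- r | Q i) F i).
Proof.
move=> bF; elim/big_ind : _ => //; [exact: bounded_borel0|exact: bounded_borelU].
Qed.

Lemma bounded_borel_sub_itv A : bounded_borel A ->
  exists n : nat, A `<=` `](- n.+1%:R), n.+1%:R].
Proof.
move=> [mA [M [Mr h]]].
exists (Num.truncn (`|M| + 1)) => x Ax /=; rewrite in_itv/=.
have hx : `|x| <= `|M| + 1 by apply: h => //; rewrite (le_lt_trans (ler_norm _))// ltrDl.
have := truncnS_gt (`|M| + 1) => h2.
have : `|x| < (Num.truncn (`|M| + 1)).+1%:R by exact: le_lt_trans h2.
by rewrite ltr_norml => /andP[-> /ltW ->].
Qed.

Lemma fin_num_bounded_borel A : bounded_borel A ->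
  (@lebesgue_measure R A) \is a fin_num.
Proof.
move=> bA; have [n An] := bounded_borel_sub_itv bA.
rewrite ge0_fin_numE//; apply: (@le_lt_trans _ _
   (lebesgue_measure `](- n.+1%:R : R), n.+1%:R])).
  by apply: le_measure => //; rewrite inE//; case: bA.
by rewrite lebesgue_measure_itv/=; case: ifP => // _; rewrite -EFinB ltry.
Qed.

End bounded_borel.

(** * Convergence of characteristic functions *)

Definition ccvg (R : realType) (u : nat -> R[i]) (l : R[i]) :=
  (fun n => Re (u n)) @ \oo --> Re l /\
  (fun n => Im (u n)) @ \oo --> Im l.

Lemma cvg_seq_continuous (R : realType) (h : R -> R) (u : nat -> R) (l : R) :
  continuous h -> u @ \oo --> l -> (fun n => h (u n)) @ \oo --> h l.
Proof. by move=> ch ul; apply: continuous_cvg => //; exact: ch. Qed.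

Section complex_limits.
Variable R : realType.
Implicit Types (u v : nat -> R[i]) (l m : R[i]).

Lemma ccvg_unique u l m : ccvg u l -> ccvg u m -> l = m.
Proof.
by move=> [l1 l2] [m1 m2]; apply: complex_eqP; [apply: cvg_unique l1 m1|apply: cvg_unique l2 m2].
Qed.

Lemma ccvg_cexpM (t_ : nat -> R) (t : R) (c : R[i]) :
  t_ @ \oo --> t -> ccvg (fun n => cexp ((t_ n)%:C * c)) (cexp (t%:C * c)).
Proof.
move=> tt.
have e (x : R) : (x%:C * c) = (x * Re c) +i* (x * Im c).
  by case: c => a b; apply: complex_eqP; rewrite ?cReM ?cImM/= mul0r ?subr0 ?addr0.
have m (a : R) : (fun n => t_ n * a) @ \oo --> t * a.
  by apply: cvgM => //; exact: cvg_cst.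
split; under eq_fun do rewrite e cexpE/=; rewrite e cexpE/=.
  apply: cvgM; [apply: (cvg_seq_continuous _ (m _)); exact: continuous_expR|].
  by apply: (cvg_seq_continuous _ (m _)); exact: continuous_cos.
apply: cvgM; [apply: (cvg_seq_continuous _ (m _)); exact: continuous_expR|].
by apply: (cvg_seq_continuous _ (m _)); exact: continuous_sin.
Qed.

Context d (T : measurableType d) (P : probability T R).

(** Characteristic function of a real random variable at [s]. *)
Definition cfun (Y : T -> R) (s : R) : R[i] :=
  cintegral P (fun w => cexp (0 +i* (s * Y w))).

Lemma cfunE Y s : cfun Y s =
  (\int[P]_w cos (s * Y w)) +i* (\int[P]_w sin (s * Y w)).
Proof.
rewrite /cfun /cintegral; congr (_ +i* _); apply: eq_Rintegral => w _;
  by rewrite cexpE/= expR0 mul1r.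
Qed.

Lemma ccvg_cfun (Y_ : nat -> T -> R) (Y : T -> R) (s_ : nat -> R) (s : R) :
  (forall n, measurable_fun setT (Y_ n)) -> measurable_fun setT Y ->
  s_ @ \oo --> s ->
  {ae P, forall w, Y_ ^~ w @ \oo --> Y w} ->
  ccvg (fun n => cfun (Y_ n) (s_ n)) (cfun Y s).
Proof.
move=> mY_ mY ss YY.
have m (a : R) Z : measurable_fun setT Z -> measurable_fun setT (fun w : T => a * Z w).
  by move=> mZ; apply: measurable_funM => //; exact: measurable_cst.
split; under eq_fun do rewrite cfunE/=; rewrite cfunE/=.
  apply: (@Rintegral_bounded_cvg _ _ _ _ _ _ 1).
  - by move=> n; case: (bmeas_cos (m (s_ n) _ (mY_ n))).
  - by case: (bmeas_cos (m s _ mY)).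
  - by move=> n w; exact: cos_max.
  - apply: filterS YY => w Yw.
    apply: (@cvg_seq_continuous _ cos (fun n => s_ n * Y_ n w)).
      exact: continuous_cos.
    exact: cvgM.
apply: (@Rintegral_bounded_cvg _ _ _ _ _ _ 1).
- by move=> n; case: (bmeas_sin (m (s_ n) _ (mY_ n))).
- by case: (bmeas_sin (m s _ mY)).
- by move=> n w; exact: sin_max.
- apply: filterS YY => w Yw.
  apply: (@cvg_seq_continuous _ sin (fun n => s_ n * Y_ n w)).
    exact: continuous_sin.
  exact: cvgM.
Qed.

Lemma cfun_continuous (Y : T -> R) : measurable_fun setT Y ->
  continuous (fun s => Re (cfun Y s)) /\
  continuous (fun s => Im (cfun Y s)).
Proof.
move=> mY; split => s; apply/(@cvg_nbhsP _ R^o) => s_ ss.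
  have [h _] := @ccvg_cfun (fun=> Y) Y s_ s (fun=> mY) mY ss (aeW _ (fun w => cvg_cst _)).
  exact: h.
have [_ h] := @ccvg_cfun (fun=> Y) Y s_ s (fun=> mY) mY ss (aeW _ (fun w => cvg_cst _)).
exact: h.
Qed.

Lemma cbmeas_cfun (Y : T -> R) s : measurable_fun setT Y ->
  cbmeas (fun w => cexp (0 +i* (s * Y w))).
Proof.
by move=> mY; apply: cbmeas_cis; apply: measurable_funM.
Qed.

Lemma eq_cfun (Y Z : T -> R) s : measurable_fun setT Y -> measurable_fun setT Z ->
  {ae P, forall w, Y w = Z w} -> cfun Y s = cfun Z s.
Proof.
move=> mY mZ YZ; apply: eq_cintegral_ae; [exact: cbmeas_cfun..|].
by apply: filterS YZ => w ->.
Qed.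

End complex_limits.

(** * Characteristic functions of a random measure *)

Section random_measure_charfun.
Variables (R : realType) (d : nat) (mu : probability 'rV[R]_d R).
Variables (X : set_indexed_rvs R d) (HX : is_random_measure mu X).
Notation Rd := 'rV[R]_d.
Notation P := (rm_prob X).
Implicit Types A B : set R.

Lemma rm_measurable B : measurable_fun setT (X B).
Proof. exact: measurable_funPT. Qed.

(** Sigma-additivity for a sequence of empty sets makes the partial sums of a
    constant sequence converge. *)
Lemma rm_set0 : {ae P, forall w, X set0 w = 0}.
Proof.
have := rm_sigma_additive HX (fun _ : nat => bounded_borel0 R)
  (@trivIset_set0 _ _ _).
rewrite bigcup0// => /(_ (proj2 (bounded_borel0 R))).
apply: filterS => w h; apply/rowP => i; rewrite mxE.
have {h} := @cvg_coord _ _ _ _ i h; set v := X set0 w ord0 i => h.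
have h1 : (fun n => \sum_(k < n) v) @ \oo --> v.
  by apply: cvg_trans h; apply: near_eq_cvg; apply: nearW => n; rewrite summxE.
have h2 : (fun n => \sum_(k < n.+1) v) @ \oo --> v.
  by rewrite (cvg_shiftS (fun n => \sum_(k < n) v)).
have h3 : (fun n => \sum_(k < n.+1) v - \sum_(k < n) v) @ \oo --> v - v.
  exact: cvgB.
rewrite subrr (_ : (fun n => _) = (fun=> v)) in h3.
  exact: (cvg_unique _ (cvg_cst v) h3).
by apply/funext => n; rewrite big_ord_recr/= addrAC subrr add0r.
Qed.

Lemma rm_additive A B : bounded_borel A -> bounded_borel B -> A `&` B = set0 ->
  {ae P, forall w, X (A `|` B) w = X A w + X B w}.
Proof.
move=> bA bB AB.
have bb n : bounded_borel (bigcup2 A B n).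
  by case: n => [//|[//|n]]; exact: bounded_borel0.
have tr : trivIset setT (bigcup2 A B) by rewrite -trivIset_bigcup2.
have := rm_sigma_additive HX bb tr.
rewrite bigcup2E => /(_ (proj2 (bounded_borelU bA bB))).
apply: filterS2 rm_set0 => w w0 h; apply: (cvg_unique (@norm_hausdorff _ _) h).
apply: cvg_near_cst; exists 2%N => // -[//|[//|n]] _ /=.
by rewrite !big_ord_recl/= big1 ?addr0// => i _.
Qed.

Lemma rm_bigsetU (I : choiceType) (r : seq I) (F : I -> set R) : uniq r ->
  (forall i, bounded_borel (F i)) -> trivIset setT F ->
  {ae P, forall w, X (\big[setU/set0]_(i <- r) F i) w = \sum_(i <- r) X (F i) w}.
Proof.
move=> + bF tF; elim: r => [_|i r IH /= /andP[ir ur]].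
  by apply: filterS rm_set0 => w; rewrite !big_nil.
have tr : F i `&` \big[setU/set0]_(j <- r) F j = set0.
  rewrite -subset0 => x [xi]; rewrite -bigcup_seq => -[j /= jr xj].
  have ij : i = j by apply: tF => //; exists x.
  by move: ir; rewrite ij jr.
have := rm_additive (bF i) (bounded_borel_bigsetU r xpredT bF) tr.
by apply: filterS2 (IH ur) => w h1 h2; rewrite !big_cons h2 h1.
Qed.

(** The increments of [F] are disjoint, and the partial sums of their values are
    the values on the sets [F n]. *)
Lemma rm_bigcup F : (forall n, bounded_borel (F n)) ->
  {homo F : n m / (n <= m)%N >-> (n <= m)%O} -> bounded_borel (\bigcup_n F n) ->
  {ae P, forall w, (fun n => X (F n) w) @ \oo --> X (\bigcup_n F n) w}.
Proof.
move=> bF nF bU.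
have bD n : bounded_borel (seqD F n).
  case: n => [|n] //=; apply: (bounded_borel_sub _ _ (bF n.+1)); last exact: subDsetl.
  by apply: measurableD; case: (bF n); case: (bF n.+1).
have tD := trivIset_seqD nF.
have := rm_sigma_additive HX bD tD; rewrite eq_bigcup_seqD => /(_ (proj2 bU)).
have ad n : {ae P, forall w, X (F n) w = \sum_(k < n.+1) X (seqD F k) w}.
  have := @rm_bigsetU nat (iota 0 n.+1) (seqD F) (iota_uniq _ _) bD tD.
  apply: filterS => w; rewrite -(big_mkord xpredT (fun k => X (seqD F k) w)).
  rewrite /index_iota subn0 => <-.
  by rewrite -(nondecreasing_bigsetU_seqD n nF) -(big_mkord xpredT) /index_iota subn0.
have {}ad := (ae_foralln ad).
apply: filterS2 ad => w h1 h2.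
rewrite (_ : (fun n => _) = (fun n => \sum_(k < n.+1) X (seqD F k) w)).
  by rewrite (cvg_shiftS (fun n => \sum_(k < n) X (seqD F k) w)).
by apply/funext => n; exact: h1.
Qed.

Variable z : Rd.

Lemma measurable_dot_rm B : measurable_fun setT (fun w => dot z (X B w)).
Proof. by apply: measurable_dot; exact: rm_measurable. Qed.

Definition rm_cfun B (s : R) : R[i] := cfun P (fun w => dot z (X B w)) s.

(** Independent scattering turns linear combinations over disjoint sets into
    products of characteristic functions. *)
Lemma cfun_lin_comb (I : finType) (D : I -> set R) (c : I -> R) (s : R) :
  (forall i, bounded_borel (D i)) -> trivIset setT D ->
  cfun P (fun w => dot z (\sum_i c i *: X (D i) w)) s =
  \prod_i rm_cfun (D i) (s * c i).
Proof.
move=> bD tD.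
pose Y (j : 'I_#|I|) := X (D (enum_val j)).
pose g (j : 'I_#|I|) (x : Rd) : R[i] := cexp (0 +i* (s * c (enum_val j) * dot z x)).
have mg j : cbmeas (g j).
  by apply: (@cbmeas_cfun _ _ _ (fun x => dot z x)); exact: measurable_dot.
have ind (A : 'I_#|I| -> set Rd) : (forall j, measurable (A j)) ->
    P (\bigcap_j (Y j @^-1` A j)) = (\prod_(j < #|I|) P (Y j @^-1` A j))%E.
  move=> mA; apply: (rm_independent HX) => // i j _ _ [x xij].
  by apply: enum_val_inj; apply: tD => //; exists x.
have := @cintegral_indep _ _ _ _ _ P _ Y (fun j => rm_measurable _) ind g mg.
rewrite -(big_enum_val (fun i : I => cintegral P (fun w =>
   cexp (0 +i* (s * c i * dot z (X (D i) w)))))).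
move=> <-; congr (cintegral _ _); apply/funext => w.
rewrite -(big_enum_val (fun i : I => cexp (0 +i* (s * c i * dot z (X (D i) w))))).
rewrite -cexp_sum; congr cexp.
rewrite dot_sumr mulr_sumr.
rewrite (@big_morph _ _ (fun x : R => 0 +i* x) 0 +%R 0 +%R)//.
  apply: eq_bigr => i _; by rewrite dotZr mulrA.
by move=> x y; apply: complex_eqP; rewrite ?cReD ?cImD/= ?addr0.
Qed.

Lemma rm_cfunU A B s : bounded_borel A -> bounded_borel B -> A `&` B = set0 ->
  rm_cfun (A `|` B) s = rm_cfun A s * rm_cfun B s.
Proof.
move=> bA bB AB.
pose D (b : bool) := if b then A else B.
have bD b : bounded_borel (D b) by case: b.
have tD : trivIset setT D.
  by move=> [] [] _ _ [x [xa xb]] //; exfalso; have : (A `&` B) x by []; rewrite AB.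
have := cfun_lin_comb (fun=> 1) s bD tD; rewrite big_bool/= mulr1 => <-.
apply: eq_cfun; [exact: measurable_dot_rm| |].
  apply: measurable_dot; apply: measurable_fun_rV => i.
  have -> : (fun w => (\sum_b 1 *: X (D b) w) ord0 i) =
    (fun w => X A w ord0 i + X B w ord0 i).
    by apply/funext => w; rewrite big_bool/= !scale1r mxE.
  by apply: measurable_funD; apply: (measurableT_comp (measurable_coord i));
    exact: rm_measurable.
by apply: filterS (rm_additive bA bB AB) => w ->; rewrite big_bool/= !scale1r.
Qed.

Lemma rm_cfun0 s : rm_cfun set0 s = 1.
Proof.
rewrite -(cintegral_cst P 1) -cexp0; apply: eq_cintegral_ae.
- by apply: cbmeas_cfun; exact: measurable_dot_rm.
- exact: cbmeas_cst.
by apply: filterS rm_set0 => w ->; rewrite dot0r mulr0.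
Qed.

Lemma rm_cfun_set1 t s : rm_cfun [set t] s = 1.
Proof.
rewrite -(cintegral_cst P 1) -cexp0; apply: eq_cintegral_ae.
- by apply: cbmeas_cfun; exact: measurable_dot_rm.
- exact: cbmeas_cst.
by apply: filterS (rm_no_atom HX t) => w ->; rewrite dot0r mulr0.
Qed.

Lemma rm_cfun_bigcup F s : (forall n, bounded_borel (F n)) ->
  {homo F : n m / (n <= m)%N >-> (n <= m)%O} -> bounded_borel (\bigcup_n F n) ->
  ccvg (fun n => rm_cfun (F n) s) (rm_cfun (\bigcup_n F n) s).
Proof.
move=> bF nF bU; apply: ccvg_cfun; [|exact: measurable_dot_rm|exact: cvg_cst|].
  by move=> n; exact: measurable_dot_rm.
by apply: filterS (rm_bigcup bF nF bU) => w; exact: cvg_dot.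
Qed.

End random_measure_charfun.

Section laws.
Context d (T : measurableType d) (R : realType).

Lemma eq_cintegral_law (m1 m2 : probability T R) (g : T -> R[i]) :
  (forall A, measurable A -> m1 A = m2 A) -> cintegral m1 g = cintegral m2 g.
Proof.
move=> m12; congr (_ +i* _); congr fine;
  by apply: eq_measure_integral => A mA _; exact: m12.
Qed.

Lemma cintegral_distribution d' (T' : measurableType d') (P : probability T' R)
  (Y : {RV P >-> T}) (g : T -> R[i]) : cbmeas g ->
  cintegral (distribution P Y) g = cintegral P (fun w => g (Y w)).
Proof.
move=> [g1 g2].
have aux (h : T -> R) : bmeas h ->
    \int[distribution P Y]_x h x = \int[P]_w h (Y w).
  move=> bh; congr fine; rewrite integral_distribution//.
    by apply/measurable_EFinP; case: bh.
  exact: (bmeas_integrable P (bmeas_comp (measurable_funPT Y) bh)).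
by rewrite /cintegral (aux _ g1) (aux _ g2).
Qed.

End laws.

Section random_measure_stationary.
Variables (R : realType) (d : nat) (mu : probability 'rV[R]_d R).
Variables (X : set_indexed_rvs R d) (HX : is_random_measure mu X).
Notation P := (rm_prob X).
Variable z : 'rV[R]_d.

Lemma rm_cfun_law B s : rm_cfun X z B s =
  cintegral (distribution P (X B)) (fun x => cexp (0 +i* (s * dot z x))).
Proof.
rewrite cintegral_distribution//; apply: (@cbmeas_cfun _ _ _ (fun x => dot z x)).
exact: measurable_dot.
Qed.

Lemma rm_cfun_shift B t s : bounded_borel B ->
  rm_cfun X z [set x + t | x in B] s = rm_cfun X z B s.
Proof.
move=> bB; rewrite !rm_cfun_law; apply: eq_cintegral_law => A mA.
exact: (rm_homogeneous HX).
Qed.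

Lemma rm_cfun_unit t s : rm_cfun X z `]t, t + 1] s =
  charfun mu (s *: z).
Proof.
rewrite rm_cfun_law /charfun.
under [X in _ = cintegral _ X]eq_fun do rewrite dotZl.
by apply: eq_cintegral_law => A mA; exact: (rm_unit_law HX).
Qed.

End random_measure_stationary.

(** * Complex logarithms *)

Section complex_log.
Variable R : realType.
Implicit Types (t : R) (w c : R[i]).

Lemma cscaleE t c : t%:C * c = (t * Re c) +i* (t * Im c).
Proof. by apply: complex_eqP; rewrite ?cReM ?cImM/= mul0r ?subr0 ?addr0. Qed.

(** The principal logarithm on the right half plane, where the argument is the
    arc tangent of the slope. *)
Definition clog w : R[i] :=
  ln (Num.sqrt (Re w ^+ 2 + Im w ^+ 2)) +i* atan (Im w / Re w).

Lemma clogK w : 0 < Re w -> cexp (clog w) = w.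
Proof.
case: w => x y /= x0; rewrite cexpE/=.
have N0 : 0 < x ^+ 2 + y ^+ 2 by rewrite ltr_pwDl ?exprn_gt0 ?sqr_ge0.
rewrite lnK ?posrE ?sqrtr_gt0//.
have c0 : cos (atan (y / x)) = x / Num.sqrt (x ^+ 2 + y ^+ 2).
  rewrite cos_atan.
  have -> : 1 + (y / x) ^+ 2 = (x ^+ 2 + y ^+ 2) / x ^+ 2.
    by field; exact: lt0r_neq0.
  rewrite sqrtrM ?(ltW N0)// sqrtrV ?sqr_ge0// sqrtr_sqr ger0_norm ?(ltW x0)//.
  by rewrite invfM invrK mulrC.
have s0 : sin (atan (y / x)) = y / x * cos (atan (y / x)).
  rewrite -{2}(atanK (y / x)) /tan divfK// c0 mulf_neq0 ?invr_neq0 ?lt0r_neq0//.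
  by rewrite sqrtr_gt0.
have q0 : Num.sqrt (x ^+ 2 + y ^+ 2) != 0 by rewrite lt0r_neq0// sqrtr_gt0.
rewrite s0 c0; apply: complex_eqP => /=; field => //.
by rewrite q0 lt0r_neq0.
Qed.

Lemma csqr_inj w1 w2 : 0 < Re w1 -> 0 < Re w2 -> w1 ^+ 2 = w2 ^+ 2 -> w1 = w2.
Proof.
move=> h1 h2 /eqP; rewrite -subr_eq0 subr_sqr mulf_eq0 subr_eq0 => /orP[/eqP//|].
move=> /eqP/(congr1 (@complex.Re R)); rewrite cReD /= => h.
by exfalso; lra.
Qed.

(** The one-parameter semigroup [t -> exp (t c)] determines [c], although
    [exp c] alone does not. *)
Lemma cexp_semigroup_inj c1 c2 :
  (forall t, 0 <= t -> cexp (t%:C * c1) = cexp (t%:C * c2)) -> c1 = c2.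
Proof.
move=> h; pose a := Re c1 - Re c2; pose b := Im c1 - Im c2.
have e t : 0 <= t -> expR (t * a) * cos (t * b) = 1 /\ expR (t * a) * sin (t * b) = 0.
  move=> t0; have : cexp (t%:C * (c1 - c2)) = 1.
    apply: (mulIf (cexp_neq0 (t%:C * c2))).
    by rewrite -cexpD -mulrDr subrK mul1r; exact: h.
  rewrite cscaleE cexpE => /= -[].
  have -> : Re (c1 - c2) = a by rewrite /a; case: (c1) (c2) => [? ?] [? ?].
  have -> : Im (c1 - c2) = b by rewrite /b; case: (c1) (c2) => [? ?] [? ?].
  by [].
have b0 : b = 0.
  apply/eqP; apply/negPn/negP => bn0.
  have p : 0 <= pi / `|b| by rewrite divr_ge0 ?pi_ge0.
  have [h1 _] := e _ p.
  have hc : cos (pi / `|b| * b) = -1.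
    have [bp|bn] := leP 0 b.
      by rewrite ger0_norm// (_ : pi / b * b = pi) ?cospi//; field.
    by rewrite ltr0_norm// (_ : pi / - b * b = - pi) ?cosN ?cospi//; field.
  move: h1; rewrite hc mulrN1 => h1.
  by have := expR_gt0 (pi / `|b| * a); lra.
have a0 : a = 0.
  have [h1 _] := e 1 ler01; move: h1; rewrite b0 mulr0 cos0 mulr1 mul1r => h1.
  by apply: expR_inj; rewrite h1 expR0.
apply: complex_eqP; apply/eqP; rewrite -subr_eq0; apply/eqP.
  exact: a0.
exact: b0.
Qed.

Lemma continuous_clog (g : R -> R[i]) s :
  {for s, continuous (fun x => Re (g x))} -> {for s, continuous (fun x => Im (g x))} ->
  0 < Re (g s) ->
  {for s, continuous (fun x => Re (clog (g x)))} /\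
  {for s, continuous (fun x => Im (clog (g x)))}.
Proof.
move=> c1 c2 g0; split => /=.
  have N0 : 0 < Num.sqrt (Re (g s) ^+ 2 + Im (g s) ^+ 2).
    by rewrite sqrtr_gt0 ltr_pwDl ?exprn_gt0 ?sqr_ge0.
  apply: (@continuous_comp _ _ _ (fun x => Num.sqrt (Re (g x) ^+ 2 + Im (g x) ^+ 2)) (@ln R)).
    apply: (@continuous_comp _ _ _ (fun x => Re (g x) ^+ 2 + Im (g x) ^+ 2) Num.sqrt).
      apply: continuousD.
        apply: (@continuous_comp _ _ _ (fun x => Re (g x)) (fun y => y ^+ 2)) => //.
        exact: exprn_continuous.
      apply: (@continuous_comp _ _ _ (fun x => Im (g x)) (fun y => y ^+ 2)) => //.
      exact: exprn_continuous.
    exact: sqrt_continuous.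
  exact: continuous_ln.
apply: (@continuous_comp _ _ _ (fun x => Im (g x) / Re (g x)) (@atan R)).
  by apply: continuousM => //; apply: continuousV => //; exact: lt0r_neq0.
exact: continuous_atan.
Qed.

End complex_log.

(** * The exponent of a random measure *)

Section levy_exponent.
Variables (R : realType) (d : nat) (mu : probability 'rV[R]_d R).
Variables (X : set_indexed_rvs R d) (HX : is_random_measure mu X).
Variable z : 'rV[R]_d.
Notation P := (rm_prob X).

Let m t s := rm_cfun X z `]0, t] s.
Let hp j : R := (2 ^+ j)^-1.

Let hp_gt0 j : 0 < hp j. Proof. by rewrite invr_gt0 exprn_gt0. Qed.

Let hpS j : hp j = hp j.+1 + hp j.+1.
Proof. by rewrite /hp exprS; field; exact: expf_neq0. Qed.

Let rm_cfun_itv x y s : x <= y -> rm_cfun X z `]x, y] s = m (y - x) s.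
Proof.
move=> xy; rewrite /m -(@rm_cfun_shift _ _ _ _ HX z `]0, y - x] x); last exact: bounded_borel_itv.
congr (rm_cfun X z _ s); apply/seteqP; split => u /=.
  rewrite in_itv/= => /andP[xu uy]; exists (u - x); last by rewrite subrK.
  by rewrite in_itv/=; apply/andP; split; lra.
by move=> [v + <-]; rewrite !in_itv/= => /andP[v0 v1]; apply/andP; split; lra.
Qed.

Let mD t u s : 0 <= t -> 0 <= u -> m (t + u) s = m t s * m u s.
Proof.
move=> t0 u0.
have := @rm_cfun_itv t (t + u) s; rewrite addrAC subrr add0r lerDl => /(_ u0) <-.
rewrite /m -(rm_cfunU HX); [|exact: bounded_borel_itv..|].
  congr (rm_cfun X z _ s); apply/seteqP; split => x /=; rewrite !in_itv/=.
    move=> /andP[x0 xt]; have [h|h] := leP x t; [left|right]; last by rewrite xt.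
    by rewrite x0.
  by move=> [|] /andP[h1 h2]; apply/andP; split; lra.
rewrite -subset0 => x [] /=; rewrite !in_itv/= => /andP[h1 h2] /andP[h3 h4].
by lra.
Qed.

Let m0 s : m 0 s = 1.
Proof. by rewrite /m set_itv_ge ?(rm_cfun0 HX)// bnd_simp ltxx. Qed.

Let mX k t s : 0 <= t -> m (k%:R * t) s = m t s ^+ k.
Proof.
move=> t0; elim: k => [|k IH]; first by rewrite mul0r m0 expr0.
by rewrite -natr1 mulrDl mul1r mD ?IH ?exprSr// mulr_ge0.
Qed.

(** Stochastic continuity: [X(]0, 2^-j])] tends to zero almost surely, so its
    characteristic function tends to one uniformly on compact sets. *)
Let rm_small : {ae P, forall w, (fun j => dot z (X `]0, hp j]%classic w)) @ \oo --> (0 : R)}.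
Proof.
pose F n : set R := `]hp n, 1]%classic.
have hp_le i j : (i <= j)%N -> hp j <= hp i.
  by move=> ij; rewrite /hp lef_pV2 ?posrE ?exprn_gt0// ler_eXn2l// ltr1n.
have hp1 n : hp n <= 1 by rewrite -[leRHS]/(1 : R) -(invr1 R) -(expr0 (2 : R)) hp_le.
have nF : {homo F : n k / (n <= k)%N >-> (n <= k)%O}.
  move=> i j ij; apply/subsetPset => x; rewrite /F/= !in_itv/= => /andP[h ->].
  by rewrite andbT (le_lt_trans _ h)// hp_le.
have UF : \bigcup_n F n = `]0, 1]%classic.
  apply/seteqP; split => x /=.
    by move=> [n _]; rewrite /F/= !in_itv/= => /andP[h ->]; rewrite (lt_trans _ h).
  rewrite in_itv/= => /andP[x0 x1].
  have [n _ hn] := near_infty_natSinv_expn_lt (PosNum x0).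
  exists n => //; rewrite /F/= in_itv/= x1 andbT.
  by have := hn n (leqnn n); rewrite div1r.
have bF n : bounded_borel (F n) by exact: bounded_borel_itv.
have bU : bounded_borel (\bigcup_n F n) by rewrite UF; exact: bounded_borel_itv.
have h1 := rm_bigcup HX bF nF bU.
have h2 n : {ae P, forall w, X `]0, 1]%classic w = X `]0, hp n]%classic w + X (F n) w}.
  have e : `]0, 1]%classic = `]0, hp n]%classic `|` F n.
    apply/seteqP; split => x; rewrite /F/= !in_itv/=.
      move=> /andP[x0 x1]; have [h|h] := leP x (hp n); [left|right]; last by rewrite x1.
      by rewrite x0.
    have := hp1 n; have := hp_gt0 n => h3 h4.
    by move=> [|] /andP[h5 h6]; apply/andP; split; lra.
  rewrite e; apply: (rm_additive HX); [exact: bounded_borel_itv..|].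
  rewrite -subset0 => x []; rewrite /F/= !in_itv/= => /andP[_ h3] /andP[h4 _].
  by have := lt_le_trans h4 h3; rewrite ltxx.
apply: filterS2 h1 (ae_foralln h2) => w h1 h2'.
have h3 : (fun n => dot z (X `]0, 1]%classic w) - dot z (X (F n) w)) @ \oo --> (0 : R).
  have h3 := @cvg_dot _ _ z _ _ h1; rewrite UF in h3.
  have h4 : (fun=> dot z (X `]0, 1]%classic w)) @ \oo --> dot z (X `]0, 1]%classic w).
    exact: cvg_cst.
  by have := cvgB h4 h3; rewrite subrr; exact.
rewrite (_ : (fun j => _) = (fun n => dot z (X `]0, 1]%classic w) - dot z (X (F n) w)))//.
by apply/funext => n; rewrite (h2' n) dotDr addrK.
Qed.

(** The function [min 2 (2 S |y|)] is continuous and dominates [1 - cos (s y)] and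
    [|sin (s y)|] for all [|s| <= S] at once. *)
Let m_small (S e : R) : 0 < S -> 0 < e -> exists J : nat, forall j s, (J <= j)%N ->
  `|s| <= S -> `|1 - Re (m (hp j) s)| <= e /\ `|Im (m (hp j) s)| <= e.
Proof.
move=> S0 e0.
pose b (y : R) := Num.min 2 (2 * S * `|y|).
pose Y j w := dot z (X `]0, hp j]%classic w).
have mY j : measurable_fun setT (Y j) by exact: measurable_dot_rm.
have mb j : measurable_fun setT (fun w => b (Y j w)).
  apply: measurable_minr; first exact: measurable_cst.
  by apply: measurable_funM => //; exact: measurableT_comp.
have b01 y : 0 <= b y <= 2.
  by rewrite le_min ler0n ge_min lexx/= !mulr_ge0// ltW.
have h : (fun j => \int[P]_w b (Y j w)) @ \oo --> \int[P]_w (0 : R).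
  apply: (@Rintegral_bounded_cvg _ _ _ _ _ _ 2) => //.
    by move=> n w; have /andP[? ?] := b01 (Y n w); rewrite ger0_norm.
  apply: filterS rm_small => w hw.
  rewrite [X in _ --> X](_ : 0 = b 0); last by rewrite /b normr0 mulr0 min_r.
  apply: (@cvg_seq_continuous _ b (fun j => Y j w)) => // y.
  apply: (@continuous_min R R (cst 2) (fun y => 2 * S * `|y|)); first exact: cst_continuous.
  apply: continuousM; first exact: cst_continuous.
  exact: norm_continuous.
rewrite Rintegral_prob_cst in h.
have [J _ hJ] : \forall j \near \oo, `|\int[P]_w b (Y j w)| <= e by exact: cvgr0_norm_le h _ e0.
exists J => j s Jj sS; have {hJ} := hJ j Jj; rewrite ger0_norm; last first.
  by apply: Rintegral_ge0 => w _; case/andP: (b01 (Y j w)).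
move=> hJ.
have ms : measurable_fun setT (fun w => s * Y j w) by exact: measurable_funM.
have bb : bmeas (fun w => b (Y j w)).
  by split => //; exists 2 => w; have /andP[? ?] := b01 (Y j w); rewrite ger0_norm.
have c1 := bmeas_cos ms; have c2 := bmeas_sin ms.
have sb w : `|s * Y j w| <= S * `|Y j w| by rewrite normrM ler_wpM2r.
have c1' : bmeas (fun w => 1 - cos (s * Y j w)).
  by apply: bmeasB => //; exact: bmeas_cst.
rewrite /m /rm_cfun cfunE/=; split; apply: le_trans hJ.
  rewrite -[X in `|X - _|](Rintegral_prob_cst P) -RintegralB_bmeas//; last exact: bmeas_cst.
  apply: le_trans (le_normr_Rintegral _ _) _ => //; first exact: bmeas_integrable.
  apply: le_Rintegral_bmeas => // [|w].
    exact: bmeas_norm.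
  rewrite le_min; apply/andP; split.
    by rewrite ger0_norm ?one_sub_cos_ge0// one_sub_cos_le2.
  by apply: (le_trans (normr_one_sub_cos_le _)); rewrite -mulrA ler_pM2l//; exact: sb.
apply: le_trans (le_normr_Rintegral _ _) _ => //; first exact: bmeas_integrable.
apply: le_Rintegral_bmeas => // [|w].
  exact: bmeas_norm.
rewrite le_min; apply/andP; split; first by have := sin_max (s * Y j w); lra.
apply: (le_trans (normr_sin_le _)); apply: le_trans (sb w) _.
by rewrite -mulrA ler_peMl ?ler1n// mulr_ge0// ltW.
Qed.

(** On each ball, the exponent is [2^J] times the principal logarithm of the
    characteristic function of [X(]0, 2^-J])], for one large [J]: among the two
    square roots of a characteristic function at time [2^-j], the one at time
    [2^-(j + 1)] is recognised by its positive real part. *)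
Let dyadic_exponent (S : R) : 0 < S -> exists J : nat, forall s, `|s| <= S ->
  0 < Re (m (hp J) s) /\ forall j, (J <= j)%N ->
  m (hp j) s = cexp ((hp j)%:C * ((2 ^+ J)%:C * clog (m (hp J) s))).
Proof.
have h20 : 0 < 2^-1 :> R by rewrite invr_gt0.
move=> S0; have [J hJ] := m_small S0 h20.
exists J => s sS.
have rp j : (J <= j)%N -> 0 < Re (m (hp j) s).
  by move=> /(hJ j s)/(_ sS)[+ _]; rewrite ler_norml => /andP[_]; lra.
split => [|j Jj]; first exact: rp.
rewrite -(subnKC Jj); elim: (j - J)%N => [|k IH].
  rewrite addn0 mulrA -(rmorphM (real_complex R)) mulVf ?expf_neq0// mul1r.
  by rewrite clogK//; exact: rp.
apply: csqr_inj; first by apply: rp; rewrite leq_addr.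
  rewrite mulrA -(rmorphM (real_complex R)) cscaleE cexpE/=.
  rewrite pmulr_rgt0 ?expR_gt0//.
  have q : hp (J + k.+1) * 2 ^+ J = (2 ^+ k.+1)^-1.
    by rewrite /hp exprD invfM mulrAC mulVf ?mul1r// expf_neq0.
  rewrite q; set a := atan _.
  have a1 : - (pi / 2) < a < pi / 2 by rewrite atan_gtNpi2 atan_ltpi2.
  have k1 : (2 ^+ k.+1)^-1 <= 1 :> R by rewrite invf_le1 ?exprn_gt0// exprn_ege1// ler1n.
  have k0 : 0 < (2 ^+ k.+1)^-1 :> R by rewrite invr_gt0 exprn_gt0.
  by apply: cos_gt0_pihalf; have := pi_gt0 R; move: a1 => /andP[? ?] ?; apply/andP; split; nra.
rewrite expr2 -mD; [|exact/ltW/hp_gt0..].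
rewrite addnS -hpS IH expr2 -cexpD -mulrDl -(rmorphD (real_complex R)).
by rewrite -hpS.
Qed.

(** Dyadic times [u j] increase to [t]; the intervals from zero to [u j] fill the
    interval from zero to [t], possibly without [t], where there is no atom. *)
Let semigroup_exponent (s : R) (c : R[i]) J :
  (forall j, (J <= j)%N -> m (hp j) s = cexp ((hp j)%:C * c)) ->
  forall t, 0 <= t -> m t s = cexp (t%:C * c).
Proof.
move=> hJ t t0.
have dy k j : (J <= j)%N -> m (k%:R * hp j) s = cexp ((k%:R * hp j)%:C * c).
  move=> Jj; rewrite mX ?(ltW (hp_gt0 _))// hJ//.
  elim: k => [|k IH]; first by rewrite expr0 mul0r mul0r cexp0.
  by rewrite exprSr IH -cexpD -mulrDl -(rmorphD (real_complex R)) -natr1 mulrDl mul1r.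
pose k j := Num.truncn (t * 2 ^+ (J + j)).
pose u j := (k j)%:R * hp (J + j).
have h2 j : 0 < 2 ^+ (J + j) :> R by rewrite exprn_gt0.
have ut j : u j <= t < u j + hp (J + j).
  have /andP[h3 h4] := truncn_itv (mulr_ge0 t0 (ltW (h2 j))).
  rewrite /u /hp; apply/andP; split; first by rewrite ler_pdivrMr.
  by rewrite -{2}(mul1r (2 ^+ _)^-1) -mulrDl natr1 ltr_pdivlMr.
have uS j : u j <= u j.+1.
  rewrite /u (_ : hp (J + j) = 2 * hp (J + j.+1)); last by rewrite addnS hpS; ring.
  rewrite mulrA ler_pM2r// -natrM ler_nat /k.
  have e0 : 0 <= t * 2 ^+ (J + j.+1) by rewrite mulr_ge0// ltW.
  rewrite truncn_ge_nat// natrM addnS exprS (mulrCA t) mulrC ler_pM2l//.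
  by rewrite truncn_le mulr_ge0// ltW.
have ucvg : u @ \oo --> t.
  apply/cvgrPdist_le => e e0.
  have [n _ hn] := near_infty_natSinv_expn_lt (PosNum e0).
  exists n => // j /= nj; have /andP[h3 h4] := ut j.
  rewrite ger0_norm ?subr_ge0//; apply: (@le_trans _ _ (hp (J + j))); first lra.
  have := hn (J + j)%N; rewrite /= div1r => h; apply/ltW/h.
  by rewrite (leq_trans nj)// leq_addl.
pose F j : set R := `]0, u j]%classic.
have nF : {homo F : n k / (n <= k)%N >-> (n <= k)%O}.
  move=> i j ij; apply/subsetPset => x; rewrite /F/= !in_itv/= => /andP[-> h].
  apply: (le_trans h); move/nondecreasing_seqP : uS; exact.
have bF n : bounded_borel (F n) by exact: bounded_borel_itv.
have sub : \bigcup_n F n `<=` `]0, t]%classic.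
  move=> x [j _]; rewrite /F/= !in_itv/= => /andP[-> h] /=.
  by apply: (le_trans h); case/andP: (ut j).
have bU : bounded_borel (\bigcup_n F n).
  apply: bounded_borel_sub sub (bounded_borel_itv _ _ _ _).
  by apply: bigcup_measurable => i _; case: (bF i).
have sup : `]0, t[%classic `<=` \bigcup_n F n.
  move=> x /=; rewrite in_itv/= => /andP[x0 xt].
  have [n _ hn] : \forall j \near \oo, x < u j by exact: cvgr_gt ucvg _ xt.
  exists n => //; rewrite /F/= in_itv/= x0 ltW//.
  by apply: hn => /=.
have e : rm_cfun X z (\bigcup_n F n) s = m t s.
  have [ht|ht] := pselect ((\bigcup_n F n) t).
    congr (rm_cfun X z _ s); apply/seteqP; split => // x /=; rewrite in_itv/= => /andP[x0].
    rewrite le_eqVlt => /predU1P[->//|xt]; apply: sup => /=.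
    by rewrite in_itv/= x0.
  have e1 : \bigcup_n F n = `]0, t[%classic.
    apply/seteqP; split => // x xF; have := sub x xF; rewrite /= !in_itv/= => /andP[-> /=].
    by rewrite le_eqVlt => /predU1P[xt|//]; rewrite xt in xF.
  have [t00|tp] := eqVneq t 0.
    rewrite e1 /m t00 !set_itv_ge//= bnd_simp ?ltxx//.
  have tgt0 : 0 < t by rewrite lt_neqAle eq_sym tp.
  rewrite /m (_ : `]0, t]%classic = `]0, t[%classic `|` [set t]); last first.
    apply/seteqP; split => x /=; rewrite !in_itv/=.
      by move=> /andP[-> /=]; rewrite le_eqVlt => /predU1P[->|->]; [right|left].
    by move=> [/andP[-> /ltW]|->]//; rewrite tgt0 lexx.
  rewrite (rm_cfunU HX); [|exact: bounded_borel_itv|exact: bounded_borel_set1|].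
    by rewrite (rm_cfun_set1 HX) mulr1 e1.
  by rewrite -subset0 => x [] /=; rewrite in_itv/= => /andP[_ h] xt; move: h; rewrite xt ltxx.
rewrite -e; apply: (ccvg_unique (rm_cfun_bigcup HX z s bF nF bU)).
rewrite (_ : (fun n => _) = (fun j => cexp ((u j)%:C * c))); first exact: ccvg_cexpM.
by apply/funext => j; exact: dy (leq_addr _ _).
Qed.

(** The sets for which the formula holds form a lambda-system that contains the
    half-open intervals. *)
Let borel_exponent (s : R) (c : R[i]) :
  (forall t, 0 <= t -> m t s = cexp (t%:C * c)) ->
  forall B, bounded_borel B -> rm_cfun X z B s = cexp ((fine (lam B))%:C * c).
Proof.
move=> hc B bB; have [n Bn] := bounded_borel_sub_itv bB.
pose D : set R := `](- n.+1%:R), n.+1%:R]%classic.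
have mD' : measurable D by exact: measurable_itv.
have bD A : measurable A -> bounded_borel (A `&` D).
  move=> mA; apply: bounded_borel_sub (bounded_borel_itv (- n.+1%:R) n.+1%:R false false).
    exact: measurableI.
  exact: subIsetr.
pose H : set (set R) := [set A | measurable A /\
  rm_cfun X z (A `&` D) s = cexp ((fine (lam (A `&` D)))%:C * c)].
have itvP' x y : rm_cfun X z `]x, y] s = cexp ((fine (lam `]x, y]%classic))%:C * c).
  have [xy|yx] := leP x y; last first.
    by rewrite set_itv_ge ?bnd_simp -?leNgt ?(ltW yx)// (rm_cfun0 HX) measure0 mul0r cexp0.
  rewrite rm_cfun_itv// hc ?subr_ge0// lebesgue_measure_itv/= lte_fin.
  case: ltP => [//|yx]; congr cexp; congr (_%:C * c) => /=.
  by apply/eqP; rewrite subr_eq0 eq_le yx.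
suff : H B by move=> [_]; rewrite setIidl.
have GH : @ocitv R `<=` H.
  move=> _ [[x y] _ <-]; split; first exact: measurable_itv.
  have -> : `](x, y).1, (x, y).2]%classic `&` D = `](Num.max x (- n.+1%:R)), (Num.min y n.+1%:R)]%classic.
    rewrite /D; apply/seteqP; split => u /=; rewrite !in_itv/= gt_max le_min.
      by move=> [/andP[-> ->] /andP[-> ->]].
    by move=> /andP[/andP[-> ->] /andP[-> ->]].
  exact: itvP'.
have lH : lambda_system setT H.
  split => //.
  - by split => //; rewrite setTI; exact: itvP'.
  - move=> A C CA [mA eA] [mC eC]; split; first exact: measurableD.
    have AC : A `&` D = ((A `\` C) `&` D) `|` (C `&` D).
      rewrite -setIUl; congr (_ `&` _); apply/seteqP; split => x.
        by move=> Ax; have [Cx|Cx] := pselect (C x); [right|left].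
      by move=> [[]//|]; exact: CA.
    have dj : ((A `\` C) `&` D) `&` (C `&` D) = set0.
      by rewrite -subset0 => x [[[_ +] _] [+ _]].
    have mAC := measurableD mA mC.
    have := rm_cfunU HX z s (bD _ mAC) (bD _ mC) dj; rewrite -AC eA eC.
    have -> : lam (A `&` D) = (lam ((A `\` C) `&` D) + lam (C `&` D))%E.
      by rewrite AC measureU//; exact: measurableI.
    rewrite fineD; [|exact/fin_num_bounded_borel/bD..].
    rewrite (rmorphD (real_complex R)) mulrDl cexpD => /(mulIf (cexp_neq0 _)).
    by move=> <-.
  - move=> F nF HF.
    have mF k : measurable (F k) by case: (HF k).
    split; first exact: bigcup_measurable.
    pose G k := F k `&` D.
    have bG k : bounded_borel (G k) by exact: bD.
    have nG : {homo G : k l / (k <= l)%N >-> (k <= l)%O}.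
      by move=> k l kl; apply/subsetPset; apply: setSI; apply/subsetPset/nF.
    have UG : (\bigcup_k F k) `&` D = \bigcup_k G k by rewrite setI_bigcupl.
    have bUG : bounded_borel (\bigcup_k G k).
      by rewrite -UG; apply: bD; exact: bigcup_measurable.
    rewrite UG; apply: (ccvg_unique (rm_cfun_bigcup HX z s bG nG bUG)).
    rewrite (_ : (fun k => _) = (fun k => cexp ((fine (lam (G k)))%:C * c))); last first.
      by apply/funext => k; case: (HF k).
    apply: ccvg_cexpM; apply: fine_cvg.
    rewrite fineK; last exact: fin_num_bounded_borel.
    apply: nondecreasing_cvg_mu => //; first by move=> k; case: (bG k).
    by case: bUG.
apply: (lambda_system_subset (@ocitvI R) lH GH) => //.
by case: bB.
Qed.

(** The random measure has a continuous exponent in each direction.  It is read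
    off the semigroup [t -> X(]0, t])], hence without lifting the characteristic
    function of [mu] along a path. *)
Theorem levy_exponent : exists c : R -> R[i],
  [/\ continuous (fun s => Re (c s)), continuous (fun s => Im (c s)), c 0 = 0 &
   forall B s, bounded_borel B -> rm_cfun X z B s = cexp ((fine (lam B))%:C * c s)].
Proof.
have sp (s : R) : 0 < `|s| + 1 by rewrite ltr_wpDl.
have /choice[J HJ] : forall S : R, exists J : nat, 0 < S -> forall s, `|s| <= S ->
  0 < Re (m (hp J) s) /\ forall t, 0 <= t ->
  m t s = cexp (t%:C * ((2 ^+ J)%:C * clog (m (hp J) s))).
  move=> S; have [S0|S0] := ltP 0 S; last by exists 0%N.
  have [J hJ] := dyadic_exponent S0; exists J => _ s sS.
  have [h1 h2] := hJ s sS; split => // t t0.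
  exact: (semigroup_exponent h2).
pose cS S s : R[i] := (2 ^+ J S)%:C * clog (m (hp (J S)) s).
have cSE S s t : 0 < S -> `|s| <= S -> 0 <= t -> m t s = cexp (t%:C * cS S s).
  by move=> S0 sS t0; have [_] := HJ S S0 s sS; exact.
pose c s := cS (`|s| + 1) s.
have cE s t : 0 <= t -> m t s = cexp (t%:C * c s).
  by move=> t0; apply: cSE => //; rewrite lerDl.
have ccS S s : 0 < S -> `|s| <= S -> c s = cS S s.
  move=> S0 sS; apply: cexp_semigroup_inj => t t0.
  exact: etrans (esym (cE s t t0)) (cSE S s t S0 sS t0).
clearbody c.
have cont s0 : {for s0, continuous (fun s => Re (c s))} /\
               {for s0, continuous (fun s => Im (c s))}.
  have S0 := sp s0; set S := `|s0| + 1 in S0.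
  have sS : `|s0| <= S by rewrite lerDl.
  have nr : \forall s \near s0, cS S s = c s.
    near=> s; apply/esym/ccS => //; apply/ltW; near: s.
    apply: (cvgr_lt `|s0|); last by rewrite /S ltrDl.
    exact: norm_continuous.
  have [g0 _] := HJ S S0 s0 sS.
  have [c1 c2] := @cfun_continuous R _ _ P _ (@measurable_dot_rm _ _ X z `]0, hp (J S)]%classic).
  have [l1 l2] := continuous_clog (c1 s0) (c2 s0) g0.
  have e1 : {for s0, continuous (fun s => Re (cS S s))}.
    rewrite (_ : (fun s => _) = (fun s => 2 ^+ J S * Re (clog (m (hp (J S)) s)))).
      by apply: (@continuousM _ _ (cst (2 ^+ J S))) => //; exact: cst_continuous.
    by apply/funext => s; rewrite /cS cscaleE.
  have e2 : {for s0, continuous (fun s => Im (cS S s))}.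
    rewrite (_ : (fun s => _) = (fun s => 2 ^+ J S * Im (clog (m (hp (J S)) s)))).
      by apply: (@continuousM _ _ (cst (2 ^+ J S))) => //; exact: cst_continuous.
    by apply/funext => s; rewrite /cS cscaleE.
  split; rewrite /prop_for/continuous_at (ccS S s0 S0 sS).
    apply: cvg_trans e1; apply: near_eq_cvg; near=> s; congr Re.
    by near: s; exact: nr.
  apply: cvg_trans e2; apply: near_eq_cvg; near=> s; congr Im.
  by near: s; exact: nr.
exists c; split.
- by move=> s; case: (cont s).
- by move=> s; case: (cont s).
- apply: cexp_semigroup_inj => t t0; rewrite -(cE 0 t t0) mulr0 cexp0.
  rewrite /m /rm_cfun cfunE; under eq_Rintegral do rewrite mul0r cos0.
  rewrite Rintegral_prob_cst; under eq_Rintegral do rewrite mul0r sin0.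
  by rewrite Rintegral_prob_cst.
move=> B s bB; apply: borel_exponent => // t t0; exact: cE.
Unshelve. all: by end_near. Qed.

End levy_exponent.

(** * Growth of the exponent *)

Section exponent_growth.
Variable R : realType.

Lemma is_derive0_cvg (g : R -> R) (dg : R) : is_derive (0 : R) (1 : R) g dg ->
  (fun n : nat => n.+1%:R * (g n.+1%:R^-1 - g 0)) @ \oo --> dg.
Proof.
move=> dgP.
have : (fun h : R => h^-1 *: ((g \o shift 0) (h *: 1) - g 0)) @ 0^' --> dg.
  by rewrite -(@derive_val _ _ _ _ _ _ _ dgP); exact: ex_derive.
move=> /(@cvgr_dnbhsP R) /(_ (fun n => n.+1%:R^-1)) h.
have -> : (fun n : nat => n.+1%:R * (g n.+1%:R^-1 - g 0)) =
   (fun n => (n.+1%:R^-1)^-1 *: ((g \o shift 0) (n.+1%:R^-1 *: 1) - g 0)).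
  by apply/funext => n; rewrite /= invrK addr0 [_ *: 1]mulr1.
apply: h; split; first by move=> n; rewrite invr_neq0.
apply/cvgrPdist_lt => e e0.
have [N _ hN] := near_infty_natSinv_lt (PosNum e0).
by exists N => // n /hN /=; rewrite sub0r normrN ger0_norm.
Qed.

(** If [|D|] left zero it would take a small positive value, where [cos] is
    not one. *)
Lemma continuous_cos1_eq0 (D : R -> R) : continuous D -> D 0 = 0 ->
  (forall s, cos (D s) = 1) -> forall s, D s = 0.
Proof.
move=> cD D0 cos1 s; apply/eqP/negPn/negP => Ds.
pose v := Num.min `|D s| 1.
have v0 : 0 < v by rewrite lt_min normr_gt0 Ds ltr01.
have v1 : v <= 1 by rewrite ge_min lexx orbT.
have cE : continuous (fun x => `|D x|).
  by move=> x; apply: continuous_comp; [exact: cD|exact: norm_continuous].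
have [t tv] : exists t, `|D t| = v.
  have vs : v <= `|D s| by rewrite ge_min lexx.
  have [s0|s0] := leP 0 s.
    have [|t _ tv] := @IVT _ (fun x => `|D x|) 0 s v s0 (continuous_subspaceT cE).
      by rewrite D0 normr0 ge_min le_max (ltW v0) vs orbT.
    by exists t.
  have [|t _ tv] := @IVT _ (fun x => `|D x|) s 0 v (ltW s0) (continuous_subspaceT cE).
    by rewrite D0 normr0 ge_min le_max (ltW v0) vs orbT.
  by exists t.
have := @one_sub_cos_ge R (D t); rewrite tv cos1 subrr => /(_ v1).
rewrite -real_normK ?num_real// tv.
have : 0 < v ^+ 2 by rewrite exprn_gt0.
lra.
Qed.

(** The real parts agree since the exponentials have the same modulus; the
    difference of the imaginary parts is continuous with [cos] equal to one. *)
Lemma continuous_log_unique (c1 c2 : R -> R[i]) :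
  continuous (fun s => Re (c1 s)) -> continuous (fun s => Im (c1 s)) ->
  continuous (fun s => Re (c2 s)) -> continuous (fun s => Im (c2 s)) ->
  c1 0 = 0 -> c2 0 = 0 -> (forall s, cexp (c1 s) = cexp (c2 s)) ->
  forall s, c1 s = c2 s.
Proof.
move=> r1 i1 r2 i2 z1 z2 e.
pose a s := Re (c1 s) - Re (c2 s); pose b s := Im (c1 s) - Im (c2 s).
have ab s : expR (a s) * cos (b s) = 1 /\ expR (a s) * sin (b s) = 0.
  have : cexp (a s +i* b s) = 1.
    apply: (mulIf (cexp_neq0 (c2 s))); rewrite mul1r -cexpD -e; congr cexp.
    by apply: complex_eqP; rewrite ?cReD ?cImD/= /a /b subrK.
  by rewrite cexpE => -[].
have a0 s : a s = 0.
  have [h1 h2] := ab s.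
  have : expR (a s) ^+ 2 = 1.
    rewrite (_ : _ ^+ 2 = expR (a s) ^+ 2 * (cos (b s) ^+ 2 + sin (b s) ^+ 2));
      last by rewrite cos2Dsin2 mulr1.
    rewrite mulrDr -!exprMn h1 h2.
    by rewrite expr1n expr0n/= addr0.
  move=> h3; apply: expR_inj; rewrite expR0; apply/eqP.
  by rewrite -(@eqrXn2 _ 2) ?ler01 ?expR_ge0// h3 expr1n.
have b0 : forall s, b s = 0.
  apply: continuous_cos1_eq0.
  - by move=> s; apply: continuousB; [exact: i1|exact: i2].
  - by rewrite /b z1 z2 subrr.
  - by move=> s; have [h _] := ab s; move: h; rewrite a0 expR0 mul1r.
move=> s; apply: complex_eqP; apply/eqP; rewrite -subr_eq0.
  by have := a0 s; rewrite /a => ->.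
by have := b0 s; rewrite /b => ->.
Qed.

(** Continuity makes the functions small on a ball of radius [dl]; the doubling
    inequalities carry a quadratic bound from the shell between [dl / 2] and [dl]
    to all larger arguments. *)
Lemma quadratic_growth (rho iota : R -> R) :
  {for 0, continuous rho} -> {for 0, continuous iota} -> rho 0 = 0 -> iota 0 = 0 ->
  (forall s, 0 <= rho s) -> (forall s, rho (2 * s) <= 4 * rho s) ->
  (forall s, `|iota (2 * s)| <= 2 * `|iota s| + 2 * rho s) ->
  forall e, 0 < e -> exists2 K, 0 < K &
    forall s, rho s + `|iota s| <= e + K * s ^+ 2.
Proof.
move=> cr ci r0 i0 rge rd idb e e0.
have e2 : 0 < e / 2 by rewrite divr_gt0.
have /cvgrPdist_le/(_ _ e2)/nbhs_ballP[d1 /= d10 h1] := cr.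
have /cvgrPdist_le/(_ _ e2)/nbhs_ballP[d2 /= d20 h2] := ci.
pose dl := Num.min d1 d2 / 2.
have dl0 : 0 < dl by rewrite divr_gt0// lt_min d10.
have small s : `|s| <= dl -> rho s <= e / 2 /\ `|iota s| <= e / 2.
  move=> sd; have sd' : `|s| < Num.min d1 d2.
    by apply: le_lt_trans sd _; rewrite /dl gtr_pMr ?lt_min ?d10// invf_lt1// ltr1n.
  move: sd'; rewrite lt_min => /andP[s1 s2]; split.
    have := h1 s; rewrite /ball/= sub0r normrN => /(_ s1).
    by rewrite r0 sub0r normrN ger0_norm.
  have := h2 s; rewrite /ball/= sub0r normrN => /(_ s2).
  by rewrite i0 sub0r normrN.
pose A := 2 * e / dl ^+ 2.
have dl2 : 0 < dl ^+ 2 by rewrite exprn_gt0.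
have A0 : 0 < A by rewrite divr_gt0// mulr_gt0.
have base s : dl / 2 < `|s| -> `|s| <= dl -> rho s <= A * s ^+ 2 /\ `|iota s| <= A * s ^+ 2.
  move=> s1 s2; have [h3 h4] := small s s2.
  have : e / 2 <= A * s ^+ 2.
    rewrite /A mulrAC ler_pdivlMr//.
    have : (dl / 2) ^+ 2 <= s ^+ 2.
      by rewrite -(real_normK (num_real s)) lerXn2r ?nnegrE// ltW// divr_gt0.
    have -> : dl ^+ 2 = 4 * (dl / 2) ^+ 2 by field.
    by move: (_ ^+ 2) (s ^+ 2) => u v uv; nra.
  by move=> h; split; apply: le_trans h.
have big k s : dl / 2 < `|s| -> `|s| <= 2 ^+ k * dl ->
    rho s <= A * s ^+ 2 /\ `|iota s| <= A * s ^+ 2.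
  elim: k s => [|k IH] s s1 s2; first by apply: base => //; move: s2; rewrite mul1r.
  have [sd|ds] := leP `|s| dl; first exact: base.
  have -> : s = 2 * (s / 2) by field.
  have [] := IH (s / 2).
  - by rewrite normrM (ger0_norm (_ : 0 <= 2^-1)) ?invr_ge0// ltr_pM2r// invr_gt0.
  - rewrite normrM (ger0_norm (_ : 0 <= 2^-1)) ?invr_ge0// ler_pdivrMr//.
    by apply: le_trans s2 _; rewrite exprS; lra.
  have := rd (s / 2); have := idb (s / 2); move: (s / 2) => u h3 h4 h5 h6.
  by rewrite exprMn; split; lra.
exists (2 * A) => [|s]; first by rewrite mulr_gt0.
have [sd|ds] := leP `|s| dl.
  have [h3 h4] := small s sd.
  have := mulr_ge0 (ltW A0) (sqr_ge0 s); lra.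
have [k hk] : exists k : nat, `|s| <= 2 ^+ k * dl.
  have := truncnS_gt (`|s| / dl); set k := (Num.truncn _).+1 => hk.
  exists k; rewrite -ler_pdivrMr//; apply: (le_trans (ltW hk)).
  by rewrite -natrX ler_nat ltnW// ltn_expl.
have ds2 : dl / 2 < `|s| by apply: lt_trans ds; rewrite gtr_pMr// invf_lt1// ltr1n.
have [h3 h4] := big k s ds2 hk.
by lra.
Qed.

End exponent_growth.

Section exponent_doubling.
Variables (R : realType).

(** Integrated forms of [1 - cos (2 y) <= 4 (1 - cos y)] and
    [|sin (2 y) - 2 sin y| <= 2 (1 - cos y)]. *)
Lemma cfun_double d (T : measurableType d) (P : probability T R) (Y : T -> R) s :
  measurable_fun setT Y ->
  [/\ 0 <= 1 - Re (cfun P Y s),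
      1 - Re (cfun P Y (2 * s)) <= 4 * (1 - Re (cfun P Y s)) &
      `|Im (cfun P Y (2 * s)) - 2 * Im (cfun P Y s)| <= 2 * (1 - Re (cfun P Y s))].
Proof.
move=> mY.
have m (a : R) : measurable_fun setT (fun w => a * Y w).
  by apply: measurable_funM => //; exact: measurable_cst.
have bc a := bmeas_cos (m a); have bs a := bmeas_sin (m a).
have b1 : @bmeas _ T R (fun=> 1) by exact: bmeas_cst.
have b1c a : bmeas (fun w => 1 - cos (a * Y w)) by exact: bmeasB.
have bZ (k : R) f : bmeas f -> bmeas (fun w : T => k * f w).
  by apply: bmeasM; exact: bmeas_cst.
have e1 a : 1 - \int[P]_w cos (a * Y w) = \int[P]_w (1 - cos (a * Y w)).
  by rewrite RintegralB_bmeas// Rintegral_prob_cst.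
rewrite !cfunE/= !e1 -!RintegralZ_bmeas//; split.
- by apply: Rintegral_ge0 => w _; exact: one_sub_cos_ge0.
- apply: le_Rintegral_bmeas => // [|w]; first exact: bZ.
  by rewrite -mulrA; exact: one_sub_cos_double.
- rewrite -RintegralB_bmeas//; last exact: bZ.
have b3 : bmeas (fun w => sin (2 * s * Y w) - 2 * sin (s * Y w)).
  by apply: bmeasB => //; exact: bZ.
apply: le_trans (le_normr_Rintegral _ _) _ => //; first exact: bmeas_integrable.
apply: le_Rintegral_bmeas => // [||w]; [exact: bmeas_norm|exact: bZ|].
rewrite -mulrA; move: (s * Y w) => y.
have -> : sin (2 * y) = 2 * sin y * cos y.
  by rewrite (_ : 2 * y = y + y) ?sinD; ring.
rewrite (_ : _ - _ = 2 * sin y * (cos y - 1)); last by ring.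
rewrite normrM distrC (ger0_norm (one_sub_cos_ge0 y)) ler_wpM2r ?one_sub_cos_ge0//.
by rewrite normrM ger0_norm// ler_piMr// sin_max.
Qed.

(** The derivative of [t -> exp (t c)] at zero is [c]. *)
Lemma cexp_deriv (c : R[i]) :
  (fun n : nat => n.+1%:R * (1 - Re (cexp ((n.+1%:R^-1)%:C * c)))) @ \oo --> - Re c /\
  (fun n : nat => n.+1%:R * Im (cexp ((n.+1%:R^-1)%:C * c))) @ \oo --> Im c.
Proof.
case: c => a b; split.
  have h : is_derive (0 : R) (1 : R) (fun t => - (expR (t * a) * cos (t * b))) (- a).
    apply: is_derive_eq.
    by rewrite !mul0r expR0 cos0 sin0 /GRing.scale/=; ring.
  have := is_derive0_cvg h; apply: cvg_trans; apply: near_eq_cvg; apply: nearW => n.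
  rewrite !mul0r expR0 cos0 mulr1 opprK cscaleE cexpE/=; congr (_ * _); ring.
have h : is_derive (0 : R) (1 : R) (fun t => expR (t * a) * sin (t * b)) b.
  apply: is_derive_eq.
  by rewrite !mul0r expR0 cos0 sin0 /GRing.scale/=; ring.
have := is_derive0_cvg h; apply: cvg_trans; apply: near_eq_cvg; apply: nearW => n.
by rewrite !mul0r expR0 sin0 mulr0 subr0 cscaleE cexpE.
Qed.

Variables (d : nat) (X : set_indexed_rvs R d) (z : 'rV[R]_d).
Variable c : R -> R[i].
Hypothesis Hc : forall B s, bounded_borel B ->
  rm_cfun X z B s = cexp ((fine (lebesgue_measure B))%:C * c s).

(** Divided by the length of the interval, the doubling inequalities for
    characteristic functions pass to the exponent. *)
Lemma exponent_doubling s :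
  [/\ 0 <= - Re (c s), - Re (c (2 * s)) <= 4 * - Re (c s) &
      `|Im (c (2 * s))| <= 2 * `|Im (c s)| + 2 * - Re (c s)].
Proof.
have pE n s' : rm_cfun X z `]0, n.+1%:R^-1] s' = cexp ((n.+1%:R^-1)%:C * c s').
  rewrite Hc; last exact: bounded_borel_itv.
  by rewrite lebesgue_measure_itv/= lte_fin invr_gt0 ltr0Sn/= subr0.
have dbl n := cfun_double (rm_prob X) s (@measurable_dot_rm _ _ X z `]0, n.+1%:R^-1]%classic).
have [c1 d1] := cexp_deriv (c s); have [c2 d2] := cexp_deriv (c (2 * s)).
have n0 n : 0 <= n.+1%:R :> R by [].
have k2 (u : nat -> R) l (k : R) : u @ \oo --> l -> (fun n => k * u n) @ \oo --> k * l.
  by move=> ul; apply: (@cvgM _ _ _ _ (fun=> k)) => //; exact: cvg_cst.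
have d1' := c2; have d2' := k2 _ _ 4 c1.
pose v n s' := n.+1%:R * Im (cexp ((n.+1%:R^-1)%:C * c s')).
have d3 : (fun n => `|v n (2 * s)|) @ \oo --> `|Im (c (2 * s))| by exact: cvg_norm d2.
have d4 : (fun n => 2 * `|v n s| +
    2 * (n.+1%:R * (1 - Re (cexp ((n.+1%:R^-1)%:C * c s))))) @ \oo -->
    2 * `|Im (c s)| + 2 * - Re (c s).
  by apply: cvgD; apply: k2 => //; exact: cvg_norm d1.
split.
- apply: (cvgr_to_ge c1); apply: nearW => n; rewrite mulr_ge0// -pE.
  by have [] := dbl n.
- apply: (ler_cvg_to d1' d2'); apply: nearW => n.
  by rewrite mulrCA ler_wpM2l// -!pE; have [] := dbl n.
- apply: (ler_cvg_to d3 d4); apply: nearW => n; rewrite /v -!pE.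
  have [_ _ h] := dbl n; rewrite !normrM (ger0_norm (n0 n)).
  have h2 := ler_wpM2l (n0 n) h.
  have := ler_normD (Im (cfun (rm_prob X) (fun w => dot z (X `]0, n.+1%:R^-1]%classic w)) (2 * s)) - 2 * Im (cfun (rm_prob X) (fun w => dot z (X `]0, n.+1%:R^-1]%classic w)) s)) (2 * Im (cfun (rm_prob X) (fun w => dot z (X `]0, n.+1%:R^-1]%classic w)) s)).
  rewrite subrK normrM (ger0_norm (ler0n R 2)) => /(ler_wpM2l (n0 n)) h3.
  by apply: (le_trans h3); rewrite mulrDr [leLHS]addrC mulrCA lerD2l [leRHS]mulrCA.
Qed.

End exponent_doubling.

(** * Elementary integrals over overlapping sets *)

(** The atoms of the algebra generated by finitely many sets: they turn a linear
    combination of overlapping sets into one of disjoint sets. *)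
Section atoms.
Variables (R : realType) (I : finType) (W : set R) (D : I -> set R) (c : I -> R).
Hypotheses (bW : bounded_borel W) (mD : forall i, measurable (D i)).
Hypothesis DW : forall i, D i `<=` W.

Definition atom (K : {set I}) : set R :=
  W `&` \bigcap_i (if i \in K then D i else ~` D i).

Definition atom_coef (K : {set I}) : R := \sum_(i in K) c i.

Definition comb_fun (x : R) : R := \sum_i c i * \1_(D i) x.

Lemma atomP K x : atom K x <-> W x /\ forall i, (i \in K) = `[< D i x >].
Proof.
split=> [[Wx h]|[Wx h]]; split => // i.
  by have := h i Logic.I; case: ifP => _ Dx; [rewrite asboolT|rewrite asboolF].
by move=> _; rewrite h; case: asboolP.
Qed.

Lemma measurable_atom K : measurable (atom K).
Proof.
apply: measurableI; first by case: bW.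
apply: fin_bigcap_measurable => // i _; case: ifP => // _.
exact: measurableC.
Qed.

Lemma bounded_borel_atom K : bounded_borel (atom K).
Proof.
apply: (bounded_borel_sub (measurable_atom K) _ bW); exact: subIsetl.
Qed.

Lemma trivIset_atom : trivIset setT atom.
Proof.
move=> K L _ _ [x [/atomP[_ xK] /atomP[_ xL]]].
by apply/setP => i; rewrite xK xL.
Qed.

Lemma comb_fun_atom K x : atom K x -> comb_fun x = atom_coef K.
Proof.
move=> /atomP[_ xK]; rewrite /comb_fun /atom_coef [RHS]big_mkcond/=.
apply: eq_bigr => i _; rewrite xK indicE.
have [Dx|Dx] := pselect (D i x); first by rewrite mem_set// asboolT// mulr1.
by rewrite memNset// asboolF// mulr0.
Qed.

Lemma mem_atom x : W x -> atom [set i | `[< D i x >]]%SET x.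
Proof. by move=> Wx; apply/atomP; split => // i; rewrite inE. Qed.

Lemma bigsetU_atom i : \big[setU/set0]_(K <- [seq K : {set I} <- index_enum _ | i \in K]) atom K = D i.
Proof.
rewrite -bigcup_seq; apply/seteqP; split => x.
  move=> [K /=]; rewrite mem_filter => /andP[iK _] /atomP[_ h].
  by move: iK; rewrite h => /asboolP.
move=> Dx; exists [set j | `[< D j x >]]%SET; last by apply: mem_atom; exact: DW Dx.
by rewrite /= mem_filter inE asboolT// mem_index_enum.
Qed.

Lemma ge0_integral_comb (F : R -> R) : (forall x, 0 <= F x) ->
  (\int[lebesgue_measure]_(x in W) (F (comb_fun x))%:E)%E =
  (\sum_K fine (lebesgue_measure (atom K)) * F (atom_coef K))%:E.
Proof.
move=> F0; have [mW _] := bW.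
transitivity (\int[lebesgue_measure]_(x in W)
    (\sum_K (F (atom_coef K) * \1_(atom K) x)%:E))%E.
  apply: eq_integral => x; rewrite inE => Wx; rewrite sumEFin; congr EFin.
  have h := mem_atom Wx; rewrite (comb_fun_atom h) (bigD1 [set i | `[< D i x >]]%SET)//=.
  rewrite indicE mem_set// mulr1 big1 ?addr0// => K KN.
  rewrite indicE memNset ?mulr0// => xK.
  by move: KN; rewrite (trivIset_atom Logic.I Logic.I (ex_intro _ x (conj xK h))) eqxx.
rewrite ge0_integral_sum//; last 2 first.
- move=> K; apply/measurable_EFinP; apply: measurable_funM; first exact: measurable_cst.
  by apply/measurable_funTS/measurable_indic; exact: measurable_atom.
- by move=> K x _; rewrite lee_fin mulr_ge0.
rewrite -sumEFin; apply: eq_bigr => K _.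
under eq_integral do rewrite EFinM.
rewrite ge0_integralZl_EFin//; last first.
  by apply/measurable_EFinP/measurable_funTS/measurable_indic; exact: measurable_atom.
rewrite integral_indic//; last exact: measurable_atom.
rewrite setIidl; last exact: subIsetl.
rewrite mulrC EFinM fineK//; apply: fin_num_bounded_borel; exact: bounded_borel_atom.
Qed.

Variables (d : nat) (mu : probability 'rV[R]_d R).
Variables (X : set_indexed_rvs R d) (HX : is_random_measure mu X).

Lemma rm_comb_atom : {ae rm_prob X, forall w,
  \sum_i c i *: X (D i) w = \sum_K atom_coef K *: X (atom K) w}.
Proof.
have h i : {ae rm_prob X, forall w, X (D i) w = \sum_(K : {set I} | i \in K) X (atom K) w}.
  have := @rm_bigsetU _ _ _ _ HX _ [seq K : {set I} <- index_enum _ | i \in K] atom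
    (filter_uniq _ (index_enum_uniq _)) bounded_borel_atom trivIset_atom.
  by apply: filterS => w; rewrite bigsetU_atom big_filter.
have {}h : {ae rm_prob X, forall w, forall i,
    X (D i) w = \sum_(K : {set I} | i \in K) X (atom K) w}.
  exact: filter_forall.
apply: filterS h => w h.
under eq_bigr => i _ do rewrite h scaler_sumr.
rewrite (exchange_big_dep xpredT)//=; apply: eq_bigr => K _.
by rewrite /atom_coef scaler_suml.
Qed.

Variables (z : 'rV[R]_d) (e : R -> R[i]).
Hypothesis He : forall B s, bounded_borel B ->
  rm_cfun X z B s = cexp ((fine (lebesgue_measure B))%:C * e s).

Lemma measurable_dot_comb (J : finType) (E : J -> set R) (a : J -> R) :
  measurable_fun setT (fun w => dot z (\sum_j a j *: X (E j) w)).
Proof.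
under eq_fun do rewrite dot_sumr.
apply: measurable_sum => j; under eq_fun do rewrite dotZr.
apply: measurable_funM; first exact: measurable_cst.
exact: measurable_dot_rm.
Qed.

Lemma cfun_comb s :
  cfun (rm_prob X) (fun w => dot z (\sum_i c i *: X (D i) w)) s =
  cexp (\sum_K (fine (lebesgue_measure (atom K)))%:C * e (s * atom_coef K)).
Proof.
rewrite (@eq_cfun _ _ _ _ _ (fun w => dot z (\sum_K atom_coef K *: X (atom K) w))).
- rewrite (cfun_lin_comb HX); [|exact: bounded_borel_atom|exact: trivIset_atom].
  rewrite cexp_sum; apply: eq_bigr => K _; apply: He; exact: bounded_borel_atom.
- exact: measurable_dot_comb.
- exact: measurable_dot_comb.
by apply: filterS rm_comb_atom => w ->.
Qed.

Let sum_cscale (u : {set I} -> R) (q : {set I} -> R[i]) :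
  \sum_K (u K)%:C * q K =
  (\sum_K u K * Re (q K)) +i* (\sum_K u K * Im (q K)).
Proof.
elim/big_ind3 : _ => //.
  by move=> ? ? ? ? ? ? -> ->.
by move=> K _; rewrite cscaleE.
Qed.

(** This applies to symmetric laws, for which the characteristic functions of
    elementary integrals are positive. *)
Lemma cfun_comb_real s : (forall x, Im (e x) = 0) ->
  (forall x, 0 <= - Re (e x)) ->
  cfun (rm_prob X) (fun w => dot z (\sum_i c i *: X (D i) w)) s =
  (expR (- fine (\int[lebesgue_measure]_(x in W)
     (- Re (e (s * comb_fun x)))%:E)%E))%:C.
Proof.
move=> e0 ege; rewrite cfun_comb sum_cscale.
under [X in _ +i* X]eq_bigr do rewrite e0 mulr0.
rewrite big1_eq (ge0_integral_comb (F := fun x => - Re (e (s * x))))//=.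
rewrite cexpE/= cos0 sin0 mulr1 mulr0; congr (expR _ +i* _).
by rewrite -sumrN; apply: eq_bigr => K _; rewrite mulrN opprK.
Qed.

(** With exponent [A + i B], where [A <= 0], this is
    [1 - exp A cos B <= - A + 2 |B|]. *)
Lemma cfun_comb_le s (F : R -> R) : (forall x, 0 <= - Re (e x)) ->
  (forall x, 2 * (- Re (e (s * x)) + `|Im (e (s * x))|) <= F x) ->
  ((1 - Re (cfun (rm_prob X) (fun w => dot z (\sum_i c i *: X (D i) w)) s))%:E <=
  \int[lebesgue_measure]_(x in W) (F (comb_fun x))%:E)%E.
Proof.
move=> ege eF.
have F0 x : 0 <= F x.
  by apply: le_trans (eF x); rewrite mulr_ge0// addr_ge0.
rewrite ge0_integral_comb// lee_fin cfun_comb sum_cscale cexpE/=.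
pose l K := fine (lebesgue_measure (atom K)).
have l0 K : 0 <= l K by exact: fine_ge0.
set A := \sum_K _; set B := \sum_K _.
have A0 : 0 <= - A.
  rewrite /A -sumrN; apply: sumr_ge0 => K _; rewrite -mulrN.
  by apply: mulr_ge0; [exact: l0 | exact: ege].
have h1 : 1 - expR A * cos B <= - A + 2 * `|B|.
  have := normr_one_sub_cos_le B; rewrite ger0_norm ?one_sub_cos_ge0// => h2.
  have := expR_ge1Dx A => h3.
  have h4 : expR A <= 1 by rewrite -expR0 ler_expR; lra.
  have h5 := expR_ge0 A; have := one_sub_cos_ge0 B.
  by move: h2 h3 h4 h5; move: (expR A) (cos B) `|B| => x y u; nra.
apply: (le_trans h1).
apply: (@le_trans _ _ (\sum_K l K * (2 * (- Re (e (s * atom_coef K)) +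
   `|Im (e (s * atom_coef K))|)))); last first.
  by apply: ler_sum => K _; rewrite ler_wpM2l.
have hB : `|B| <= \sum_K l K * `|Im (e (s * atom_coef K))|.
  apply: (le_trans (ler_norm_sum _ _ _)); apply: ler_sum => K _.
  by rewrite normrM (ger0_norm (l0 K)).
have -> : \sum_K l K * (2 * (- Re (e (s * atom_coef K)) +
   `|Im (e (s * atom_coef K))|)) =
   2 * (- A + \sum_K l K * `|Im (e (s * atom_coef K))|).
  rewrite /A -sumrN -big_split mulr_sumr/=; apply: eq_bigr => K _.
  by rewrite /l; ring.
lra.
Qed.

End atoms.

(** * The truncation inequality *)

Section truncation_inequality.
Variable R : realType.

Lemma integral_one_sub_cos (y : R) : y != 0 ->
  (\int[lam]_(s in `[0%R, 1%R]) (1 - cos (s * y))%:E = (1 - sin y / y)%:E)%E.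
Proof.
move=> y0; pose F (s : R) := s - sin (s * y) / y.
have dF (s : R) : is_derive s (1 : R) F (1 - cos (s * y)).
  rewrite /F; apply: is_derive_eq.
  by rewrite /GRing.scale/=; field.
have cF : continuous F.
  by move=> s; apply: differentiable_continuous; apply/derivable1_diffP; case: (dF s).
rewrite (@continuous_FTC2 _ _ F)//.
- by rewrite /F mul1r mul0r sin0 mul0r subr0 sube0.
- apply: continuous_subspaceT => s; apply: continuousB; first exact: cst_continuous.
  apply: (@continuous_comp _ _ _ (fun s : R => s * y) cos); last exact: continuous_cos.
  exact: mulrr_continuous.
- split => [s _|| ].
  + by case: (dF s).
  + by apply: cvg_at_right_filter; exact: cF.
  + by apply: cvg_at_left_filter; exact: cF.
- by move=> s _; rewrite derive1E; exact: derive_val.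
Qed.

(** Averaging [1 - cos (s y)] over [s] in the unit interval gives
    [1 - sin y / y], which is at least one half once [|y| >= 2]. *)
Lemma truncation_inequality d (T : measurableType d)
  (m : {sigma_finite_measure set T -> \bar R}) (Y : T -> R) (K : \bar R) :
  measurable_fun setT Y ->
  (forall s, 0 <= s <= 1 -> (\int[m]_w (1 - cos (s * Y w))%:E <= K)%E) ->
  (m [set w | (2 <= `|Y w|)%R] <= 2%:E * K)%E.
Proof.
move=> mY HK.
pose U : set R := `[0, 1]%classic.
have mU : measurable U by exact: measurable_itv.
have lamU : lam U = 1%E by rewrite /U lebesgue_measure_itv/= lte_fin ltr01 sube0.
pose h (p : T * R) : \bar R := (\1_U p.2 * (1 - cos (p.2 * Y p.1)))%:E.
have mh : measurable_fun setT h.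
  apply/measurable_EFinP; apply: measurable_funM.
    by apply: (measurableT_comp (measurable_indic mU)); exact: measurable_snd.
  apply: measurable_funB; first exact: measurable_cst.
  apply: (measurableT_comp (continuous_measurable_fun (@continuous_cos R))).
  apply: measurable_funM; first exact: measurable_snd.
  by apply: (measurableT_comp mY); exact: measurable_fst.
have h0 p : (0 <= h p)%E by rewrite lee_fin mulr_ge0// one_sub_cos_ge0.
have inner w : (\int[lam]_s h (w, s) = \int[lam]_(s in U) (1 - cos (s * Y w))%:E)%E.
  rewrite [RHS]integral_mkcond; apply: eq_integral => s _.
  rewrite /h/= patchE indicE; case: ifP => _; first by rewrite mul1r.
  by rewrite mul0r.
have mA : measurable [set w | (2 <= `|Y w|)%R].
  by apply: measurable_ge; exact: measurable_fun_norm.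
have lb : (m [set w | (2 <= `|Y w|)%R] <= 2%:E * \int[m]_w \int[lam]_s h (w, s))%E.
  rewrite -ge0_integralZl//; last 2 first.
  - apply: measurable_fun_fubini_tonelli_F => //.
  - by move=> w _; apply: integral_ge0.
  rewrite -[X in (m X <= _)%E]setIT -integral_indic//.
  apply: ge0_le_integral => //.
  - by apply/measurable_EFinP; exact: measurable_indic.
  - apply: measurable_funeM; exact: measurable_fun_fubini_tonelli_F.
  move=> w _; rewrite indicE; case: (boolP (w \in _)); last first.
    by move=> _; rewrite mule_ge0//; apply: integral_ge0.
  rewrite inE/= => Yw; have Yn0 : Y w != 0.
    by rewrite -normr_gt0; apply: lt_le_trans Yw.
  rewrite inner integral_one_sub_cos// -EFinM lee_fin.
  have : `|sin (Y w) / Y w| <= 2^-1.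
    rewrite normrM normfV ler_pdivrMr ?normr_gt0//.
    by have := sin_max (Y w); move: Yw; move: `|_| => x y; lra.
  by rewrite ler_norml => /andP[_]; lra.
apply: (le_trans lb); rewrite lee_pmul2l//.
rewrite fubini_tonelli//.
apply: (@le_trans _ _ (\int[lam]_(s in U) K)%E); last first.
  by rewrite integral_cst// [X in (_ * X)%E]lamU mule1.
rewrite [leRHS]integral_mkcond; apply: ge0_le_integral => //.
- by move=> s _; apply: integral_ge0.
- exact: measurable_fun_fubini_tonelli_G.
- apply/(measurable_restrictT _ mU); exact: measurable_cst.
move=> s _; rewrite patchE; case: ifP => [|sU].
  rewrite inE /U/= in_itv/= => sU.
  apply: le_trans (HK s sU); apply: ge0_le_integral => //.
  - by apply: (measurableT_comp mh); exact: measurable_pair2.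
  - apply/measurable_EFinP; apply: measurable_funB; first exact: measurable_cst.
    apply: (measurableT_comp (continuous_measurable_fun (@continuous_cos R))).
    by apply: measurable_funM => //; exact: measurable_cst.
  - move=> w _; rewrite /h/= lee_fin indicE.
    by case: (_ \in _); rewrite ?mul1r// mul0r one_sub_cos_ge0.
by rewrite integral0_eq// => w _; rewrite /h/= indicE sU mul0r.
Qed.

End truncation_inequality.

(** * Completeness of convergence in probability *)

Section cvg_in_probability.
Context d0 (T : measurableType d0) (R : realType) (P : probability T R).

Lemma prob_le (A B : set T) : measurable A -> measurable B -> A `<=` B ->
  (P A <= P B)%E.
Proof. by move=> mA mB AB; apply: le_measure => //; rewrite inE. Qed.

Lemma prob_subU (A B C : set T) (x y : \bar R) : measurable A -> measurable B ->
  measurable C -> A `<=` B `|` C -> (P B <= x)%E -> (P C <= y)%E -> (P A <= x + y)%E.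
Proof.
move=> mA mB mC ABC Bx Cy; apply: (@le_trans _ _ (P (B `|` C))).
  by apply: prob_le => //; exact: measurableU.
apply: (le_trans (measureU2 _ mB mC)); exact: leeD.
Qed.

Lemma measurable_dist_ge (e : R) (f g : T -> R) : measurable_fun setT f ->
  measurable_fun setT g -> measurable [set w | e <= `|f w - g w|].
Proof.
by move=> mf mg; apply: measurable_ge; apply: measurable_fun_norm; exact: measurable_funB.
Qed.

(** Completeness of convergence in probability: along a subsequence whose
    increments exceed [2^-k] with probability at most [2^-k], the sequence is
    eventually Cauchy outside sets of small probability. *)
Lemma L0_complete (u : nat -> T -> R) : (forall n, measurable_fun setT (u n)) ->
  (forall e, 0 < e -> exists N, forall n m, (N <= n)%N -> (N <= m)%N ->
     (P [set w | (e <= `|u n w - u m w|)%R] <= e%:E)%E) ->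
  exists2 Z : T -> R, measurable_fun setT Z &
    forall e, 0 < e -> exists N, forall n, (N <= n)%N ->
     (P [set w | (e <= `|u n w - Z w|)%R] <= e%:E)%E.
Proof.
move=> mU H.
pose hp k : R := 2^-1 ^+ k.
have hp0 k : 0 < hp k by rewrite exprn_gt0// invr_gt0.
have hpS k : hp k = hp k.+1 + hp k.+1 by rewrite /hp exprS; lra.
have /choice[N HN] := fun k => H (hp k) (hp0 k).
pose n_ k := (k + \sum_(i < k.+1) N i)%N.
have n_mono i j : (i <= j)%N -> (n_ i <= n_ j)%N.
  move=> ij; apply: leq_add => //; rewrite -!(big_mkord xpredT N) (@big_cat_nat _ _ _ i.+1 0 j.+1)//=.
  exact: leq_addr.
have n_N i : (N i <= n_ i)%N by rewrite /n_ big_ord_recr/= addnA leq_addl.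
pose x k := u (n_ k).
pose bad i := [set w | hp i <= `|x i.+1 w - x i w|].
have mbad i : measurable (bad i) by apply: measurable_dist_ge; exact: mU.
have pbad i : (P (bad i) <= (hp i)%:E)%E.
  by apply: HN; [apply: (leq_trans (n_N i)); exact: n_mono|exact: n_N].
pose Bad k := \bigcup_i bad (k + i)%N.
have mBad k : measurable (Bad k) by exact: bigcupT_measurable.
have pBad k : (P (Bad k) <= (2 * hp k)%:E)%E.
  apply: (@le_trans _ _ (\sum_(0 <= i <oo) P (bad (k + i)%N))%E).
    by apply: measure_sigma_subadditive.
  apply: le_trans (epsilon_trick0 xpredT (_ : 0 <= 2 * hp k)); last by rewrite mulr_ge0// ltW.
  apply: lee_nneseries => // i _; apply: (le_trans (pbad _)).
  rewrite lee_fin /hp exprD natrX exprS exprVn (exprVn 2 i) invfM.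
  by rewrite le_eqVlt; apply/orP; left; apply/eqP; field; rewrite !expf_neq0.
have good k w : ~ Bad k w -> forall i, `|x (k + i)%N w - x k w| <= 2 * hp k - 2 * hp (k + i)%N.
  move=> nB; elim=> [|i IH]; first by rewrite addn0 !subrr normr0.
  have hi : `|x (k + i).+1 w - x (k + i)%N w| < hp (k + i)%N.
    by rewrite ltNge; apply/negP => h; apply: nB; exists i.
  rewrite addnS; have := hpS (k + i)%N => h2.
  rewrite (_ : _ - _ = (x (k + i).+1 w - x (k + i)%N w) + (x (k + i)%N w - x k w)).
    by apply: (le_trans (ler_normD _ _)); lra.
  by ring.
(* An upper limit is measurable and defined everywhere. *)
pose Z w := fine (limn_esup (fun k => (x k w)%:E)).
have mZ : measurable_fun setT Z.
  apply: (measurableT_comp (fine_measurable measurableT)).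
  by apply: measurable_fun_limn_esup => n; exact/measurable_EFinP/mU.
have cvgx k w : ~ Bad k w -> (fun i => x i w) @ \oo --> Z w.
  move=> nB.
  have cx : cvgn (fun i => x i w).
    apply: cauchy_cvg; apply: cauchy_exP => e e0.
    have nBj j : (k <= j)%N -> ~ Bad j w.
      move=> kj [i _ h]; apply: nB; exists (j - k + i)%N => //.
      by rewrite addnA subnKC.
    have [j1 _ hj1] := near_infty_natSinv_expn_lt (PosNum (divr_gt0 e0 (ltr0Sn _ 1))).
    pose j := maxn j1 k; exists (x j w); exists j => // i /= ji.
    have := good j w (nBj j (leq_maxr _ _)) (i - j)%N; rewrite subnKC// => h.
    rewrite /ball/= distrC; apply: (le_lt_trans h).
    have := hj1 j (leq_maxl _ _); rewrite /= div1r -exprVn -/(hp j).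
    have := hp0 i; lra.
  have e : limn_esup (fun k => (x k w)%:E) = (limn (fun i => x i w))%:E.
    have ce : (fun k => (x k w)%:E) @ \oo --> (limn (fun i => x i w))%:E.
      by apply: cvg_EFin => //; exact: nearW.
    rewrite is_cvg_limn_esupE; last by apply/cvg_ex; eexists; exact: ce.
    exact/cvg_lim.
  by rewrite /Z e.
have closeZ k w : ~ Bad k w -> `|x k w - Z w| <= 2 * hp k.
  move=> nB; have h1 := cvgx k w nB.
  have h2 : (fun i => `|x k w - x i w|) @ \oo --> `|x k w - Z w|.
    by apply: cvg_norm; apply: cvgB => //; exact: cvg_cst.
  apply: (cvgr_to_le h2); exists k => // i /= ki.
  have := good k w nB (i - k)%N; rewrite subnKC// distrC => h.
  by apply: (le_trans h); rewrite gerBl mulr_ge0// ltW.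
exists Z => // e e0.
have e4 : 0 < e / 2 by rewrite divr_gt0.
have [N1 HN1] := H _ e4.
have [j1 _ hj1] := near_infty_natSinv_expn_lt (PosNum (divr_gt0 e4 (ltr0Sn _ 1))).
pose k := maxn j1 N1.
have k2 : 2 * hp k < e / 2.
  have := hj1 k (leq_maxl _ _); rewrite /= div1r -exprVn -/(hp k); lra.
exists N1 => n N1n.
have -> : e%:E = (e / 2 + e / 2)%:E by rewrite -splitr.
rewrite EFinD; apply: (@prob_subU _ [set w | e / 2 <= `|u n w - x k w|] (Bad k)) => //.
- exact: measurable_dist_ge.
- by apply: measurable_dist_ge => //; exact: mU.
- move=> w /= ew; have [|nB] := pselect (Bad k w); [by right|left].
  have := closeZ k w nB => h.
  have := ler_normD (u n w - x k w) (x k w - Z w).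
  rewrite addrA subrK /= => h2; move: ew h h2 k2; move: `|_| `|_| `|_| (hp k) => p q r t.
  by move=> *; lra.
- apply: HN1 => //; apply: (leq_trans (leq_maxr j1 N1)); exact: leq_addr.
- by apply: (le_trans (pBad k)); rewrite lee_fin ltW.
Qed.

End cvg_in_probability.

Section cvg_in_probability_rV.
Context d0 (T : measurableType d0) (R : realType) (P : probability T R) (d : nat).
Notation Rd := 'rV[R]_d.

Lemma dot_ge0 (x : Rd) : 0 <= dot x x.
Proof. by apply: sumr_ge0 => i _; rewrite -expr2 sqr_ge0. Qed.

Lemma coord_le_enorm (x : Rd) i : `|x ord0 i| <= enorm x.
Proof.
rewrite -sqrtr_sqr /enorm ler_wsqrtr// /dot (bigD1 i)//= expr2 lerDl.
by apply: sumr_ge0 => j _; rewrite -expr2 sqr_ge0.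
Qed.

Lemma enorm_le_sum (x : Rd) : enorm x <= \sum_i `|x ord0 i|.
Proof.
have s0 : 0 <= \sum_i `|x ord0 i| by apply: sumr_ge0.
rewrite -(ger0_norm s0) -sqrtr_sqr ler_wsqrtr// /dot expr2 mulr_suml.
apply: ler_sum => i _; apply: (@le_trans _ _ (`|x ord0 i| * `|x ord0 i|)).
  by rewrite -normrM ler_norm.
by rewrite ler_wpM2l// (bigD1 i)//= lerDl sumr_ge0.
Qed.

Lemma enorm_ge_coord (x : Rd) e : 0 < e -> e <= enorm x ->
  exists i, e / d.+1%:R <= `|x ord0 i|.
Proof.
move=> e0 ex; apply/not_existsP => h.
have : \sum_i `|x ord0 i| <= \sum_(i < d) e / d.+1%:R.
  by apply: ler_sum => i _; apply: ltW; rewrite ltNge; apply/negP; exact: h.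
rewrite sumr_const card_ord -[X in _ <= X]mulr_natr mulrAC ler_pdivlMr// leNgt => /negP; apply.
have s1 := le_trans ex (enorm_le_sum x).
apply: (@lt_le_trans _ _ (e * d.+1%:R)); first by rewrite ltr_pM2l// ltr_nat.
by rewrite ler_wpM2r.
Qed.

(** The constant, far from optimal, comes from comparing the norm with the sum of
    the coordinates. *)
Lemma enormD (x y : Rd) : enorm (x + y) <= (d%:R + 1) * (enorm x + enorm y).
Proof.
apply: (le_trans (enorm_le_sum _)).
apply: (@le_trans _ _ (\sum_(i < d) (enorm x + enorm y))).
  apply: ler_sum => i _; rewrite mxE; apply: (le_trans (ler_normD _ _)).
  by apply: lerD; exact: coord_le_enorm.
rewrite sumr_const card_ord -[X in X <= _]mulr_natl ler_wpM2r ?lerDl//.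
by rewrite addr_ge0// sqrtr_ge0.
Qed.

Lemma measurable_enorm (f : T -> Rd) : measurable_fun setT f ->
  measurable_fun setT (fun w => enorm (f w)).
Proof.
move=> mf; apply: (measurableT_comp (continuous_measurable_fun (@sqrt_continuous R))).
apply: measurable_sum => i.
by apply: measurable_funM; apply: (measurableT_comp (measurable_coord i)).
Qed.

Lemma measurable_fun_rVB (f g : T -> Rd) : measurable_fun setT f ->
  measurable_fun setT g -> measurable_fun setT (fun w => f w - g w).
Proof.
move=> mf mg; apply: measurable_fun_rV => i; under eq_fun do rewrite !mxE.
by apply: measurable_funB; apply: (measurableT_comp (measurable_coord i)).
Qed.

Lemma measurable_enorm_ge (e : R) (f g : T -> Rd) : measurable_fun setT f ->
  measurable_fun setT g -> measurable [set w | e <= enorm (f w - g w)].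
Proof.
by move=> mf mg; apply: measurable_ge; apply: measurable_enorm; exact: measurable_fun_rVB.
Qed.

(** A vector of norm at least [e] has a coordinate of size at least
    [e / (d + 1)]. *)
Lemma prob_enorm_le (f : T -> Rd) (e : R) (x : \bar R) : 0 < e ->
  measurable_fun setT f ->
  (forall i, (P [set w | (e / d.+1%:R <= `|f w ord0 i|)%R] <= x)%E) ->
  (P [set w | (e <= enorm (f w))%R] <= \sum_(i < d) x)%E.
Proof.
move=> e0 mf fx.
have mi i : measurable [set w | e / d.+1%:R <= `|f w ord0 i|].
  apply: measurable_ge; apply: measurable_fun_norm.
  exact: (measurableT_comp (measurable_coord i)).
apply: (@le_trans _ _ (P (\big[setU/set0]_(i < d) [set w | e / d.+1%:R <= `|f w ord0 i|]))).
  apply: prob_le.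
  - by apply: measurable_ge; exact: measurable_enorm.
  - exact: bigsetU_measurable.
  - move=> w /= /(enorm_ge_coord e0)[i hi]; rewrite -bigcup_seq; exists i => //=.
    by rewrite mem_index_enum.
have -> : (\sum_(i < d) x = \sum_(i <- index_enum 'I_d) x)%E by [].
elim: (index_enum _) => [|i r IH]; first by rewrite !big_nil measure0.
rewrite !big_cons; apply: (le_trans (measureU2 _ _ _)) => //.
  exact: bigsetU_measurable.
by apply: leeD; [exact: fx|exact: IH].
Qed.

Lemma L0_complete_rV (V : nat -> T -> Rd) : (forall n, measurable_fun setT (V n)) ->
  (forall e, 0 < e -> exists N, forall n m, (N <= n)%N -> (N <= m)%N ->
     (P [set w | (e <= enorm (V n w - V m w))%R] <= e%:E)%E) ->
  exists2 Z : T -> Rd, measurable_fun setT Z &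
    forall e, 0 < e -> exists N, forall n, (N <= n)%N ->
     (P [set w | (e <= enorm (V n w - Z w))%R] <= e%:E)%E.
Proof.
move=> mV H.
have mVi n i : measurable_fun setT (fun w => V n w ord0 i).
  exact: (measurableT_comp (measurable_coord i)).
have Zi (i : 'I_d) : exists Z : T -> R, measurable_fun setT Z /\
    forall e, 0 < e -> exists N, forall n, (N <= n)%N ->
     (P [set w | (e <= `|V n w ord0 i - Z w|)%R] <= e%:E)%E.
  have [//|e e0|Z mZ hZ] := @L0_complete _ _ _ P (fun n w => V n w ord0 i); last by exists Z.
  have [N HN] := H e e0; exists N => n m Nn Nm; apply: le_trans (HN n m Nn Nm).
  apply: prob_le; [exact: measurable_dist_ge|exact: measurable_enorm_ge|].
  move=> w /= h; apply: (le_trans h); have := coord_le_enorm (V n w - V m w) i.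
  by rewrite !mxE.
have /choice[Z HZ] := Zi.
have mZ : measurable_fun setT (fun w => \row_i Z i w : Rd).
  by apply: measurable_fun_rV => i; under eq_fun do rewrite mxE; case: (HZ i).
exists (fun w => \row_i Z i w) => // e e0.
have e1 : 0 < Num.min (e / d.+1%:R) (e / d.+1%:R) by rewrite minxx divr_gt0.
rewrite minxx in e1.
have /choice[N HN] := fun i => (HZ i).2 _ e1.
exists (\max_i N i)%N => n Nn.
apply: (@le_trans _ _ (\sum_(i < d) (e / d.+1%:R)%:E)%E).
  apply: prob_enorm_le => //; first exact: measurable_fun_rVB.
  move=> i; apply: le_trans (HN i n _); last by apply: leq_trans Nn; exact: leq_bigmax.
  rewrite le_eqVlt; apply/orP; left; apply/eqP; congr (P _).
  by apply/seteqP; split => w /=; rewrite !mxE.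
rewrite sumEFin lee_fin sumr_const card_ord -[X in X <= _]mulr_natr mulrAC ler_pdivrMr//.
by rewrite ler_pM2l// ler_nat.
Qed.

End cvg_in_probability_rV.

(** * Tails of elementary integrals *)

Section elementary_tail.
Variables (R : realType) (d : nat) (mu : probability 'rV[R]_d R).
Variables (X : set_indexed_rvs R d) (HX : is_random_measure mu X).
Notation P := (rm_prob X).

Lemma one_sub_Re_cfun d0 (T : measurableType d0) (Q : probability T R) (Y : T -> R) s :
  measurable_fun setT Y ->
  (\int[Q]_w (1 - cos (s * Y w))%:E)%E = (1 - Re (cfun Q Y s))%:E.
Proof.
move=> mY; have m : measurable_fun setT (fun w => s * Y w).
  by apply: measurable_funM => //; exact: measurable_cst.
have b1 : @bmeas _ T R (fun=> 1) by exact: bmeas_cst.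
rewrite cfunE/= -[X in (X - _)%:E](Rintegral_prob_cst Q) -RintegralB_bmeas//.
  rewrite /Rintegral fineK//; apply: integrable_fin_num => //.
  by apply: bmeas_integrable; apply: bmeasB => //; exact: bmeas_cos.
exact: bmeas_cos.
Qed.

Lemma measurable_rm_comb (J : finType) (E : J -> set R) (a : J -> R) :
  measurable_fun setT (fun w => \sum_j a j *: X (E j) w).
Proof.
apply: measurable_fun_rV => i.
have : measurable_fun setT
    (fun w => dot (delta_mx ord0 i) (\sum_j a j *: X (E j) w)).
  exact: measurable_dot_comb.
by under eq_fun do rewrite dot_delta.
Qed.

(** The exponent in each coordinate direction vanishes at zero and is at most
    [eta1 + K s^2]; integrated along the elementary function, this bounds one minus
    the characteristic function, and the truncation inequality bounds the tail. *)
Lemma elementary_tail (e eta : R) : 0 < e -> 0 < eta -> exists2 K, 0 < K &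
  forall (I : finType) (W : set R) (D : I -> set R) (c : I -> R),
  bounded_borel W -> (forall i, measurable (D i)) -> (forall i, D i `<=` W) ->
  (P [set w | (e <= enorm (\sum_i c i *: X (D i) w))%R] <=
   \int[lam]_(x in W) (eta * (comb_fun D c x != 0)%:R + K * comb_fun D c x ^+ 2)%:E)%E.
Proof.
move=> e0 eta0.
pose e1 := e / d.+1%:R; have e10 : 0 < e1 by rewrite divr_gt0.
have d10 : 0 < d.+1%:R :> R by [].
pose eta1 := eta / (4 * d.+1%:R).
have eta10 : 0 < eta1 by rewrite divr_gt0// mulr_gt0.
have /choice[ex Hex] : forall i : 'I_d, exists c : R -> R[i], exists2 K, 0 < K &
    [/\ forall s, 0 <= - Re (c s), c 0 = 0,
     forall s, - Re (c s) + `|Im (c s)| <= eta1 + K * s ^+ 2 &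
     forall B s, bounded_borel B ->
       rm_cfun X (delta_mx ord0 i) B s = cexp ((fine (lam B))%:C * c s)].
  move=> i; have [c [c1 c2 c00 cE]] := levy_exponent HX (delta_mx ord0 i).
  exists c; have dbl s := exponent_doubling cE s.
  have cR : continuous (fun s => - Re (c s)) by move=> s; apply: continuousN; exact: c1.
  have [|||||K K0 HK] := quadratic_growth (cR 0) (c2 0) _ _ _ _ _ eta10.
  - by rewrite c00 oppr0.
  - by rewrite c00.
  - by move=> s; case: (dbl s).
  - by move=> s; case: (dbl s).
  - by move=> s; case: (dbl s).
  by exists K => //; split => // s; case: (dbl s).
have /choice[K HK] : forall i, exists K, 0 < K /\ [/\ forall s, 0 <= - Re (ex i s), ex i 0 = 0,
     forall s, - Re (ex i s) + `|Im (ex i s)| <= eta1 + K * s ^+ 2 &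
     forall B s, bounded_borel B ->
       rm_cfun X (delta_mx ord0 i) B s = cexp ((fine (lam B))%:C * ex i s)].
  by move=> i; have [K K0 h] := Hex i; exists K.
pose K1 := 1 + \sum_i K i.
have K10 : 0 < K1.
  by rewrite ltr_pwDl// sumr_ge0// => i _; have [/ltW] := HK i.
have KK1 i : K i <= K1.
  rewrite /K1 (bigD1 i)//= addrCA lerDl addr_ge0// sumr_ge0// => j _.
  by have [/ltW] := HK j.
pose K2 := 4 * d.+1%:R * (K1 * (2 / e1) ^+ 2).
have K20 : 0 < K2.
  by rewrite !mulr_gt0// ?invr_gt0//.
exists K2 => // I W D c bW mD DW.
pose F x := 2 * (eta1 * (x != 0)%:R + K1 * (2 / e1) ^+ 2 * x ^+ 2).
have F0 x : 0 <= F x.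
  have h1 : 0 <= eta1 * (x != 0)%:R by rewrite mulr_ge0// ltW.
  have h2 : 0 <= K1 * (2 / e1) ^+ 2 * x ^+ 2.
    by apply: mulr_ge0; [apply: mulr_ge0|]; rewrite ?sqr_ge0// ltW.
  by rewrite /F mulr_ge0// addr_ge0.
pose g := comb_fun D c.
have mg : measurable_fun setT g.
  by apply: measurable_sum => i; apply: measurable_funM => //; exact: measurable_indic.
have mF : measurable_fun W (fun x => (F (g x))%:E).
  apply/measurable_EFinP; apply: measurable_funTS.
  apply: measurable_funM; first exact: measurable_cst.
  apply: measurable_funD; apply: measurable_funM; try exact: measurable_cst.
    rewrite (_ : (fun x => _) = \1_(~` (g @^-1` [set 0]))).
      apply: measurable_indic; apply: measurableC; rewrite -[X in measurable X]setTI.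
      exact: mg.
    apply/funext => y; rewrite indicE; case: (eqVneq (g y) 0) => gx.
      by rewrite memNset//= => /(_ gx).
    by rewrite mem_set//=; exact/eqP.
  by under eq_fun do rewrite expr2; exact: measurable_funM.
have bound i : (P [set w | (e1 <= `|(\sum_j c j *: X (D j) w) ord0 i|)%R] <=
    2%:E * \int[lam]_(x in W) (F (g x))%:E)%E.
  have [_ [ege e00 eb eE]] := HK i.
  pose Y w := 2 / e1 * (\sum_j c j *: X (D j) w) ord0 i.
  have mS : measurable_fun setT (fun w => (\sum_j c j *: X (D j) w) ord0 i).
    by apply: (measurableT_comp (measurable_coord i)); exact: measurable_rm_comb.
  have mY : measurable_fun setT Y by apply: measurable_funM => //; exact: measurable_cst.
  have YE w : (2 <= `|Y w|) = (e1 <= `|(\sum_j c j *: X (D j) w) ord0 i|).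
    have p : 0 <= 2 / e1 by rewrite divr_ge0// ltW.
    by rewrite /Y normrM (ger0_norm p) mulrAC ler_pdivlMr// ler_pM2l.
  rewrite (_ : mkset _ = [set w | 2 <= `|Y w|]); last first.
    by apply/seteqP; split => w /=; rewrite YE.
  apply: truncation_inequality => // s /andP[s0 s1].
  have -> : (\int[P]_w (1 - cos (s * Y w))%:E)%E =
     (\int[P]_w (1 - cos ((s * (2 / e1)) * (\sum_j c j *: X (D j) w) ord0 i))%:E)%E.
    by apply: eq_integral => w _; rewrite /Y mulrA.
  rewrite one_sub_Re_cfun//.
  have := @cfun_comb_le _ _ _ _ c bW mD DW _ _ _ HX (delta_mx ord0 i) _ eE (s * (2 / e1)) F ege.
  under eq_fun do rewrite dot_delta; apply => y.
  have [->|x0] := eqVneq y 0.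
    by rewrite mulr0 e00/= oppr0 normr0 addr0 mulr0; exact: F0.
  rewrite /F x0 mulr1 ler_pM2l//; apply: (le_trans (eb _)); rewrite lerD2l.
  rewrite exprMn mulrA ler_wpM2r ?sqr_ge0// exprMn; apply: ler_pM => //.
  - by have [/ltW] := HK i.
  - by rewrite mulr_ge0 ?sqr_ge0.
  - by rewrite ler_piMl ?sqr_ge0// expr_le1.
apply: (le_trans (prob_enorm_le e0 (measurable_rm_comb _ _) bound)).
have I0 : (0 <= \int[lam]_(x in W) (F (g x))%:E)%E.
  by apply: integral_ge0 => x _; rewrite lee_fin.
apply: (@le_trans _ _ ((2 * d.+1%:R)%:E * \int[lam]_(x in W) (F (g x))%:E)%E).
  rewrite big_const_ord; elim: (d) => [|k IH].
    by rewrite /= mule_ge0// lee_fin.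
  rewrite iterS; apply: (le_trans (leeD (lexx _) IH)).
  by rewrite -ge0_muleDl ?lee_fin ?mulr_ge0// -EFinD -[X in X + _](mulr1) -mulrDr -[X in X + _]/(1%:R) -natrD.
rewrite -ge0_integralZl//; last 2 first.
- by case: bW.
- by move=> x _; rewrite lee_fin.
rewrite le_eqVlt; apply/orP; left; apply/eqP; apply: eq_integral => x _.
rewrite -EFinM; congr EFin; rewrite /F /K2 /eta1 -/(g x); move: (K1 * _) ((_ != 0)%:R) => u v.
by move: d10; move: (d.+1%:R) => D1 D10; field; rewrite lt0r_neq0.
Qed.

End elementary_tail.

(** * Exhaustion of an open interval *)

Section ereal_nbhs0.
Variable R : realType.

Lemma ereal_nbhs0_le (e : R) : 0 < e -> nbhs (0%E : \bar R) [set x | (x <= e%:E)%E].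
Proof.
move=> e0; change (nbhs (0 : R) (fun r : R => (r%:E <= e%:E)%E)).
apply/nbhs_ballP; exists e => //= r; rewrite /ball/= sub0r normrN => re.
by rewrite /= lee_fin; apply: ltW; apply: le_lt_trans re; exact: ler_norm.
Qed.

Lemma ereal_nbhs0_sub (U : set (\bar R)) : nbhs (0%E : \bar R) U ->
  exists2 e : R, 0 < e & forall x : \bar R, (0 <= x)%E -> (x <= e%:E)%E -> U x.
Proof.
change (nbhs (0 : R) (fun r : R => U r%:E) -> exists2 e : R, 0 < e & forall x : \bar R, (0 <= x)%E -> (x <= e%:E)%E -> U x).
move=> /nbhs_ballP[e /= e0 he]; exists (e / 2); first by rewrite divr_gt0.
move=> [r| |] //; rewrite !lee_fin => r0 re; apply: he.
by rewrite /ball/= sub0r normrN ger0_norm//; lra.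
Qed.

End ereal_nbhs0.

Section measurable_function_pack.
Context d1 d2 (T1 : measurableType d1) (T2 : measurableType d2) (g : T1 -> T2).
Hypothesis mg : measurable_fun setT g.

(** An alias of [g] that carries the structure of a measurable function, so that
    [g] can serve as a random variable. *)
Definition mfun_pack of measurable_fun setT g := g.

HB.instance Definition _ := isMeasurableFun.Build _ _ _ _ (mfun_pack mg) mg.

Lemma mfun_exists : exists h : {mfun T1 >-> T2}, h = g :> (T1 -> T2).
Proof. by exists (mfun_pack mg). Qed.

End measurable_function_pack.

Section exhaustion.
Variable R : realType.

Lemma exhaust_left (a : \bar R) (c : R) : (a < c%:E)%E -> exists p : nat -> R,
  [/\ forall n, (a < (p n)%:E)%E /\ p n < c, forall n m, (n <= m)%N -> p m <= p n &
      forall x : R, (a < x%:E)%E -> exists N, forall n, (N <= n)%N -> p n < x].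
Proof.
case: a => [r| |] //= rc.
  rewrite lte_fin in rc.
  have rc0 : 0 < c - r by rewrite subr_gt0.
  exists (fun n => r + (c - r) / n.+2%:R); split.
  - move=> n; rewrite lte_fin ltrDl divr_gt0//; split => //.
    by rewrite -ltrBrDl ltr_pdivrMr// ltr_pMr// ltr1n.
  - by move=> n m nm; rewrite lerD2l ler_pM2l// lef_pV2 ?posrE// ler_nat !ltnS.
  - move=> x; rewrite lte_fin => rx.
    have xr : 0 < (x - r) / (c - r) by rewrite divr_gt0// subr_gt0.
    have [N _ hN] := near_infty_natSinv_lt (PosNum xr).
    exists N => n Nn.
    have : n.+2%:R^-1 * (c - r) < x - r by rewrite -ltr_pdivlMr//; exact: hN n.+1 (leqW Nn).
    by rewrite mulrC ltrBrDl.
exists (fun n => c - n.+1%:R); split.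
- by move=> n; rewrite ltNyr gtrBl.
- by move=> n m nm; rewrite lerD2l lerN2 ler_nat ltnS.
- move=> x _; exists (Num.truncn `|c - x|) => n Nn.
  have h1 := truncnS_gt `|c - x|.
  have h2 : (Num.truncn `|c - x|).+1%:R <= n.+1%:R :> R by rewrite ler_nat ltnS.
  by have := ler_norm (c - x); lra.
Qed.

Lemma exhaust_right (b : \bar R) (c : R) : (c%:E < b)%E -> exists q : nat -> R,
  [/\ forall n, ((q n)%:E < b)%E /\ c < q n, forall n m, (n <= m)%N -> q n <= q m &
      forall x : R, (x%:E < b)%E -> exists N, forall n, (N <= n)%N -> x < q n].
Proof.
move=> cb; have : (- b < (- c)%:E)%E by rewrite EFinN lteN2.
move=> /exhaust_left[p [h1 h2 h3]]; exists (fun n => - p n); split.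
- by move=> n; have [h4 h5] := h1 n; rewrite EFinN lteNl; split => //; lra.
- by move=> n m nm; rewrite lerN2 h2.
- move=> x xb; have [|N hN] := h3 (- x); first by rewrite EFinN lteN2.
  by exists N => n /hN; lra.
Qed.

Lemma ereal_dense (a b : \bar R) : (a < b)%E -> exists c : R, (a < c%:E < b)%E.
Proof.
case: a => [r| |]; case: b => [s| |] //= ab.
- by rewrite lte_fin in ab; exists ((r + s) / 2); rewrite !lte_fin; apply/andP; split; lra.
- by exists (r + 1); rewrite ltry lte_fin ltrDl ltr01.
- by exists (s - 1); rewrite ltNyr lte_fin gtrBl ltr01.
- by exists 0; rewrite ltry ltNyr.
Qed.

Lemma exhaust_oitv (a b : \bar R) : (a < b)%E -> exists p q : nat -> R,
  [/\ forall n, [/\ oitv a b (p n), oitv a b (q n) & p n < q n],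
      forall n m, (n <= m)%N -> p m <= p n, forall n m, (n <= m)%N -> q n <= q m &
      forall x, oitv a b x -> exists N, forall n, (N <= n)%N -> p n < x <= q n].
Proof.
move=> /ereal_dense[c /andP[ac cb]].
have [p [p1 p2 p3]] := exhaust_left ac; have [q [q1 q2 q3]] := exhaust_right cb.
exists p, q; split => //.
  move=> n; have [h1 h2] := p1 n; have [h3 h4] := q1 n; rewrite /oitv/=; split.
  - by rewrite h1 (lt_trans _ cb)// lte_fin.
  - by rewrite h3 (lt_trans ac)// lte_fin.
  - exact: lt_trans h4.
move=> x /andP[ax xb]; have [N1 h1] := p3 x ax; have [N2 h2] := q3 x xb.
exists (maxn N1 N2) => n; rewrite geq_max => /andP[n1 n2].
by rewrite h1// ltW// h2.
Qed.

End exhaustion.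

Section oitv.
Variables (R : realType) (a b : \bar R).

Lemma measurable_oitv : measurable (oitv a b).
Proof.
rewrite (_ : oitv a b = setT `&` EFin @^-1` `]a, b[%classic).
  have mE : measurable_fun setT (EFin : R -> \bar R).
    by apply/measurable_EFinP; exact: measurable_id.
  by apply: mE => //; exact: emeasurable_itv.
by rewrite setTI; apply/seteqP; split => s; rewrite /oitv/= in_itv.
Qed.

Lemma inner_borel_bounded B : inner_borel a b B -> bounded_borel B.
Proof.
move=> [mB BD lB uB]; split => //.
have [B0|/set0P[x0 Bx0]] := eqVneq B set0.
  by rewrite B0; case: (bounded_borel0 R).
have [l hl] : exists l : R, forall x, B x -> l <= x.
  have : (ereal_inf (EFin @` B) <= x0%:E)%E by apply: ereal_inf_lbound; exists x0.
  move: lB; case E : (ereal_inf _) => [l| |] h1 h2.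
  - by exists l => x Bx; rewrite -lee_fin -E; apply: ereal_inf_lbound; exists x.
  - by rewrite leye_eq in h2.
  - by rewrite ltNge leNye in h1.
have [u hu] : exists u : R, forall x, B x -> x <= u.
  have : (x0%:E <= ereal_sup (EFin @` B))%E by apply: ereal_sup_ubound; exists x0.
  move: uB; case E : (ereal_sup _) => [u| |] h1 h2.
  - by exists u => x Bx; rewrite -lee_fin -E; apply: ereal_sup_ubound; exists x.
  - by rewrite ltNge leey in h1.
  - by rewrite leeNy_eq in h2.
exists (`|l| + `|u|); split; first exact: num_real.
move=> M hM x Bx /=; have := hl x Bx; have := hu x Bx.
have := ler_norm u; have := normr_ge0 u; have := normr_ge0 l.
have : - `|l| <= l by rewrite lerNl -normrN ler_norm.
by rewrite ler_norml => *; apply/andP; split; lra.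
Qed.

Lemma inner_borel_itv p q : oitv a b p -> oitv a b q ->
  inner_borel a b `]p, q].
Proof.
rewrite /oitv/= => /andP[ap pb] /andP[aq qb]; split => //.
- move=> x /=; rewrite in_itv/= => /andP[px xq]; apply/andP; split.
    by apply: lt_trans ap _; rewrite lte_fin.
  by apply: le_lt_trans qb; rewrite lee_fin.
- apply: (lt_le_trans ap); apply/ereal_infP => _ [x /= + <-].
  by rewrite in_itv/= => /andP[px _]; rewrite lee_fin ltW.
- apply: le_lt_trans qb; apply/ereal_supP => _ [x /= + <-].
  by rewrite in_itv/= => /andP[_ xq]; rewrite lee_fin.
Qed.

End oitv.

Lemma measurable_supp (R : realType) (D : set R) (f : R -> R) : measurable_fun D f ->
  measurable_fun D (fun x => \1_[set t | f t != 0] x : R).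
Proof.
move=> mf.
rewrite (_ : (fun x => _) = (fun x => \1_(~` [set 0]) (f x))).
  apply: (measurableT_comp _ mf); apply: measurable_indic.
  by apply: measurableC; exact: measurable_set1.
apply/funext => x; rewrite !indicE; have [fx|fx] := eqVneq (f x) 0.
  by rewrite !memNset//= fx ?eqxx//; exact.
by rewrite !mem_set//=; exact/eqP.
Qed.

(** * Integrals of square integrable functions with small support *)

Section sufficient.
Variables (R : realType) (d : nat) (mu : probability 'rV[R]_d R).
Variables (X : set_indexed_rvs R d) (HX : is_random_measure mu X).
Variables (a b : \bar R) (f : R -> R).
Local Notation D := (oitv a b).
Hypothesis mf : measurable_fun D f.
Notation P := (rm_prob X).
Hypothesis supp_fin : (\int[lam]_(s in D) (\1_[set t | f t != 0] s)%:E < +oo)%E.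
Hypothesis sqr_fin : (\int[lam]_(s in D) ((f s) ^+ 2)%:E < +oo)%E.

Let mD : measurable D. Proof. exact: measurable_oitv. Qed.

Definition step_sf n : simple_fun a b :=
  @SimpleFun R a b _ (step_coef R) (step_set D f n)
    (fun j => @measurable_step_set _ _ _ D mD f mf n j)
    (fun j => @subIsetl _ D _) (@trivIset_step_set _ _ _ D f n).

Let step_integral n B (w : rm_space X) := simple_integral (step_sf n) B w.

Let comb_set n m B B' (i : 'I_(2 * n.+1 * n.+1) + 'I_(2 * m.+1 * m.+1)) : set R :=
  match i with inl j => B `&` step_set D f n j | inr j => B' `&` step_set D f m j end.
Let comb_coef n m (i : 'I_(2 * n.+1 * n.+1) + 'I_(2 * m.+1 * m.+1)) : R :=
  match i with inl j => step_coef R j | inr j => - step_coef R j end.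

Let WB n m B B' w :
  step_integral n B w - step_integral m B' w = \sum_i comb_coef i *: X (@comb_set n m B B' i) w.
Proof.
rewrite big_sumType/=; congr (_ + _).
by rewrite -sumrN; apply: eq_bigr => j _; rewrite scaleNr.
Qed.

Let comb_funE n m B B' x : comb_fun (@comb_set n m B B') (@comb_coef n m) x =
  \1_B x * step_fun D f n x - \1_B' x * step_fun D f m x.
Proof.
rewrite /comb_fun big_sumType/= /step_fun !mulr_sumr -sumrN; congr (_ + _).
  by apply: eq_bigr => j _; rewrite indicI mulrCA.
by apply: eq_bigr => j _; rewrite indicI mulNr mulrCA.
Qed.

Let sqr_err n : \bar R := (\int[lam]_(x in D) ((step_fun D f n x - f x) ^+ 2)%:E)%E.
Let sym_diff (B B' : set R) : set R := (B `\` B') `|` (B' `\` B).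
Let sqr_mass (S : set R) : \bar R := (\int[lam]_(x in D) (f x ^+ 2 * \1_S x)%:E)%E.

Let msupp : measurable_fun D (fun x => \1_[set t | f t != 0] x : R).
Proof. exact: measurable_supp. Qed.

Let mf2 : measurable_fun D (fun x => f x ^+ 2).
Proof. by under eq_fun do rewrite expr2; exact: measurable_funM. Qed.

Let mstep n : measurable_fun D (step_fun D f n).
Proof. exact/measurable_funTS/measurable_step_fun. Qed.

Let mdiff n : measurable_fun D (fun x => (step_fun D f n x - f x) ^+ 2).
Proof.
have m : measurable_fun D (fun x => step_fun D f n x - f x) by exact: measurable_funB.
by under eq_fun do rewrite expr2; exact: measurable_funM.
Qed.

(** Where [|f|] is at most [n + 1] the error is at most one, and it vanishes with
    [f]; elsewhere the discretisation is zero. *)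
Let step_err_le n x : D x ->
  (step_fun D f n x - f x) ^+ 2 <= \1_[set t | f t != 0] x + f x ^+ 2.
Proof.
move=> Dx; have [fx|fx] := eqVneq (f x) 0.
  by rewrite (step_fun0 _ _ fx) fx subrr expr0n/= addr0.
rewrite indicE mem_set//= mulr1n.
have [xN|xN] := boolP (- n.+1%:R <= f x < n.+1%:R).
  have := step_fun_near Dx xN; rewrite distrC -(real_normK (num_real (_ - _))) => h.
  have : `|step_fun D f n x - f x| <= 1 by apply: (le_trans h); rewrite invf_le1// ler1n.
  have := normr_ge0 (step_fun D f n x - f x); have := sqr_ge0 (f x).
  by rewrite (expr2 `|_|); move: `|_| => y; nra.
rewrite step_fun_out ?sub0r ?sqrrN ?lerDr// => j [_ /= /andP[j1 j2]].
move/negP: xN; apply; have := @step_fun_le _ _ _ D f n.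
have Np : 0 < n.+1%:R :> R by [].
have h0 : 0 <= (f x + n.+1%:R) * n.+1%:R by apply: le_trans j1.
have h1 : (f x + n.+1%:R) * n.+1%:R < 2 * n.+1%:R * n.+1%:R.
  by apply: (lt_le_trans j2); rewrite -!natrM ler_nat; exact: ltn_ord.
move=> _; apply/andP; split; first by move: h0; rewrite pmulr_lge0//; lra.
by move: h1; rewrite ltr_pM2r//; lra.
Qed.

Let int_dom : lam.-integrable D (fun x => (\1_[set t | f t != 0] x + f x ^+ 2)%:E).
Proof.
apply/integrableP; split; first by apply/measurable_EFinP; exact: measurable_funD.
under eq_integral do rewrite gee0_abs ?lee_fin ?addr_ge0 ?sqr_ge0// EFinD.
rewrite ge0_integralD//.
- by rewrite lte_add_pinfty.
- exact/measurable_EFinP.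
- by move=> x _; rewrite lee_fin sqr_ge0.
- exact/measurable_EFinP.
Qed.

Let sqr_err_small e : 0 < e -> exists N, forall n, (N <= n)%N -> (sqr_err n <= e%:E)%E.
Proof.
move=> e0.
have [] := @dominated_convergence _ _ _ lam D mD
  (fun n x => ((step_fun D f n x - f x) ^+ 2)%:E) (fun=> 0%E) _ _ _ _ int_dom.
- by move=> n; apply/measurable_EFinP; exact: mdiff.
- exact: measurable_cst.
- apply: aeW => x Dx; apply: cvg_EFin; first exact: nearW.
  have h : (fun n => (step_fun D f n x - f x) ^+ 2) @ \oo --> (f x - f x) ^+ 2.
    apply: (@cvg_seq_continuous _ (fun y => y ^+ 2)); first exact: exprn_continuous.
    by apply: cvgB; [exact: step_fun_cvg|exact: cvg_cst].
  by rewrite subrr expr0n/= in h.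
- apply: aeW => x n Dx; rewrite gee0_abs ?lee_fin ?sqr_ge0//.
  exact: step_err_le.
move=> _ _; rewrite integral0 => h.
by have [N _ hN] := h _ (ereal_nbhs0_le e0); exists N.
Qed.

Let L := fine (\int[lam]_(s in D) (\1_[set t | f t != 0] s)%:E)%E.
Let LE : (\int[lam]_(s in D) (\1_[set t | f t != 0] s)%:E = L%:E)%E.
Proof.
by rewrite /L fineK// ge0_fin_numE//; apply: integral_ge0 => s _; rewrite lee_fin.
Qed.

(** Where the indicators agree only the discretisation errors matter; on the
    symmetric difference one of the two terms is left. *)
Let pointwise n m B B' x : D x ->
  (\1_B x * step_fun D f n x - \1_B' x * step_fun D f m x) ^+ 2 <=
  2 * ((step_fun D f n x - f x) ^+ 2 + (step_fun D f m x - f x) ^+ 2 +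
       f x ^+ 2 * \1_(sym_diff B B') x).
Proof.
move=> Dx; move: (step_fun D f n x) (step_fun D f m x) (f x) => u v y.
have := sqr_ge0 (u - y); have := sqr_ge0 (v - y); have := sqr_ge0 y.
have := sqr_ge0 (u - y - y); have := sqr_ge0 (v - y - y); have := sqr_ge0 ((u - y) + (v - y)).
rewrite !indicE.
have [xB|xB] := pselect (B x); have [xB'|xB'] := pselect (B' x).
- rewrite (mem_set xB) (mem_set xB') (_ : x \in sym_diff B B' = false) /=; last first.
    by apply/negbTE/negP; rewrite inE => -[[]|[]].
  by rewrite !expr2; nra.
- rewrite (mem_set xB) (memNset xB') (_ : x \in sym_diff B B' = true) /=; last first.
    by apply/mem_set; left.
  by rewrite !expr2; nra.
- rewrite (memNset xB) (mem_set xB') (_ : x \in sym_diff B B' = true) /=; last first.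
    by apply/mem_set; right.
  by rewrite !expr2; nra.
- rewrite (memNset xB) (memNset xB') (_ : x \in sym_diff B B' = false) /=; last first.
    by apply/negbTE/negP; rewrite inE => -[[]|[]].
  by rewrite !expr2; nra.
Qed.

Let measurable_sym_diff B B' : measurable B -> measurable B' -> measurable (sym_diff B B').
Proof. by move=> mB mB'; apply: measurableU; exact: measurableD. Qed.

Let measurable_sqr_indic S : measurable S -> measurable_fun D (fun x => f x ^+ 2 * \1_S x).
Proof.
by move=> mS; apply: measurable_funM => //; exact/measurable_funTS/measurable_indic.
Qed.

Let step_tail e eta : 0 < e -> 0 < eta -> exists2 K, 0 < K & forall n m B B',
  bounded_borel B -> bounded_borel B' -> B `<=` D -> B' `<=` D ->
  (P [set w | (e <= enorm (step_integral n B w - step_integral m B' w))%R] <=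
   (eta * L)%:E + K%:E * (sqr_err n + sqr_err m + sqr_mass (sym_diff B B')))%E.
Proof.
move=> e0 eta0; have [K K0 HK] := elementary_tail HX e0 eta0.
exists (2 * K) => [|n m B B' bB bB' BD BD']; first by rewrite mulr_gt0.
have [mB _] := bB; have [mB' _] := bB'.
have bW := bounded_borelU bB bB'.
have mC i : measurable (@comb_set n m B B' i).
  by case: i => j; apply: measurableI => //; exact: measurable_step_set.
have CW i : @comb_set n m B B' i `<=` B `|` B'.
  by case: i => j x [xB _]; [left|right].
have := HK _ _ _ (@comb_coef n m) bW mC CW.
under eq_fun do rewrite -WB.
move=> h; apply: (le_trans h).
have WD : B `|` B' `<=` D by move=> x [/BD|/BD'].
pose g1 x := eta * \1_[set t | f t != 0] x.
pose g2 x := (step_fun D f n x - f x) ^+ 2 + (step_fun D f m x - f x) ^+ 2.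
pose g3 x := f x ^+ 2 * \1_(sym_diff B B') x.
have mg1 : measurable_fun D (fun x => (g1 x)%:E).
  by apply/measurable_EFinP; apply: measurable_funM => //; exact: measurable_cst.
have mg2 : measurable_fun D (fun x => (g2 x)%:E).
  by apply/measurable_EFinP; apply: measurable_funD.
have mg3 : measurable_fun D (fun x => (g3 x)%:E).
  by apply/measurable_EFinP; apply: measurable_sqr_indic; exact: measurable_sym_diff.
have g20 x : 0 <= g2 x by rewrite addr_ge0// sqr_ge0.
have g30 x : 0 <= g3 x by rewrite mulr_ge0// sqr_ge0.
have g10 x : 0 <= g1 x by rewrite mulr_ge0// ltW.
have m23 : measurable_fun D (fun x => ((2 * K)%:E * ((g2 x)%:E + (g3 x)%:E))%E).
  by apply: measurable_funeM; exact: emeasurable_funD.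
have -> : ((eta * L)%:E + (2 * K)%:E * (sqr_err n + sqr_err m + sqr_mass (sym_diff B B')) =
  \int[lam]_(x in D) ((g1 x)%:E + (2 * K)%:E * ((g2 x)%:E + (g3 x)%:E)))%E.
  have K20 : 0 <= 2 * K by rewrite mulr_ge0// ltW.
  rewrite ge0_integralD; [|exact: mD|by move=> x _; rewrite lee_fin|exact: mg1
    |by move=> x _; rewrite mule_ge0// lee_fin// addr_ge0|exact: m23].
  congr (_ + _)%E.
    under eq_integral do rewrite /g1 EFinM.
    rewrite ge0_integralZl; [by rewrite LE EFinM|exact: mD|exact/measurable_EFinP
      |by move=> x _; rewrite lee_fin|by rewrite lee_fin ltW].
  rewrite ge0_integralZl; [|exact: mD|exact: emeasurable_funD
    |by move=> x _; rewrite lee_fin addr_ge0|by rewrite lee_fin].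
  congr (_ * _)%E.
  rewrite ge0_integralD; [|exact: mD|by move=> x _; rewrite lee_fin|exact: mg2
    |by move=> x _; rewrite lee_fin|exact: mg3].
  congr (_ + _)%E; rewrite /sqr_err /g2.
  under [RHS]eq_integral do rewrite EFinD.
  by rewrite ge0_integralD; [|exact: mD|by move=> x _; rewrite lee_fin sqr_ge0
    |by apply/measurable_EFinP; exact: mdiff|by move=> x _; rewrite lee_fin sqr_ge0
    |by apply/measurable_EFinP; exact: mdiff].
apply: (@le_trans _ _ (\int[lam]_(x in B `|` B') ((g1 x)%:E + (2 * K)%:E * ((g2 x)%:E + (g3 x)%:E)))%E); last first.
  apply: ge0_subset_integral; [by case: bW|exact: mD|exact: emeasurable_funD| |exact: WD].
  - move=> x _; apply: adde_ge0; first by rewrite lee_fin.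
    apply: mule_ge0; first by rewrite lee_fin mulr_ge0// ltW.
    by rewrite lee_fin addr_ge0.
apply: ge0_le_integral.
- by case: bW.
- by move=> x _; rewrite lee_fin addr_ge0// mulr_ge0 ?sqr_ge0// ltW.
- apply/measurable_EFinP; apply: measurable_funTS.
  have mg : measurable_fun setT (comb_fun (@comb_set n m B B') (@comb_coef n m)).
    by apply: measurable_sum => i; apply: measurable_funM => //; exact: measurable_indic.
  apply: measurable_funD; apply: measurable_funM; try exact: measurable_cst.
    rewrite (_ : (fun x => _) = \1_(~` (comb_fun (@comb_set n m B B') (@comb_coef n m) @^-1` [set 0]))).
      apply: measurable_indic; apply: measurableC; rewrite -[X in measurable X]setTI.
      exact: mg.
    apply/funext => y; rewrite indicE; case: (eqVneq (comb_fun _ _ y) 0) => gx.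
      by rewrite memNset//= => /(_ gx).
    by rewrite mem_set//=; exact/eqP.
  by under eq_fun do rewrite expr2; exact: measurable_funM.
- apply: (measurable_funS mD WD); exact: emeasurable_funD.
move=> x /WD Dx; rewrite -[leRHS]/((g1 x + 2 * K * (g2 x + g3 x))%:E).
rewrite lee_fin comb_funE; apply: lerD.
  rewrite ler_pM2l//; have [fx|fx] := eqVneq (f x) 0.
    by rewrite (step_fun0 D n fx) (step_fun0 D m fx) !mulr0 subrr eqxx.
  have -> : \1_[set t | f t != 0] x = 1 :> R by rewrite indicE mem_set.
  by case: (_ != 0).
rewrite mulrAC [_ * K]mulrC ler_pM2l//.
by have := pointwise n m B B' Dx; rewrite mulrC.
Qed.

(** Cauchy estimate for the integrals of the discretisations: small errors in
    the integrand and in the domain give close integrals. *)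
Let step_close e : 0 < e -> exists2 dl, 0 < dl & exists N, forall n m B B',
  (N <= n)%N -> (N <= m)%N ->
  bounded_borel B -> bounded_borel B' -> B `<=` D -> B' `<=` D ->
  (sqr_mass (sym_diff B B') <= dl%:E)%E ->
  (P [set w | (e <= enorm (step_integral n B w - step_integral m B' w))%R] <= e%:E)%E.
Proof.
move=> e0.
have L0 : 0 <= L by apply: fine_ge0; apply: integral_ge0 => s _; rewrite lee_fin.
have L1 : 0 < L + 1 by rewrite ltr_wpDl.
have eta0 : 0 < e / (2 * (L + 1)) by rewrite divr_gt0// mulr_gt0.
have [K K0 HK] := step_tail e0 eta0.
have dl0 : 0 < e / (6 * K) by rewrite divr_gt0// mulr_gt0.
have [N HN] := sqr_err_small dl0.
exists (e / (6 * K)) => //; exists N => n m B B' Nn Nm bB bB' BD BD' ht.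
apply: (le_trans (HK n m B B' bB bB' BD BD')).
apply: (@le_trans _ _ ((e / 2)%:E + K%:E * ((e / (6 * K))%:E + (e / (6 * K))%:E + (e / (6 * K))%:E))%E).
  apply: leeD.
    rewrite lee_fin (_ : _ * L = e / 2 * (L / (L + 1))); last first.
      by field; rewrite lt0r_neq0.
    by rewrite ler_piMr ?divr_ge0 ?(ltW e0)// ler_pdivrMr// mul1r lerDl.
  rewrite lee_pmul2l// leeD//; apply: leeD; exact: HN.
rewrite -[leLHS]/((e / 2 + K * (e / (6 * K) + e / (6 * K) + e / (6 * K)))%:E).
rewrite lee_fin le_eqVlt; apply/orP; left; apply/eqP.
by field; rewrite lt0r_neq0.
Qed.

Let mW n B : measurable_fun setT (step_integral n B).
Proof.
exact: (@measurable_rm_comb _ _ X _ (fun j => B `&` step_set D f n j) (step_coef R)).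
Qed.

Let sqr_mass0 B : sqr_mass (sym_diff B B) = 0%E.
Proof.
rewrite /sqr_mass integral0_eq// => x _; rewrite indicE memNset ?mulr0//.
by move=> [[]|[]].
Qed.

Let J_ex B : exists J : {RV P >-> 'rV[R]_d}, inner_borel a b B ->
  forall e, 0 < e -> exists N, forall n, (N <= n)%N ->
    (P [set w | (e <= enorm (step_integral n B w - J w))%R] <= e%:E)%E.
Proof.
have [iB|niB] := pselect (inner_borel a b B); last by exists (X B).
have bB := inner_borel_bounded iB; have [_ BD _ _] := iB.
have [|e e0|Z mZ HZ] := @L0_complete_rV _ _ _ P _ (fun n => step_integral n B); first by move=> n; exact: mW.
  have [dl dl0 [N HN]] := step_close e0; exists N => n m Nn Nm; apply: HN => //.
  by rewrite sqr_mass0 lee_fin ltW.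
by have [h hZ] := mfun_exists mZ; exists h => _ e e0; rewrite hZ; exact: HZ.
Qed.

Lemma cvg_in_prob_nat (V : nat -> rm_space X -> 'rV[R]_d) (Z : rm_space X -> 'rV[R]_d) :
  (forall n, measurable_fun setT (V n)) -> measurable_fun setT Z ->
  (forall e, 0 < e -> exists N, forall n, (N <= n)%N ->
     (P [set w | (e <= enorm (V n w - Z w))%R] <= e%:E)%E) ->
  cvg_in_prob \oo V Z.
Proof.
move=> mV mZ H e e0 U /ereal_nbhs0_sub[dl dl0 hU].
have m0 : 0 < Num.min e dl by rewrite lt_min e0.
have [N HN] := H _ m0; exists N => // n /= Nn; apply: hU => //.
apply: (@le_trans _ _ (Num.min e dl)%:E); last by rewrite lee_fin ge_min lexx orbT.
apply: le_trans (HN n Nn); apply: prob_le; [exact: measurable_enorm_ge..|].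
by move=> w /=; apply: le_trans; rewrite ge_min lexx.
Qed.

(** The discretisations approximate [f] in mean square and vanish where [f] does,
    so their integrals over a fixed set form a Cauchy sequence in probability. *)
Lemma integral_exists : exists J : set R -> {RV P >-> 'rV[R]_d},
  @is_integral R d a b X f J /\
  forall B, inner_borel a b B -> forall e, 0 < e -> exists N, forall n, (N <= n)%N ->
    (P [set w | (e <= enorm (step_integral n B w - J B w))%R] <= e%:E)%E.
Proof.
have /choice[J HJ] := J_ex; exists J; split => //.
exists step_sf; split; first by apply: aeW => s Ds; exact: step_fun_cvg.
move=> B iB; apply: cvg_in_prob_nat => //.
- by move=> n; exact: mW.
- exact: HJ.
Qed.

Theorem sufficient_locally_integrable : Defs.locally_integrable a b X f.
Proof. by have [J [hJ _]] := integral_exists; exists J. Qed.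

Let sqr_mass_mono S S' : measurable S -> measurable S' -> S `<=` S' -> (sqr_mass S <= sqr_mass S')%E.
Proof.
move=> mS mS' SS'; apply: ge0_le_integral => //.
- by move=> x _; rewrite lee_fin mulr_ge0// sqr_ge0.
- by apply/measurable_EFinP; exact: measurable_sqr_indic.
- by apply/measurable_EFinP; exact: measurable_sqr_indic.
move=> x _; rewrite lee_fin ler_wpM2l ?sqr_ge0// !indicE ler_nat.
have [xS|xS] := pselect (S x); first by rewrite (mem_set xS) (mem_set (SS' x xS)).
by rewrite (memNset xS).
Qed.

Let int_f2 : lam.-integrable D (fun x => (f x ^+ 2)%:E).
Proof.
apply/integrableP; split; first exact/measurable_EFinP.
by under eq_integral do rewrite gee0_abs ?lee_fin ?sqr_ge0//.
Qed.

Let sqr_mass_small (p p' : nat -> R) :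
  (forall x, D x -> exists N, forall n, (N <= n)%N -> p n < x <= p' n) ->
  forall e, 0 < e -> exists N, forall n, (N <= n)%N ->
    (sqr_mass (~` `]p n, p' n]%classic) <= e%:E)%E.
Proof.
move=> ex e e0.
have mS n : measurable (~` `]p n, p' n]%classic : set R) by exact: measurableC.
have [] := @dominated_convergence _ _ _ lam D mD
  (fun n x => (f x ^+ 2 * \1_(~` `]p n, p' n]%classic) x)%:E) (fun=> 0%E) _ _ _ _ int_f2.
- by move=> n; apply/measurable_EFinP; exact: measurable_sqr_indic.
- exact: measurable_cst.
- apply: aeW => x Dx; apply: cvg_near_cst; have [N HN] := ex x Dx.
  exists N => // n /= Nn; rewrite indicE memNset ?mulr0//= in_itv/=.
  by move=> h; apply: h; exact: HN.
- apply: aeW => x n Dx; rewrite gee0_abs ?lee_fin; last by rewrite mulr_ge0// sqr_ge0.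
  by rewrite indicE ler_piMr ?sqr_ge0// lern1 leq_b1.
move=> _ _; rewrite integral0 => h.
by have [N _ hN] := h _ (ereal_nbhs0_le e0); exists N.
Qed.

(** Near the ends of the interval little square mass of [f] is left, so integrals
    over large intervals are close in probability; the centring is zero. *)
Theorem sufficient_essentially_integrable : (a < b)%E ->
  essentially_integrable a b X f.
Proof.
move=> ab; have [J [hJ HJ]] := integral_exists; exists J; split => //.
have [p [qq [pq pmono qmono ex]]] := exhaust_oitv ab.
pose B n : set R := `]p n, qq n]%classic.
have iB n : inner_borel a b (B n) by have [? ? _] := pq n; exact: inner_borel_itv.
have bB n := inner_borel_bounded (iB n).
have BD n : B n `<=` D by case: (iB n).
have tls := sqr_mass_small ex.
have mB n : measurable (B n) by case: (iB n).
have Bmono n m : (n <= m)%N -> B n `<=` B m.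
  move=> nm x; rewrite /B/= !in_itv/= => /andP[px xq]; apply/andP; split.
    by apply: le_lt_trans px; exact: pmono.
  by apply: (le_trans xq); exact: qmono.
have sym_diff_sub N A A' : B N `<=` A -> B N `<=` A' -> sym_diff A A' `<=` ~` B N.
  by move=> NA NA' x [[_ nx]|[_ nx]] Bx; apply: nx; [exact: NA'|exact: NA].
have [|e e0|Z mZ HZ] := @L0_complete_rV _ _ _ P _ (fun n => step_integral n (B n)).
- by move=> n; exact: mW.
- have [dl dl0 [N1 HN1]] := step_close e0; have [N2 HN2] := tls dl dl0.
  exists (maxn N1 N2) => n m; rewrite !geq_max => /andP[n1 n2] /andP[m1 m2].
  apply: HN1 => //; apply: le_trans (HN2 N2 (leqnn _)); apply: sqr_mass_mono.
  + exact: measurable_sym_diff.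
  + exact: measurableC.
  + by apply: sym_diff_sub; exact: Bmono.
have [h hZ] := mfun_exists mZ.
exists (fun _ _ => 0), h; rewrite hZ => e e0 U /ereal_nbhs0_sub[r r0 hU].
(* Three comparisons are chained, each costing a factor of [enormD]. *)
pose k := (d%:R + 1 : R); have k1 : 1 <= k by rewrite lerDr.
have k0 : 0 < k by apply: lt_le_trans k1.
pose e1 := Num.min (e / (4 * k ^+ 2)) (r / 3).
have e10 : 0 < e1 by rewrite lt_min !divr_gt0// mulr_gt0// exprn_gt0.
have [dl dl0 [N1 HN1]] := step_close e10; have [N2 HN2] := tls dl dl0.
have [N3 HN3] := HZ e1 e10.
have [pD qD plq] := pq N2.
exists (p N2), (qq N2); split => // x y Dx Dy xp qy; apply: hU => //=.
pose A : set R := `]x, y]%classic.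
have iA : inner_borel a b A by exact: inner_borel_itv.
have bA := inner_borel_bounded iA; have AD : A `<=` D by case: iA.
have mA : measurable A by case: iA.
have BA : B N2 `<=` A.
  move=> u; rewrite /A /B/= !in_itv/= => /andP[h1 h2]; apply/andP; split; first exact: lt_trans h1.
  by apply: (le_trans h2); exact: ltW.
have [N4 HN4] := HJ A iA e1 e10.
pose n := maxn (maxn N1 N2) (maxn N3 N4).
have nN1 : (N1 <= n)%N by rewrite /n !leq_max leqnn.
have nN2 : (N2 <= n)%N by rewrite /n !leq_max leqnn orbT.
have nN3 : (N3 <= n)%N by rewrite /n !leq_max leqnn !orbT.
have nN4 : (N4 <= n)%N by rewrite /n !leq_max leqnn !orbT.
have P1 := HN4 n nN4; have P3 := HN3 n nN3.
have P2 : (P [set w | (e1 <= enorm (step_integral n A w - step_integral n (B n) w))%R] <= e1%:E)%E.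
  apply: HN1 => //; apply: le_trans (HN2 N2 (leqnn _)); apply: sqr_mass_mono.
  + exact: measurable_sym_diff.
  + exact: measurableC.
  + by apply: sym_diff_sub => //; exact: Bmono.
have m1 : measurable [set w | e1 <= enorm (step_integral n A w - J A w)].
  by apply: measurable_enorm_ge => //; exact: mW.
have m2 : measurable [set w | e1 <= enorm (step_integral n A w - step_integral n (B n) w)].
  by apply: measurable_enorm_ge; exact: mW.
have m3 : measurable [set w | e1 <= enorm (step_integral n (B n) w - Z w)].
  by apply: measurable_enorm_ge => //; exact: mW.
apply: (@le_trans _ _ (e1%:E + (e1%:E + e1%:E))%E); last first.
  rewrite -!EFinD lee_fin; have : e1 <= r / 3 by rewrite ge_min lexx orbT.
  lra.
apply: (@prob_subU _ _ _ _ _ _ ([set w | e1 <= enorm (step_integral n A w - step_integral n (B n) w)] `|`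
   [set w | e1 <= enorm (step_integral n (B n) w - Z w)]) _ _ _ m1) => //.
- apply: measurable_enorm_ge => //.
  by under eq_fun do rewrite subr0; exact: measurable_funPT.
- exact: measurableU.
- move=> w /=; rewrite subr0 => ew; apply: contrapT => /not_orP[/negP h1 /not_orP[/negP h2 /negP h3]].
  rewrite -!ltNge in h1 h2 h3.
  have h4 : enorm (J A w - step_integral n A w) = enorm (step_integral n A w - J A w).
    by rewrite /enorm /dot; congr Num.sqrt; apply: eq_bigr => i _; rewrite !mxE; ring.
  have := enormD (J A w - step_integral n A w) (step_integral n A w - Z w); rewrite addrA subrK h4 => h5.
  have := enormD (step_integral n A w - step_integral n (B n) w) (step_integral n (B n) w - Z w); rewrite addrA subrK => h6.
  have e1e : e1 <= e / (4 * k ^+ 2) by rewrite ge_min lexx.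
  have h7 : e1 * (4 * k ^+ 2) <= e by rewrite -ler_pdivlMr// mulr_gt0// exprn_gt0.
  have h8 : k * (enorm (step_integral n A w - J A w) + enorm (step_integral n A w - Z w)) < e.
    apply: lt_le_trans h7; rewrite -/k in h6.
    apply: (@le_lt_trans _ _ (k * (enorm (step_integral n A w - J A w) + k * (e1 + e1)))).
      rewrite ler_pM2l// lerD2l; apply: (le_trans h6); rewrite ler_pM2l//.
      by apply: lerD; exact: ltW.
    rewrite (_ : e1 * _ = k * (4 * k * e1)); last by ring.
    by rewrite ltr_pM2l//; nra.
  by have := le_lt_trans (le_trans ew h5) h8; rewrite ltxx.
- by apply: (@prob_subU _ _ _ _ _ _ _ _ _ _ m2 m3) => //; exact: measurableU.
Qed.

End sufficient.

(** * Integrability of the cumulant *)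

Section cumulant_integrable.
Variables (R : realType) (d : nat) (mu : probability 'rV[R]_d R).

Lemma cmod_le (w : R[i]) : cmod w <= `|Re w| + `|Im w|.
Proof.
case: w => x y; rewrite /cmod/=; have s0 : 0 <= `|x| + `|y| by rewrite addr_ge0.
rewrite -[leRHS](ger0_norm s0) -sqrtr_sqr ler_wsqrtr//.
rewrite sqrrD !real_normK ?num_real// [leRHS]addrAC lerDl mulrn_wge0//.
Qed.

Lemma cmod0 : cmod (0 : R[i]) = 0.
Proof. by rewrite /cmod/= expr0n addr0 sqrtr0. Qed.

Lemma cumulantP : (exists C, is_cumulant mu C) -> is_cumulant mu (cumulant mu).
Proof. by move=> [C hC]; apply: xgetPex; exists C. Qed.

(** Along each ray both functions are continuous logarithms of the same
    characteristic function. *)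
Lemma cumulantE (C : 'rV[R]_d -> R[i]) : is_cumulant mu C -> cumulant mu = C.
Proof.
move=> hC; have [[c1 c2] c0 cE] := hC.
have [[u1 u2] u0 uE] := cumulantP (ex_intro _ _ hC).
apply/funext => z.
have cs : continuous (fun s : R => s *: z) by exact: scalel_continuous.
rewrite -(scale1r z).
apply: (@continuous_log_unique _ (fun s => cumulant mu (s *: z)) (fun s => C (s *: z))).
- by move=> s; apply: (@continuous_comp _ _ _ (fun s : R => s *: z) (fun x => Re (cumulant mu x))); [exact: cs|exact: u1].
- by move=> s; apply: (@continuous_comp _ _ _ (fun s : R => s *: z) (fun x => Im (cumulant mu x))); [exact: cs|exact: u2].
- by move=> s; apply: (@continuous_comp _ _ _ (fun s : R => s *: z) (fun x => Re (C x))); [exact: cs|exact: c1].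
- by move=> s; apply: (@continuous_comp _ _ _ (fun s : R => s *: z) (fun x => Im (C x))); [exact: cs|exact: c2].
- by rewrite scale0r.
- by rewrite scale0r.
- by move=> s; rewrite -uE -cE.
Qed.

Variables (X : set_indexed_rvs R d) (HX : is_random_measure mu X).

Lemma levy_exponent_law (z : 'rV[R]_d) (c : R -> R[i]) :
  (forall B s, bounded_borel B ->
     rm_cfun X z B s = cexp ((fine (lam B))%:C * c s)) ->
  forall s, cexp (c s) = charfun mu (s *: z).
Proof.
move=> cE s; rewrite -(rm_cfun_unit HX z 0 s) add0r cE; last exact: bounded_borel_itv.
by rewrite lebesgue_measure_itv/= lte_fin ltr01 sube0/= mul1r.
Qed.

Lemma cumulant_ray (C : 'rV[R]_d -> R[i]) (z : 'rV[R]_d) (c : R -> R[i]) :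
  is_cumulant mu C ->
  continuous (fun s => Re (c s)) -> continuous (fun s => Im (c s)) -> c 0 = 0 ->
  (forall B s, bounded_borel B ->
     rm_cfun X z B s = cexp ((fine (lam B))%:C * c s)) ->
  forall s, C (s *: z) = c s.
Proof.
move=> [[u1 u2] u0 uE] c1 c2 c0 cE.
have cs : continuous (fun s : R => s *: z) by exact: scalel_continuous.
apply: (@continuous_log_unique _ (fun s => C (s *: z))) => //.
- by move=> s; apply: (@continuous_comp _ _ _ (fun s : R => s *: z) (fun x => Re (C x))); [exact: cs|exact: u1].
- by move=> s; apply: (@continuous_comp _ _ _ (fun s : R => s *: z) (fun x => Im (C x))); [exact: cs|exact: u2].
- by rewrite scale0r.
- by move=> s; rewrite -uE (levy_exponent_law cE).
Qed.

Variables (a b : \bar R) (f : R -> R).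
Local Notation D := (oitv a b).
Hypothesis mf : measurable_fun D f.
Hypothesis supp_fin : (\int[lam]_(s in D) (\1_[set t | f t != 0] s)%:E < +oo)%E.
Hypothesis sqr_fin : (\int[lam]_(s in D) ((f s) ^+ 2)%:E < +oo)%E.

(** The exponent vanishes at zero and is at most [1 + K s^2], so the integrand is
    at most the indicator of the support of [f] plus [K f^2]. *)
Lemma cumulant_integrable (z : 'rV[R]_d) :
  (\int[lam]_(s in D) (cmod (cumulant mu (f s *: z)))%:E < +oo)%E.
Proof.
have mD := measurable_oitv a b.
(* Without a continuous logarithm the cumulant takes its default value zero. *)
have [hC|nC] := pselect (exists C, is_cumulant mu C); last first.
  have -> : cumulant mu = fun=> 0.
    by apply: xgetPN => C hC; apply: nC; exists C.
  by rewrite integral0_eq ?ltry// => s _; rewrite cmod0.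
have [c [c1 c2 c0 cE]] := levy_exponent HX z.
have CE := cumulant_ray (cumulantP hC) c1 c2 c0 cE.
have dbl s := exponent_doubling cE s.
have cR : continuous (fun s => - Re (c s)) by move=> s; apply: continuousN; exact: c1.
have [|||||K K0 HK] := quadratic_growth (cR 0) (c2 0) _ _ _ _ _ ltr01.
- by rewrite c0 oppr0.
- by rewrite c0.
- by move=> s; case: (dbl s).
- by move=> s; case: (dbl s).
- by move=> s; case: (dbl s).
have mfs : measurable_fun D (fun s => \1_[set t | f t != 0] s : R) by exact: measurable_supp.
have mf2 : measurable_fun D (fun s => f s ^+ 2).
  by under eq_fun do rewrite expr2; exact: measurable_funM.
apply: (@le_lt_trans _ _ (\int[lam]_(s in D)
    ((\1_[set t | f t != 0] s)%:E + K%:E * (f s ^+ 2)%:E))%E).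
  apply: ge0_le_integral => //.
  - by move=> s _; rewrite lee_fin /cmod; case: (cumulant _ _) => x y; exact: sqrtr_ge0.
  - apply/measurable_EFinP; under eq_fun do rewrite CE.
    have m1 := measurableT_comp (continuous_measurable_fun c1) mf.
    have m2 := measurableT_comp (continuous_measurable_fun c2) mf.
    rewrite (_ : (fun s => _) = (fun s => Num.sqrt (Re (c (f s)) ^+ 2 + Im (c (f s)) ^+ 2))).
      apply: (measurableT_comp (continuous_measurable_fun (@sqrt_continuous R))).
      by apply: measurable_funD; under eq_fun do rewrite expr2; exact: measurable_funM.
    by apply/funext => s; rewrite /cmod; case: (c (f s)).
  - apply: emeasurable_funD; first exact/measurable_EFinP.
    by apply: measurable_funeM; exact/measurable_EFinP.
  move=> s Ds; rewrite CE -EFinM -EFinD lee_fin.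
  have [fs|fs] := eqVneq (f s) 0.
    by rewrite fs c0 cmod0 indicE memNset/= ?fs ?eqxx// expr0n/= mulr0 addr0.
  rewrite indicE mem_set//=; apply: (le_trans (cmod_le _)).
  have := HK (f s); have [h _ _] := dbl (f s).
  by rewrite -(normrN (Re (c (f s)))) (ger0_norm h).
rewrite ge0_integralD//.
- rewrite ge0_integralZl//.
  + by rewrite lte_add_pinfty// lte_mul_pinfty// lee_fin ltW.
  + exact/measurable_EFinP.
  + by move=> s _; rewrite lee_fin sqr_ge0.
  + by rewrite lee_fin ltW.
- exact/measurable_EFinP.
- by move=> s _; rewrite mule_ge0// lee_fin ?sqr_ge0// ltW.
- by apply: measurable_funeM; exact/measurable_EFinP.
Qed.

End cumulant_integrable.

(** * Uniqueness of characteristic functions on the line *)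

(** The map [x -> (3 x - x^3) / 2] pushes every point of [[-1, 1]] to its sign,
    so that the sign of a trigonometric polynomial is a bounded pointwise limit
    of trigonometric polynomials. *)
Section sign_iteration.
Variable R : realType.

Definition sgstep (x : R) : R := (3 * x - x ^+ 3) / 2.

Lemma sgstepN x : sgstep (- x) = - sgstep x.
Proof. by rewrite /sgstep; field. Qed.

Lemma sgstep_itv x : 0 <= x <= 1 -> x <= sgstep x <= 1.
Proof.
move=> /andP[x0 x1]; rewrite /sgstep; apply/andP; split; rewrite -subr_ge0.
  rewrite (_ : _ - x = x * (1 - x) * (1 + x) / 2); last by field.
  by rewrite divr_ge0// !mulr_ge0//; lra.
rewrite (_ : 1 - _ = (1 - x) ^+ 2 * (2 + x) / 2); last by field.
by rewrite divr_ge0// mulr_ge0// ?sqr_ge0//; lra.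
Qed.

Lemma iter_sgstepN n x : iter n sgstep (- x) = - iter n sgstep x.
Proof. by elim: n => //= n ->; rewrite sgstepN. Qed.

Lemma iter_sgstep_bound n x : `|x| <= 1 -> `|iter n sgstep x| <= 1.
Proof.
wlog x0 : x / 0 <= x => [H|].
  case: (leP 0 x) => [x0|x0]; first exact: H.
  rewrite -normrN => h; rewrite -(opprK x) iter_sgstepN normrN; apply: H => //.
  by rewrite oppr_ge0 ltW.
rewrite ger0_norm// => x1; have : 0 <= iter n sgstep x <= 1.
  elim: n => /= [|n /andP[h1 h2]]; first by rewrite x0.
  have /andP[h3 h4] : iter n sgstep x <= sgstep (iter n sgstep x) <= 1.
    by apply: sgstep_itv; rewrite h1.
  by rewrite h4 (le_trans h1 h3).
by move=> /andP[h1 h2]; rewrite ger0_norm.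
Qed.

Lemma iter_sgstep_cvg x : `|x| <= 1 -> (fun n => iter n sgstep x) @ \oo --> Num.sg x.
Proof.
wlog x0 : x / 0 <= x => [H|].
  case: (leP 0 x) => [x0|x0]; first exact: H.
  rewrite -normrN => h; rewrite -(opprK x) sgrN.
  under eq_fun do rewrite iter_sgstepN.
  by apply: cvgN; apply: H => //; rewrite oppr_ge0 ltW.
rewrite ger0_norm// => x1.
have [->|xn0] := eqVneq x 0.
  rewrite sgr0 (_ : (fun n => _) = (fun=> 0)); first exact: cvg_cst.
  by apply/funext; elim=> //= n ->; rewrite /sgstep expr0n/= mulr0 subr0 mul0r.
have xp : 0 < x by rewrite lt_neqAle eq_sym xn0.
rewrite gtr0_sg//.
have key n : [/\ x <= iter n sgstep x, iter n sgstep x <= 1 &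
    1 - iter n sgstep x <= (1 - x / 2) ^+ n].
  elim: n => /= [|n [h1 h2 h3]]; first by rewrite expr0; split => //; lra.
  have /andP[h4 h5] : iter n sgstep x <= sgstep (iter n sgstep x) <= 1.
    by apply: sgstep_itv; rewrite h2 (le_trans x0 h1).
  split => //; first exact: le_trans h4.
  rewrite exprS; apply: (@le_trans _ _ ((1 - x / 2) * (1 - iter n sgstep x))); last first.
    by rewrite ler_wpM2l//; lra.
  move: h1 h2; move: (iter n sgstep x) => y xy y1.
  rewrite (_ : 1 - sgstep y = (1 - (y + y ^+ 2) / 2) * (1 - y)); last first.
    by rewrite /sgstep; field.
  by rewrite ler_wpM2r ?subr_ge0//; have := sqr_ge0 y; lra.
have h : (fun n => (1 - x / 2) ^+ n) @ \oo --> 0.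
  by apply: cvg_expr; rewrite ger0_norm; lra.
apply/cvgrPdist_le => e e0; move/cvgrPdist_le : h => /(_ e e0)[N _ hN].
exists N => // n /hN /=; rewrite sub0r normrN => h; have [h1 h2 h3] := key n.
by rewrite ger0_norm ?subr_ge0// (le_trans h3)// (le_trans (ler_norm _) h).
Qed.

End sign_iteration.

Section trigonometric_polynomials.
Variable R : realType.

Inductive trigpoly : (R -> R) -> Prop :=
| trigpoly_cos c t th : trigpoly (fun y => c * cos (t * y + th))
| trigpolyD f g : trigpoly f -> trigpoly g -> trigpoly (fun y => f y + g y).

Lemma trigpolyM f g : trigpoly f -> trigpoly g -> trigpoly (fun y => f y * g y).
Proof.
move=> tf tg; elim: tf => [c t th|f1 f2 _ h1 _ h2]; last first.
  by under eq_fun do rewrite mulrDl; exact: trigpolyD.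
elim: tg => [c' t' th'|g1 g2 _ h1 _ h2]; last first.
  by under eq_fun do rewrite mulrDr; exact: trigpolyD.
rewrite (_ : (fun y => _) = (fun y =>
    (c * c' / 2) * cos ((t + t') * y + (th + th')) +
    (c * c' / 2) * cos ((t - t') * y + (th - th')))).
  by apply: trigpolyD; exact: trigpoly_cos.
apply/funext => y.
rewrite (_ : (t + t') * y + (th + th') = (t * y + th) + (t' * y + th')); last by ring.
rewrite (_ : (t - t') * y + (th - th') = (t * y + th) - (t' * y + th')); last by ring.
by move: (t * y + th) (t' * y + th') => p q; rewrite cosD cosB; field.
Qed.

Lemma trigpoly_cst c : trigpoly (fun=> c).
Proof.
rewrite (_ : (fun=> c) = (fun y : R => c * cos (0 * y + 0))); first exact: trigpoly_cos.
by apply/funext => y; rewrite mul0r addr0 cos0 mulr1.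
Qed.

Lemma trigpoly_sin t u : trigpoly (fun y => sin (t * (y - u))).
Proof.
rewrite (_ : (fun y => _) = (fun y => 1 * cos (t * y + (- (t * u) - pi / 2)))).
  exact: trigpoly_cos.
apply/funext => y; rewrite mul1r (_ : t * y + _ = t * (y - u) - pi / 2); last by ring.
by rewrite cosB cos_pihalf sin_pihalf mulr0 add0r mulr1.
Qed.

Lemma trigpoly_iter n f : trigpoly f -> trigpoly (fun y => iter n (@sgstep R) (f y)).
Proof.
move=> tf; elim: n => //= n IH.
rewrite (_ : (fun y => _) = (fun y => 3 / 2 * iter n (@sgstep R) (f y) +
   (- 1 / 2 * iter n (@sgstep R) (f y)) * (iter n (@sgstep R) (f y) * iter n (@sgstep R) (f y)))).
  apply: trigpolyD; first by apply: trigpolyM => //; exact: trigpoly_cst.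
  by apply: trigpolyM; apply: trigpolyM => //; exact: trigpoly_cst.
by apply/funext => y; rewrite {1}/sgstep; field.
Qed.

Lemma bmeas_trigpoly f : trigpoly f -> bmeas f.
Proof.
elim=> [c t th|f1 f2 _ h1 _ h2]; last exact: bmeasD.
apply: bmeasM; first exact: bmeas_cst.
by apply: bmeas_cos; apply: measurable_funD => //; exact: mulrl_measurable.
Qed.

Variables (m1 m2 : probability R R).
Hypothesis m12 : forall t, cfun m1 idfun t = cfun m2 idfun t.

Let bc (t : R) : bmeas (fun y : R => cos (t * y)).
Proof. by apply: bmeas_cos; exact: mulrl_measurable. Qed.

Let bs (t : R) : bmeas (fun y : R => sin (t * y)).
Proof. by apply: bmeas_sin; exact: mulrl_measurable. Qed.

Lemma eq_Rintegral_trigpoly f : trigpoly f -> \int[m1]_x f x = \int[m2]_x f x.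
Proof.
elim=> [c t th|f1 f2 t1 h1 t2 h2]; last first.
  by rewrite !RintegralD_bmeas ?h1 ?h2//; exact: bmeas_trigpoly.
have e (m : probability R R) : \int[m]_x (c * cos (t * x + th)) =
    c * cos th * Re (cfun m idfun t) - c * sin th * Im (cfun m idfun t).
  rewrite cfunE/= -!RintegralZ_bmeas// -RintegralB_bmeas.
  - by apply: eq_Rintegral => x _; rewrite cosD; ring.
  - by apply: bmeasM => //; exact: bmeas_cst.
  - by apply: bmeasM => //; exact: bmeas_cst.
by rewrite !e m12.
Qed.

Let eq_Rintegral_lim (f_ : nat -> R -> R) (f : R -> R) :
  (forall n, measurable_fun setT (f_ n)) ->
  (forall n x, `|f_ n x| <= 1) -> (forall x, f_ ^~ x @ \oo --> f x) ->
  (forall n, \int[m1]_x f_ n x = \int[m2]_x f_ n x) ->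
  measurable_fun setT f /\ \int[m1]_x f x = \int[m2]_x f x.
Proof.
move=> mf b1 ff e.
have mfl : measurable_fun setT f by apply: (measurable_fun_cvg mf) => x _; exact: ff.
split => //.
have h1 := Rintegral_bounded_cvg (P := m1) mf mfl b1 (aeW _ ff).
have h2 := Rintegral_bounded_cvg (P := m2) mf mfl b1 (aeW _ ff).
by rewrite (funext e) in h1; apply: (cvg_unique _ h1 h2); exact: norm_hausdorff.
Qed.

Let eq_sgsin (t u : R) : measurable_fun setT (fun y : R => Num.sg (sin (t * (y - u)))) /\
  \int[m1]_y Num.sg (sin (t * (y - u))) = \int[m2]_y Num.sg (sin (t * (y - u))).
Proof.
have tp n := trigpoly_iter n (trigpoly_sin t u).
apply: (eq_Rintegral_lim (f_ := fun n y => iter n (@sgstep R) (sin (t * (y - u))))).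
- by move=> n; case: (bmeas_trigpoly (tp n)).
- by move=> n x; apply: iter_sgstep_bound; exact: sin_max.
- by move=> x; apply: iter_sgstep_cvg; exact: sin_max.
- by move=> n; exact: eq_Rintegral_trigpoly.
Qed.

Let sg_le1 (x : R) : `|Num.sg x| <= 1.
Proof. by rewrite normr_sg; case: (x != 0). Qed.

(** The sign of [sin ((y - u) / n)] is that of [y - u] once [n] exceeds
    [|y - u|]. *)
Let eq_sg (u : R) : measurable_fun setT (fun y : R => Num.sg (y - u)) /\
  \int[m1]_y Num.sg (y - u) = \int[m2]_y Num.sg (y - u).
Proof.
apply: (eq_Rintegral_lim (f_ := fun n y => Num.sg (sin (n.+1%:R^-1 * (y - u))))) => //.
- by move=> n; case: (eq_sgsin n.+1%:R^-1 u).
- move=> y; apply: cvg_near_cst; exists (Num.truncn `|y - u|) => // n /= Nn.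
  have hn : `|y - u| < n.+1%:R.
    by apply: (lt_le_trans (truncnS_gt _)); rewrite ler_nat ltnS.
  have npos : 0 < n.+1%:R^-1 :> R by rewrite invr_gt0.
  have p2 : 1 < pi :> R by have := pi_ge2 R; lra.
  have hl : `|n.+1%:R^-1 * (y - u)| < pi.
    rewrite normrM gtr0_norm// mulrC ltr_pdivrMr//; apply: (lt_trans hn).
    by rewrite ltr_pMl.
  have [yu|yu|->] := ltgtP (y - u) 0; last by rewrite mulr0 sin0.
    rewrite (ltr0_sg yu); apply: ltr0_sg; rewrite -oppr_gt0 -sinN; apply: sin_gt0_pi.
    move: hl; rewrite ltr_norml => /andP[h1 h2].
    by rewrite oppr_gt0 pmulr_rlt0// yu ltrNl.
  rewrite (gtr0_sg yu); apply: gtr0_sg; apply: sin_gt0_pi.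
  by move: hl; rewrite ltr_norml => /andP[_ ->]; rewrite mulr_gt0.
- by move=> n; case: (eq_sgsin n.+1%:R^-1 u).
Qed.

(** The integrals of trigonometric polynomials are read off the characteristic
    function; bounded limits lead from these to signs of sines, to signs of
    [y - u], and to indicators of half-lines. *)
Theorem cfun_injective (A : set R) : measurable A -> m1 A = m2 A.
Proof.
have ray (u : R) : m1 `]u, +oo[%classic = m2 `]u, +oo[%classic.
  have [_] : measurable_fun setT (fun y : R => (2 * \1_(`]u, +oo[%classic) y - 1 : R)) /\
     \int[m1]_y (2 * \1_(`]u, +oo[%classic) y - 1) =
     \int[m2]_y (2 * \1_(`]u, +oo[%classic) y - 1).
    apply: (eq_Rintegral_lim (f_ := fun n y => Num.sg (y - (u + n.+1%:R^-1)))) => //.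
    - by move=> n; case: (eq_sg (u + n.+1%:R^-1)).
    - move=> y; apply: cvg_near_cst; have [yu|uy] := leP y u.
        apply: nearW => n; rewrite indicE memNset/= ?mulr0 ?sub0r; last first.
          by rewrite in_itv/= andbT; apply/negP; rewrite -leNgt.
        apply: ltr0_sg; rewrite subr_lt0; apply: (le_lt_trans yu).
        by rewrite ltrDl invr_gt0.
      have uy0 : 0 < y - u by rewrite subr_gt0.
      have [N _ hN] := near_infty_natSinv_lt (PosNum uy0).
      exists N => // n /hN /= h; rewrite indicE mem_set/= ?in_itv/= ?andbT ?uy//.
      rewrite gtr0_sg; first by ring.
      by rewrite opprD addrA subr_gt0.
    - by move=> n; case: (eq_sg (u + n.+1%:R^-1)).
  have mI : measurable (`]u, +oo[%classic : set R) by exact: measurable_itv.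
  have e (m : probability R R) : \int[m]_y (2 * \1_(`]u, +oo[%classic) y - 1) =
      2 * fine (m `]u, +oo[%classic) - 1.
    rewrite RintegralB_bmeas ?RintegralZ_bmeas ?Rintegral_prob_cst ?Rintegral_prob_indic//.
    - exact: bmeas_indic.
    - by apply: bmeasM; [exact: bmeas_cst|exact: bmeas_indic].
    - exact: bmeas_cst.
  rewrite !e => h; have {}h : fine (m1 `]u, +oo[%classic) = fine (m2 `]u, +oo[%classic) by lra.
  by rewrite -[LHS]fineK ?fin_num_measure// -[RHS]fineK ?fin_num_measure// h.
apply: (@measure_unique _ R R (@RGenOInfty.G R) (fun n => `](- n%:R), +oo[%classic) _ _ _ _ m1 m2).
- exact: RGenOInfty.measurableE.
- move=> _ _ [x ->] [y ->]; exists (Num.max x y).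
  by apply/seteqP; split => z /=; rewrite !in_itv/= !andbT gt_max;
    [case=> -> ->|case/andP=> -> ->].
- by move=> n; exists (- n%:R).
- apply/seteqP; split => // x _; exists (Num.truncn `|x|).+1 => //=.
  rewrite in_itv/= andbT; have := truncnS_gt `|x|; rewrite ltrNl => /(le_lt_trans _); apply.
  by rewrite -normrN ler_norm.
- by move=> _ [x ->]; exact: ray.
- by move=> n; rewrite (le_lt_trans (probability_le1 _ _)) ?ltry.
Qed.

End trigonometric_polynomials.

(** * Compound Poisson laws *)

Section laws_of_functions.
Variable R : realType.

Lemma law_exists d1 d2 (T1 : measurableType d1) (T2 : measurableType d2)
    (P : probability T1 R) (Y : T1 -> T2) : measurable_fun setT Y ->
  exists m : probability T2 R, forall A, m A = P (Y @^-1` A).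
Proof.
move=> mY; have [h hY] := mfun_exists mY.
by exists (distribution P h) => A; rewrite -hY.
Qed.

Lemma cintegral_law d1 d2 (T1 : measurableType d1) (T2 : measurableType d2)
    (P : probability T1 R) (Y : T1 -> T2) (m : probability T2 R) (g : T2 -> R[i]) :
  measurable_fun setT Y -> (forall A, measurable A -> m A = P (Y @^-1` A)) ->
  cbmeas g -> cintegral m g = cintegral P (fun w => g (Y w)).
Proof.
move=> mY mP bg; have [h hY] := mfun_exists mY.
have -> : cintegral m g = cintegral (distribution P h) g.
  by apply: eq_cintegral_law => A mA; rewrite mP// -hY.
by rewrite cintegral_distribution// hY.
Qed.

Lemma cfun_law d1 (T1 : measurableType d1) (P : probability T1 R) (Y : T1 -> R)
    (m : probability R R) s :
  measurable_fun setT Y -> (forall A, measurable A -> m A = P (Y @^-1` A)) ->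
  cfun m idfun s = cfun P Y s.
Proof.
move=> mY mP; rewrite /cfun (cintegral_law mY mP)//.
by apply: cbmeas_cis; exact: mulrl_measurable.
Qed.

(** The law of the sum of two coordinates under the product measure. *)
Lemma convolution_exists (m1 m2 : probability R R) : exists m : probability R R,
  (forall A, measurable A -> m A = (\int[m1]_x m2 [set y : R | A ((x : R) + y)%R])%E) /\
  forall s, cfun m idfun s = cfun m1 idfun s * cfun m2 idfun s.
Proof.
pose Q : probability (R * R)%type R := (m1 \x m2)%E.
have mf : measurable_fun setT (fst : R * R -> R) by exact: measurable_fst.
have ms : measurable_fun setT (snd : R * R -> R) by exact: measurable_snd.
have mD : measurable_fun setT (fun xy : R * R => xy.1 + xy.2) by exact: measurable_funD.
have [m hm] := law_exists Q mD.
have Qf A : measurable A -> m1 A = Q (fst @^-1` A).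
  move=> mA; rewrite (_ : fst @^-1` A = A `*` setT); last first.
    by apply/seteqP; split => -[x y] //= [].
  rewrite /Q/= product_measure1E// -[LHS]mule1; congr (_ * _)%E.
  by rewrite -(probability_setT m2).
have Qs A : measurable A -> m2 A = Q (snd @^-1` A).
  move=> mA; rewrite (_ : snd @^-1` A = setT `*` A); last first.
    by apply/seteqP; split => -[x y] //= [].
  rewrite /Q/= product_measure1E// -[LHS]mul1e; congr (_ * _)%E.
  by rewrite -(probability_setT m1).
exists m; split => [A mA|s].
  rewrite hm /Q/= /product_measure1; apply: eq_integral => x _ /=.
  by rewrite xsectionE.
rewrite (cfun_law s mD (fun A _ => hm A)) (cfun_law s mf Qf) (cfun_law s ms Qs).
pose Y (j : 'I_2) : R * R -> R := if j == ord0 then fst else snd.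
have mY j : measurable_fun setT (Y j) by rewrite /Y; case: ifP.
pose g (j : 'I_2) (x : R) : R[i] := cexp (0 +i* (s * x)).
have bg j : cbmeas (g j) by apply: cbmeas_cis; exact: mulrl_measurable.
have ind (A : 'I_2 -> set R) : (forall j, measurable (A j)) ->
    Q (\bigcap_j (Y j @^-1` A j)) = (\prod_(j < 2) Q (Y j @^-1` A j))%E.
  move=> mA; rewrite !big_ord_recl big_ord0 mule1 /Y/= -Qf// -Qs//.
  rewrite /Q -product_measure1E//; congr (_ _).
  apply/seteqP; split => [[x y] /= h|[x y] /= [h1 h2] j _].
    by split; [exact: (h ord0)|exact: (h (lift ord0 ord0))].
  by case: (unliftP ord0 j) => [k ->|->] //=; rewrite (ord1 k).
have := @cintegral_indep _ _ _ _ _ Q 2 Y mY ind g bg.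
rewrite !big_ord_recl big_ord0 mulr1 /Y/= => <-.
rewrite /cfun; congr cintegral; apply/funext => -[x y] /=.
rewrite !big_ord_recl big_ord0 mulr1 /g/= -cexpD; congr cexp.
by apply: complex_eqP => /=; rewrite ?addr0// mulrDr.
Qed.

End laws_of_functions.

(** Used to randomise the number of factors of a convolution power. *)
Lemma mixture_exists d (T : measurableType d) (R : realType)
    (w : nat -> R) (m_ : nat -> probability T R) :
  (forall n, 0 <= w n) -> (\sum_(n <oo) (w n)%:E)%E = 1%E ->
  exists m : probability T R, forall g : T -> R, (forall x, 0 <= g x) ->
    measurable_fun setT g ->
    (\int[m]_x (g x)%:E = \sum_(n <oo) ((w n)%:E * \int[m_ n]_x (g x)%:E))%E.
Proof.
move=> w0 w1.
pose k_ n : {measure set T -> \bar R} := mscale (NngNum (w0 n)) (m_ n).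
pose k := mseries k_ 0.
have k1 : k setT = 1%E.
  rewrite /k /mseries -w1; apply: eq_eseriesr => n _.
  by rewrite /k_/= /mscale/= probability_setT mule1.
pose M := Measure_isProbability.Build _ _ _ k k1.
pose m : probability T R := HB.pack (mseries k_ 0) M.
exists m => g g0 mg; have mg' : measurable_fun setT (EFin \o g) by exact/measurable_EFinP.
transitivity (\int[mseries k_ 0]_x (g x)%:E)%E; first by [].
rewrite ge0_integral_measure_series//; last by move=> x _; rewrite lee_fin.
apply: eq_eseriesr => n _; rewrite /k_ ge0_integral_mscale//.
by move=> x _; rewrite lee_fin.
Qed.

Section embedded_convolution_powers.
Variables (R : realType) (d : nat) (i0 : 'I_d).

(** The line in direction [i0]: infinite divisibility is checked on the line, where
    characteristic functions are known to determine laws. *)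
Definition axis (x : R) : 'rV[R]_d := x *: delta_mx ord0 i0.

Lemma axisD x y : axis (x + y) = axis x + axis y.
Proof. exact: scalerDl. Qed.

Lemma dot_axis z x : dot z (axis x) = z ord0 i0 * x.
Proof.
rewrite /axis dotZr mulrC; congr (_ * _).
rewrite /dot (bigD1 i0)//= !mxE !eqxx mulr1 big1 ?addr0// => i /negPf ni.
by rewrite !mxE ni andbF mulr0.
Qed.

Lemma measurable_axis : measurable_fun setT axis.
Proof.
apply: measurable_fun_rV => i.
rewrite (_ : (fun x => _) = (fun x : R => (delta_mx ord0 i0 : 'rV[R]_d) ord0 i * x)).
  exact: mulrl_measurable.
by apply/funext => x; rewrite /axis mxE mulrC.
Qed.

Lemma measurable_translate (B : set 'rV[R]_d) v : measurable B ->
  measurable [set y | B (v + y)].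
Proof.
move=> mB; rewrite -[X in measurable X]setTI.
have mT : measurable_fun setT (fun y : 'rV[R]_d => v + y).
  apply: measurable_fun_rV => i.
  rewrite (_ : (fun y => _) = (fun y : 'rV[R]_d => v ord0 i + y ord0 i)).
    by apply: measurable_funD; [exact: measurable_cst|exact: measurable_coord].
  by apply/funext => y; rewrite mxE.
exact: mT.
Qed.

(** The convolution powers of a law carried by a coordinate axis are computed
    on the line. *)
Lemma conv_pow_axis (rho : probability R R) (nu : probability 'rV[R]_d R) (n : nat) :
  (forall B, measurable B -> nu B = rho (axis @^-1` B)) ->
  exists m : probability R R,
    (forall s, cfun m idfun s = cfun rho idfun s ^+ n) /\
    forall B, measurable B -> m (axis @^-1` B) = conv_pow nu n B.
Proof.
move=> hnu; elim: n => [|n [m [hm1 hm2]]].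
  have mc : measurable_fun setT (fun _ : R => 0 : R) by exact: measurable_cst.
  have [m hm] := law_exists rho mc.
  exists m; split => [s|B mB].
    rewrite expr0 (cfun_law s mc (fun A _ => hm A)) /cfun -[RHS](cintegral_cst rho).
    congr cintegral; apply/funext => x; rewrite mulr0; exact: cexp0.
  rewrite hm /conv_pow/= /axis diracE; have [B0|B0] := boolP (0 \in B).
    rewrite -(probability_setT rho); congr (rho _); apply/seteqP; split => // x _.
    by rewrite /= scale0r; apply: set_mem.
  transitivity (rho set0); last by rewrite measure0.
  congr (rho _); apply/seteqP; split => // x.
  by rewrite /= scale0r => /mem_set; rewrite (negbTE B0).
have [m' [hm'2 hm'1]] := convolution_exists rho m.
exists m'; split => [s|B mB]; first by rewrite hm'1 hm1 exprS.
have maxB : measurable (axis @^-1` B).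
  by rewrite -[X in measurable X]setTI; exact: measurable_axis.
rewrite hm'2// /conv_pow iterS -/(conv_pow nu n).
pose F v := m (axis @^-1` [set y | B (v + y)]).
have mF : measurable_fun setT F.
  pose A : set ('rV[R]_d * R) := [set vt | B (vt.1 + axis vt.2)].
  have mA : measurable A.
    rewrite -[X in measurable X]setTI.
    have mD : measurable_fun setT (fun vt : 'rV[R]_d * R => vt.1 + axis vt.2).
      apply: measurable_fun_rV => i.
      rewrite (_ : (fun y => _) = (fun vt : 'rV[R]_d * R =>
         (vt.1 : 'rV_d) ord0 i + axis vt.2 ord0 i)); last first.
        by apply/funext => vt; rewrite mxE.
      apply: measurable_funD.
        by apply: (measurableT_comp (measurable_coord (R := R) i)); exact: measurable_fst.
      apply: (measurableT_comp (measurable_coord (R := R) i)).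
      by apply: (measurableT_comp measurable_axis); exact: measurable_snd.
    exact: mD.
  have := measurable_fun_xsection m mA; congr measurable_fun.
  by apply/funext => v; rewrite /= /F xsectionE.
have [h hh] := mfun_exists measurable_axis.
transitivity (\int[distribution rho h]_v F v)%E; last first.
  transitivity (\int[nu]_v F v)%E.
    apply: eq_measure_integral => A mA _; transitivity (rho (axis @^-1` A)).
      by rewrite -hh.
    exact/esym/hnu.
  apply: eq_integral => v _; rewrite /F; apply: hm2; exact: measurable_translate.
rewrite ge0_integral_distribution//.
apply: eq_integral => x _ /=; rewrite /F hh; congr (m _).
by apply/seteqP; split => y /=; rewrite axisD.
Qed.

(** A law on an axis is infinitely divisible as soon as its characteristic
    function has a root of each order among characteristic functions, because
    these determine the laws. *)
Lemma ID_axis (m : probability R R) (mu : probability 'rV[R]_d R) :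
  (forall B, measurable B -> mu B = m (axis @^-1` B)) ->
  (forall n, (0 < n)%N -> exists r : probability R R,
     forall s, cfun r idfun s ^+ n = cfun m idfun s) ->
  ID R d mu.
Proof.
move=> hmu hr n n0; have [r er] := hr n n0.
have [nu hnu] := law_exists r measurable_axis.
have [m' [h1 h2]] := conv_pow_axis n (fun B _ => hnu B).
exists nu => B mB; rewrite -h2// hmu//; apply: cfun_injective => [t|].
  by rewrite h1 er.
by rewrite -[X in measurable X]setTI; exact: measurable_axis.
Qed.

End embedded_convolution_powers.
Arguments axis {R d}.

Section compound_poisson.
Variable R : realType.

Lemma one_sub_Im_cfun d (T : measurableType d) (Q : probability T R) (Y : T -> R) s :
  measurable_fun setT Y ->
  (\int[Q]_w (1 - sin (s * Y w))%:E)%E = (1 - Im (cfun Q Y s))%:E.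
Proof.
move=> mY; have m : measurable_fun setT (fun w => s * Y w).
  by apply: measurable_funM => //; exact: measurable_cst.
have b1 : @bmeas _ T R (fun=> 1) by exact: bmeas_cst.
rewrite cfunE/= -[X in (X - _)%:E](Rintegral_prob_cst Q) -RintegralB_bmeas//.
  rewrite /Rintegral fineK//; apply: integrable_fin_num => //.
  by apply: bmeas_integrable; apply: bmeasB => //; exact: bmeas_sin.
exact: bmeas_sin.
Qed.

Lemma cfun_realP d (T : measurableType d) (Q : probability T R) (Y : T -> R) s c :
  measurable_fun setT Y ->
  (\int[Q]_w (1 - cos (s * Y w))%:E)%E = (1 - c)%:E ->
  (\int[Q]_w (1 - sin (s * Y w))%:E)%E = 1%E -> cfun Q Y s = c%:C.
Proof.
move=> mY; rewrite one_sub_Re_cfun// one_sub_Im_cfun// => -[h1] -[h2].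
by apply: complex_eqP => /=; lra.
Qed.

(** The law of a fair random sign. *)
Lemma symmetric_sign_exists : exists rho : probability R R,
  forall s, cfun rho idfun s = (cos s)%:C.
Proof.
pose Y (b : bool) : R := if b then 1 else -1.
have mY : measurable_fun setT Y by [].
have [rho hr] := law_exists (bernoulli_prob (2^-1 : R)) mY.
have hp : (0 <= (2^-1 : R) <= 1) by apply/andP; split; lra.
exists rho => s; rewrite (cfun_law s mY (fun A _ => hr A)).
have c0 x : (0 <= (1 - cos (s * Y x))%:E)%E by rewrite lee_fin one_sub_cos_ge0.
have s0 x : (0 <= (1 - sin (s * Y x))%:E)%E by rewrite lee_fin subr_ge0 sin_le1.
apply: cfun_realP => //; rewrite integral_bernoulli_prob//= mulr1 mulrN1 ?cosN ?sinN.
  by rewrite -!EFinM -EFinD /unstable.onem; congr EFin; field.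
by rewrite -!EFinM -EFinD /unstable.onem; congr EFin; field.
Qed.

Lemma eseries_EFin (u : nat -> R) (l : R) : series u @ \oo --> l ->
  (\sum_(n <oo) (u n)%:E)%E = l%:E.
Proof.
move=> h; apply: cvg_lim => //.
rewrite (_ : (fun n => _) = EFin \o series u).
  by apply: cvg_EFin; [exact: nearW|exact: h].
by apply/funext => n; rewrite sumEFin.
Qed.

Lemma cvg_exp_series (c x : R) :
  series (fun n => c * exp_coeff x n) @ \oo --> c * expR x.
Proof.
rewrite (_ : series _ = c \*: series (exp_coeff x)); last first.
  by apply/funext => n; rewrite /series/= scaler_sumr.
by apply: cvgZr; exact: is_cvg_series_exp_coeff.
Qed.

(** The law of the sum of a Poissonian number of independent random signs: the
    exponential series resums the powers of [cos s]. *)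
Lemma compound_poisson_exists (c : R) : 0 <= c -> exists m : probability R R,
  forall s, cfun m idfun s = (expR (c * (cos s - 1)))%:C.
Proof.
move=> c0; have [rho hrho] := symmetric_sign_exists.
have pw n : exists m : probability R R, forall s, cfun m idfun s = ((cos s) ^+ n)%:C.
  elim: n => [|n [m hm]].
    have mc : measurable_fun setT (fun _ : R => 0 : R) by exact: measurable_cst.
    have [m hm] := law_exists rho mc.
    exists m => s; rewrite expr0 (cfun_law s mc (fun A _ => hm A)) /cfun.
    rewrite -[RHS](cintegral_cst rho).
    congr cintegral; apply/funext => x; rewrite mulr0; exact: cexp0.
  have [m' [_ h]] := convolution_exists rho m.
  by exists m' => s; rewrite h hrho hm exprS rmorphM.
have [m_ hm_] := choice pw.
pose w n := expR (- c) * exp_coeff c n.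
have w0 n : 0 <= w n by rewrite mulr_ge0 ?expR_ge0//; exact: exp_coeff_ge0.
have w1 : (\sum_(n <oo) (w n)%:E)%E = 1%E.
  by rewrite (eseries_EFin (@cvg_exp_series (expR (- c)) c)) -expRD addNr expR0.
have [m hm] := mixture_exists m_ w0 w1.
exists m => s.
have mid : measurable_fun setT (fun x : R => s * x) by exact: mulrl_measurable.
have mcos : measurable_fun setT (fun x : R => 1 - cos (s * x)).
  by apply: measurable_funB; [exact: measurable_cst|case: (bmeas_cos mid)].
have msin : measurable_fun setT (fun x : R => 1 - sin (s * x)).
  by apply: measurable_funB; [exact: measurable_cst|case: (bmeas_sin mid)].
apply: cfun_realP => //.
- exact: measurable_id.
- rewrite [LHS](hm (fun x => 1 - cos (s * x)) (fun x => one_sub_cos_ge0 (s * x)) mcos).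
  transitivity (\sum_(n <oo) (expR (- c) * exp_coeff c n -
      expR (- c) * exp_coeff (c * cos s) n)%:E)%E.
    apply: eq_eseriesr => n _; rewrite (one_sub_Re_cfun (m_ n) s (@measurable_id _ _ setT)) hm_/=.
    by rewrite -EFinM /w /exp_coeff/= exprMn; congr EFin; ring.
  apply: eseries_EFin.
  rewrite (_ : series _ = series (fun n => expR (- c) * exp_coeff c n) -
     series (fun n => expR (- c) * exp_coeff (c * cos s) n)); last first.
    by apply/funext => n; rewrite /series/= sumrB.
  rewrite (_ : 1 - _ = expR (- c) * expR c - expR (- c) * expR (c * cos s)).
    by apply: cvgB; exact: cvg_exp_series.
  by rewrite -!expRD addNr expR0; congr (_ - expR _); ring.
- rewrite [LHS](hm (fun x => 1 - sin (s * x)) _ msin); last first.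
    by move=> x; rewrite subr_ge0; exact: sin_le1.
  rewrite -w1; apply: eq_eseriesr => n _.
  by rewrite (one_sub_Im_cfun (m_ n) s (@measurable_id _ _ setT)) hm_/= subr0 mule1.
Qed.

End compound_poisson.


(** * Laws with prescribed jumps *)

Section convergence_in_probability.
Context d (T : measurableType d) (R : realType) (P : probability T R).

(** The integrands differ by at most [|s| dl] where [u n] and [Z] are [dl]-close,
    and by at most two on the small exceptional set. *)
Lemma Rintegral_lip_cvg (g : R -> R) (u : nat -> T -> R) (Z : T -> R) (s : R) :
  (forall x y, `|g x - g y| <= `|x - y|) -> (forall x, `|g x| <= 1) ->
  (forall Y : T -> R, measurable_fun setT Y -> bmeas (fun w => g (s * Y w))) ->
  (forall n, measurable_fun setT (u n)) -> measurable_fun setT Z ->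
  (forall e, 0 < e -> exists N, forall n, (N <= n)%N ->
     (P [set w | (e <= `|u n w - Z w|)%R] <= e%:E)%E) ->
  (fun n => \int[P]_w g (s * u n w)) @ \oo --> \int[P]_w g (s * Z w).
Proof.
move=> lip g1 bg mu mZ H; apply/cvgrPdist_le => e e0.
pose dl := e / (`|s| + 2); have dl0 : 0 < dl by rewrite divr_gt0// ltr_wpDl.
have [N hN] := H _ dl0; exists N => // n /hN /= h.
pose A := [set w | (dl <= `|u n w - Z w|)%R].
have mA : measurable A by apply: measurable_dist_ge.
have bA : bmeas (\1_A : T -> R) by exact: bmeas_indic.
have bD : bmeas (fun w => g (s * Z w) - g (s * u n w)) by apply: bmeasB; exact: bg.
rewrite -RintegralB_bmeas; [|exact: bg|exact: bg].
have b2 : bmeas (fun w => `|s| * dl + 2 * \1_A w).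
  by apply: bmeasD; [exact: bmeas_cst|apply: bmeasM => //; exact: bmeas_cst].
have pt w : `|g (s * Z w) - g (s * u n w)| <= `|s| * dl + 2 * \1_A w.
  rewrite indicE; case: (boolP (w \in A)) => [_|/negP wA].
    rewrite mulr1; apply: (le_trans (ler_normB _ _)).
    by have := g1 (s * Z w); have := g1 (s * u n w); have : 0 <= `|s| * dl; [rewrite mulr_ge0// ltW|lra].
  rewrite mulr0 addr0 (le_trans (lip _ _))// -mulrBr normrM ler_wpM2l// ltW//.
  by rewrite ltNge distrC; apply/negP => h'; apply: wA; rewrite inE.
have le1 : \int[P]_w (g (s * Z w) - g (s * u n w)) <= \int[P]_w (`|s| * dl + 2 * \1_A w).
  by apply: le_Rintegral_bmeas => // w; rewrite (le_trans (ler_norm _)).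
have le2 : \int[P]_w (-1 * (`|s| * dl + 2 * \1_A w)) <=
    \int[P]_w (g (s * Z w) - g (s * u n w)).
  apply: le_Rintegral_bmeas => //; first by apply: bmeasM => //; exact: bmeas_cst.
  by move=> w; rewrite mulN1r lerNl (le_trans _ (pt w))// -normrN ler_norm.
have ev : \int[P]_w (`|s| * dl + 2 * \1_A w) <= e.
  rewrite RintegralD_bmeas; [|exact: bmeas_cst|by apply: bmeasM => //; exact: bmeas_cst].
  rewrite Rintegral_prob_cst RintegralZ_bmeas// Rintegral_prob_indic//.
  have {}h : fine (P A) <= dl by rewrite -lee_fin fineK// fin_num_measure.
  have ee : e = `|s| * dl + 2 * dl.
    by rewrite -mulrDl /dl mulrC divfK// gt_eqF// ltr_wpDl.
  by rewrite [leRHS]ee lerD2l ler_wpM2l.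
rewrite ler_norml; apply/andP; split; last exact: le_trans le1 ev.
by apply: le_trans le2; rewrite RintegralZ_bmeas// mulN1r lerN2.
Qed.

Lemma normr_cosB_le (x y : R) : `|cos x - cos y| <= `|x - y|.
Proof.
have -> : cos x - cos y = - 2 * sin ((x + y) / 2) * sin ((x - y) / 2).
  have key p q : cos (p + q) - cos (p - q) = - 2 * sin p * sin q.
    by rewrite cosD cosB; ring.
  by rewrite -key; congr (cos _ - cos _); field.
rewrite !normrM normrN (ger0_norm (ler0n _ 2)).
have h1 : `|sin ((x + y) / 2)| <= 1 by exact: sin_max.
have := normr_sin_le ((x - y) / 2); rewrite normrM (ger0_norm (x := 2^-1))// => h2.
have h3 : `|sin ((x + y) / 2)| * `|sin ((x - y) / 2)| <= 1 * (`|x - y| / 2).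
  by apply: ler_pM.
by rewrite -mulrA; lra.
Qed.

Lemma normr_sinB_le (x y : R) : `|sin x - sin y| <= `|x - y|.
Proof.
have cp t : sin t = cos (t - pi / 2) by rewrite cosB cos_pihalf sin_pihalf; ring.
by rewrite !cp (le_trans (normr_cosB_le _ _))// (_ : x - _ - _ = x - y)//; ring.
Qed.

Lemma ccvg_cfun_prob (u : nat -> T -> R) (Z : T -> R) (s : R) :
  (forall n, measurable_fun setT (u n)) -> measurable_fun setT Z ->
  (forall e, 0 < e -> exists N, forall n, (N <= n)%N ->
     (P [set w | (e <= `|u n w - Z w|)%R] <= e%:E)%E) ->
  ccvg (fun n => cfun P (u n) s) (cfun P Z s).
Proof.
move=> mu mZ H.
have ms Y : measurable_fun setT Y -> measurable_fun setT (fun w : T => s * Y w).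
  by move=> mY; apply: measurable_funM => //; exact: measurable_cst.
split.
- rewrite [X in X @ _ --> _](_ : _ = fun n => \int[P]_w cos (s * u n w)); last first.
    by apply/funext => n; rewrite cfunE.
  rewrite cfunE; apply: Rintegral_lip_cvg => //.
  + exact: normr_cosB_le.
  + exact: cos_max.
  + by move=> Y mY; apply: bmeas_cos; exact: ms.
- rewrite [X in X @ _ --> _](_ : _ = fun n => \int[P]_w sin (s * u n w)); last first.
    by apply/funext => n; rewrite cfunE.
  rewrite cfunE; apply: Rintegral_lip_cvg => //.
  + exact: normr_sinB_le.
  + exact: sin_max.
  + by move=> Y mY; apply: bmeas_sin; exact: ms.
Qed.

End convergence_in_probability.

Section jump_exponent.
Variable R : realType.

Definition trunc_sqr (x : R) : R := Num.min (x ^+ 2) 1.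

Lemma trunc_sqr_ge0 x : 0 <= trunc_sqr x.
Proof. by rewrite /trunc_sqr le_min sqr_ge0 ler01. Qed.

Lemma one_sub_cos_trunc q x : 1 - cos (q * x) <= (q ^+ 2 + 2) * trunc_sqr x.
Proof.
rewrite /trunc_sqr; have q0 := sqr_ge0 q; case: (leP (x ^+ 2) 1) => x1.
  apply: (le_trans (one_sub_cos_le_sqr _)); rewrite exprMn mulrDl lerDl.
  by rewrite mulr_ge0// sqr_ge0.
by apply: (le_trans (one_sub_cos_le2 _)); lra.
Qed.

Variables a l : nat -> R.

(** Minus the exponent of the symmetric law whose jumps [a k] and [- a k] have
    intensity [l k / 2] each. *)
Definition jump_exponent (u : R) : R :=
  limn (series (fun k => l k * (1 - cos (a k * u)))).

Hypothesis l0 : forall k, 0 <= l k.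
Hypothesis Scvg : cvgn (series (fun k => l k * trunc_sqr (a k))).

Lemma jump_exponent_cvg u :
  series (fun k => l k * (1 - cos (a k * u))) @ \oo --> jump_exponent u.
Proof.
have h : cvgn (series (fun k => (u ^+ 2 + 2) * (l k * trunc_sqr (a k)))).
  exact: is_cvg_seriesZ.
apply: series_le_cvg h => k.
- by rewrite mulr_ge0// one_sub_cos_ge0.
- by rewrite !mulr_ge0// ?trunc_sqr_ge0// addr_ge0// sqr_ge0.
- rewrite mulrCA ler_wpM2l// [a k * u]mulrC; exact: one_sub_cos_trunc.
Qed.

Lemma jump_exponent_ge0 u : 0 <= jump_exponent u.
Proof.
apply: limr_ge; first exact: jump_exponent_cvg.
apply: nearW => n.
by apply: sumr_ge0 => k _; rewrite mulr_ge0// one_sub_cos_ge0.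
Qed.

Lemma jump_exponent0 : jump_exponent 0 = 0.
Proof.
rewrite /jump_exponent (_ : series _ = fun=> 0); first exact: lim_cst.
by apply/funext => n; apply: big1 => k _; rewrite mulr0 cos0 subrr mulr0.
Qed.

End jump_exponent.

Lemma sum_tail (R : zmodType) (v : nat -> R) m n : (m <= n)%N ->
  \sum_(k < n) (if (k < m)%N then 0 else v k) = \sum_(k < n) v k - \sum_(k < m) v k.
Proof.
move=> mn; rewrite -(subnKC mn); elim: (n - m)%N => [|i IH].
  by rewrite addn0 subrr big1// => k _; rewrite ltn_ord.
by rewrite addnS !big_ord_recr/= IH ltnNge leq_addr/= addrAC.
Qed.

(** A law with a prescribed sequence of jump sizes is a limit in probability of
    combinations of the masses that a Poissonian random measure puts on disjoint
    intervals whose lengths are the jump intensities. *)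
Section jump_law.
Variables (R : realType) (d : nat) (pi : probability 'rV[R]_d R).
Variables (N : set_indexed_rvs R d) (HN : is_random_measure pi N) (e : 'rV[R]_d).
Notation P := (rm_prob N).
Hypothesis Nexp : forall B s, bounded_borel B ->
  rm_cfun N e B s = (expR (fine (lam B) * (cos s - 1)))%:C.
Variables a l : nat -> R.
Hypothesis l0 : forall k, 0 <= l k.
Hypothesis Scvg : cvgn (series (fun k => l k * trunc_sqr (a k))).
Variables (c : R) (c0 : 0 <= c).

Let t k := c * \sum_(j < k) l j.
Let B k : set R := `]t k, t k.+1]%classic.
Let Y k w := dot e (N (B k) w).

Let tS k : t k.+1 = t k + c * l k.
Proof. by rewrite /t big_ord_recr/= mulrDr. Qed.

Let t_le j k : (j <= k)%N -> t j <= t k.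
Proof.
move=> jk; rewrite -(subnKC jk); elim: (_ - _)%N => [|n IH]; first by rewrite addn0.
by rewrite addnS tS (le_trans IH)// lerDl mulr_ge0.
Qed.

Let bB k : bounded_borel (B k).
Proof. exact: bounded_borel_itv. Qed.

Let lamB k : fine (lam (B k)) = c * l k.
Proof.
rewrite /B lebesgue_measure_itv/= lte_fin tS ltrDl.
case: ltP => [h|h]; first by rewrite -EFinB/= addrAC subrr add0r.
by apply/esym/eqP; rewrite eq_le h mulr_ge0.
Qed.

Let tB : trivIset setT B.
Proof.
have h j k x : (j < k)%N -> B j x -> B k x -> False.
  move=> jk; rewrite /B/= !in_itv/= => /andP[_ h1] /andP[h2 _].
  by have := lt_le_trans h2 (le_trans h1 (t_le jk)); rewrite ltxx.
move=> j k _ _ [x [xj xk]]; case: (ltngtP j k) => // jk.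
- by case: (h _ _ _ jk xj xk).
- by case: (h _ _ _ jk xk xj).
Qed.

Let mY k : measurable_fun setT (Y k).
Proof. exact: measurable_dot_rm. Qed.

Let cfunY (b : nat -> R) n s : cfun P (fun w => \sum_(k < n) b k * Y k w) s =
  (expR (- (c * \sum_(k < n) l k * (1 - cos (s * b k)))))%:C.
Proof.
have tB' : trivIset setT (fun i : 'I_n => B i).
  by move=> i j _ _ h; apply: val_inj; exact: tB.
have := cfun_lin_comb HN e (fun i : 'I_n => b i) s (fun i : 'I_n => bB i) tB'.
rewrite (_ : (fun w => dot e _) = (fun w => \sum_(k < n) b k * Y k w)); last first.
  by apply/funext => w; rewrite dot_sumr; apply: eq_bigr => i _; rewrite dotZr.
move=> ->; under eq_bigr do rewrite Nexp// lamB.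
rewrite -rmorph_prod; congr (_%:C); rewrite -expR_sum; congr expR.
by rewrite mulr_sumr -sumrN; apply: eq_bigr => i _; ring.
Qed.

Let W n w := \sum_(k < n) a k * Y k w.

Let mW n : measurable_fun setT (W n).
Proof.
apply: measurable_sum => i; apply: measurable_funM; first exact: measurable_cst.
exact: mY.
Qed.

(** The truncation inequality bounds the probability that a block of jumps
    contributes much by the sum of [l k * trunc_sqr (a k)] over the block. *)
Let W_cauchy : forall e, 0 < e -> exists N, forall n m, (N <= n)%N -> (N <= m)%N ->
     (P [set w | (e <= `|W n w - W m w|)%R] <= e%:E)%E.
Proof.
move=> eps eps0; pose q := 2 / eps; have q0 : 0 < q by rewrite divr_gt0.
pose K := 2 * c * (q ^+ 2 + 2).
have K0 : 0 <= K by rewrite !mulr_ge0// addr_ge0// sqr_ge0.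
have K10 : 0 < K + 1 by lra.
pose u k := l k * trunc_sqr (a k).
have ek0 : 0 < eps / (K + 1) by rewrite divr_gt0.
have [N0 hN0] : exists N0, forall n m, (N0 <= m)%N -> (m <= n)%N ->
    \sum_(k < n) u k - \sum_(k < m) u k <= eps / (K + 1).
  have nd : nondecreasing_seq (series u).
    by apply: nondecreasing_series => k _ _; rewrite mulr_ge0// trunc_sqr_ge0.
  have /cvgrPdist_le/(_ _ ek0)[N0 _ hN0] := Scvg.
  exists N0 => n m h1 mn; have := hN0 m h1; rewrite /= ler_norml => /andP[_].
  have := nondecreasing_cvgn_le nd Scvg n.
  by rewrite /series/= !big_mkord; lra.
exists N0 => n m; wlog mn : n m / (m <= n)%N => [H hn hm|].
  case/orP : (leq_total m n) => h; first exact: H.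
  by under eq_set do rewrite distrC; exact: H.
move=> _ hm.
pose b k := if (k < m)%N then 0 else a k.
have eD w : W n w - W m w = \sum_(k < n) b k * Y k w.
  rewrite -(sum_tail (fun k => a k * Y k w) mn); apply: eq_bigr => k _.
  by rewrite /b; case: ifP => // _; rewrite mul0r.
have mD : measurable_fun setT (fun w => q * (W n w - W m w)).
  by apply: measurable_funM; [exact: measurable_cst|exact: measurable_funB].
rewrite (_ : [set w | _] = [set w | (2 <= `|q * (W n w - W m w)|)%R]); last first.
  apply/seteqP; split => w /=; rewrite normrM gtr0_norm// /q;
    by rewrite mulrAC ler_pdivlMr// ler_pM2l.
apply: (@le_trans _ _ (2%:E * (c * ((q ^+ 2 + 2) * (eps / (K + 1))))%:E)%E).
  apply: truncation_inequality => // s /andP[s0 s1].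
  rewrite (_ : (fun w => _) = (fun w => (1 - cos ((s * q) * (\sum_(k < n) b k * Y k w)))%:E)); last first.
    by apply/funext => w; rewrite eD mulrA.
  rewrite one_sub_Re_cfun; last first.
    apply: measurable_sum => i; apply: measurable_funM; first exact: measurable_cst.
    exact: mY.
  rewrite cfunY/= lee_fin.
  set A := \sum_(k < n) _; have A0 : c * A <= c * ((q ^+ 2 + 2) * (eps / (K + 1))).
    rewrite ler_wpM2l//; apply: (@le_trans _ _ ((q ^+ 2 + 2) * (\sum_(k < n) u k - \sum_(k < m) u k))).
      rewrite -sum_tail// mulr_sumr; apply: ler_sum => k _; rewrite /b.
      case: ifP => _; first by rewrite !mulr0 cos0 subrr mulr0.
      rewrite /u [leRHS]mulrCA ler_wpM2l//; apply: (le_trans (one_sub_cos_trunc _ _)).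
      rewrite ler_wpM2r ?trunc_sqr_ge0// lerD2r exprMn ler_piMl ?sqr_ge0//.
      by rewrite expr_le1.
    by rewrite ler_wpM2l ?hN0// addr_ge0// sqr_ge0.
  by apply: le_trans A0; have := expR_ge1Dx (- (c * A)); lra.
rewrite -EFinM lee_fin.
rewrite (_ : 2 * _ = K * (eps / (K + 1))); last by rewrite /K; ring.
by rewrite mulrCA; apply: ler_piMr; [exact: ltW|rewrite ler_pdivrMr// mul1r lerDl].
Qed.

Lemma jump_law_exists : exists V : probability R R,
  forall u, cfun V idfun u = (expR (- (c * jump_exponent a l u)))%:C.
Proof.
have [Z mZ HZ] := L0_complete mW W_cauchy.
have [V hV] := law_exists P mZ.
exists V => u; rewrite (cfun_law u mZ (fun A _ => hV A)).
apply: (ccvg_unique (ccvg_cfun_prob u mW mZ HZ)).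
have h : (fun n => expR (- (c * \sum_(k < n) l k * (1 - cos (u * a k))))) @ \oo -->
    expR (- (c * jump_exponent a l u)).
  apply: (@cvg_seq_continuous _ expR); first exact: continuous_expR.
  apply: cvgN; apply: cvgM; first exact: cvg_cst.
  rewrite (_ : (fun n => _) = series (fun k => l k * (1 - cos (a k * u)))).
    exact: jump_exponent_cvg.
  by apply/funext => n; rewrite /series/= big_mkord; apply: eq_bigr => k _; rewrite [u * _]mulrC.
split.
- rewrite (_ : (fun n => _) = (fun n => expR (- (c * \sum_(k < n) l k * (1 - cos (u * a k))))))//.
  by apply/funext => n; rewrite /W cfunY.
- rewrite (_ : (fun n => _) = (fun=> 0)); first exact: cvg_cst.
  by apply/funext => n; rewrite /W cfunY.
Qed.

End jump_law.


(** * A purely non-Gaussian law with prescribed jumps *)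

Lemma symmetric_jump_measure_exists d (T : measurableType d) (R : realType)
    (x y : nat -> T) (l : nat -> R) : (forall k, 0 <= l k) ->
  exists nu : {measure set T -> \bar R},
  (forall A, nu A = (\sum_(k <oo) ((l k / 2)%:E * (\d_(x k) A + \d_(y k) A)))%E) /\
  forall g : T -> \bar R, (forall v, (0 <= g v)%E) -> measurable_fun setT g ->
    (\int[nu]_v g v = \sum_(k <oo) ((l k / 2)%:E * (g (x k) + g (y k))))%E.
Proof.
move=> l0; have l20 k : 0 <= l k / 2 by rewrite divr_ge0.
pose m k : {measure set T -> \bar R} :=
  mscale (NngNum (l20 k)) (measure_add (\d_(x k)) (\d_(y k))).
exists (mseries m 0); split => [A|g g0 mg].
  by apply: eq_eseriesr => k _; congr (_ * _)%E; exact: measure_addE.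
rewrite ge0_integral_measure_series//; apply: eq_eseriesr => k _.
rewrite /m ge0_integral_mscale//= ge0_integral_measure_add//.
by rewrite !integral_dirac// !diracT !mul1e.
Qed.

Section jump_law_ID0.
Variables (R : realType) (d : nat) (i0 : 'I_d).
Variable X : probability 'rV[R]_d R -> set_indexed_rvs R d.
Hypothesis X_spec : forall mu, ID R d mu -> is_random_measure mu (X mu).
Local Notation ax := (@axis R d i0).

Let e0 : 'rV[R]_d := delta_mx ord0 i0.

Lemma dot_axis0 (x : R) : dot e0 (ax x) = x.
Proof. by rewrite dot_axis /e0 mxE !eqxx mul1r. Qed.

Lemma enorm_axis (x : R) : enorm (ax x) ^+ 2 = x ^+ 2.
Proof.
by rewrite /enorm sqr_sqrtr ?dot_ge0// dot_axis /axis !mxE !eqxx mulr1 expr2.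
Qed.

Lemma charfun_axis (m : probability R R) (mu : probability 'rV[R]_d R) z :
  (forall B, measurable B -> mu B = m (ax @^-1` B)) ->
  charfun mu z = cfun m idfun (z ord0 i0).
Proof.
move=> h; rewrite /charfun (cintegral_law (measurable_axis i0) h).
  by congr cintegral; apply/funext => x; rewrite dot_axis.
by have := @cbmeas_cfun _ _ _ (fun x => dot z x) 1 (measurable_dot z (@measurable_id _ _ setT));
  congr cbmeas; apply/funext => x; rewrite mul1r.
Qed.

(** The compound Poisson law on an axis is infinitely divisible, so it has a random
    measure; uniqueness of continuous logarithms identifies its exponent. *)
Lemma poisson_measure_exists : exists N : set_indexed_rvs R d,
  (exists pi, is_random_measure pi N) /\ forall B s, bounded_borel B ->
    rm_cfun N e0 B s = (expR (fine (lam B) * (cos s - 1)))%:C.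
Proof.
have [m hm] := @compound_poisson_exists R 1 ler01.
have [pi hpi] := law_exists m (measurable_axis i0).
have IDpi : ID R d pi.
  apply: (ID_axis (fun B _ => hpi B)) => n n0.
  have n1 : 0 <= (n%:R : R)^-1 by rewrite invr_ge0.
  have [r hr] := @compound_poisson_exists R n%:R^-1 n1.
  exists r => s; rewrite hr hm -rmorphXn/= -expRM_natl mul1r mulrA mulfV ?mul1r//.
  by rewrite pnatr_eq0 -lt0n.
have HN := X_spec IDpi; exists (X pi); split; first by exists pi.
have [c [c1 c2 c00 cE]] := levy_exponent HN e0.
have cc s : cexp (c s) = cexp ((cos s - 1)%:C).
  rewrite (levy_exponent_law HN cE) (charfun_axis _ (fun B _ => hpi B)) mxE mxE !eqxx mulr1.
  by rewrite hm mul1r cexpE/= cos0 sin0 mulr1 mulr0.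
have {}cc s : c s = (cos s - 1)%:C.
  apply: (continuous_log_unique c1 c2 _ _ c00 _ cc).
  - move=> u; apply: (@continuousB _ _ _ cos (fun=> 1)); first exact: continuous_cos.
    exact: cst_continuous.
  - exact: cst_continuous.
  - by rewrite cos0 subrr.
move=> B s bB; rewrite cE// cc cscaleE/= mulr0 cexpE/= cos0 sin0 mulr1 mulr0.
by [].
Qed.

Variables a l : nat -> R.
Hypothesis a_gt0 : forall k, 0 < a k.
Hypothesis l0 : forall k, 0 <= l k.
Hypothesis Scvg : cvgn (series (fun k => l k * trunc_sqr (a k))).

(** The roots are the laws with all intensities divided by [n].  The jump measure
    is symmetric, so the odd part of the integrand of the representation has equal
    positive and negative parts and integrates to zero. *)
Lemma jump_law_ID0 : exists2 mu, ID0 R d mu &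
  is_cumulant mu (fun z => (- jump_exponent a l (z ord0 i0))%:C).
Proof.
have [N [[pi HN] Nexp]] := poisson_measure_exists.
have [V hV] := jump_law_exists HN Nexp l0 Scvg ler01.
have [mu hmu] := law_exists V (measurable_axis i0).
have IDmu : ID R d mu.
  apply: (ID_axis (fun B _ => hmu B)) => n n0.
  have n1 : 0 <= (n%:R : R)^-1 by rewrite invr_ge0.
  have [r hr] := jump_law_exists HN Nexp l0 Scvg n1.
  exists r => s; rewrite hr hV -rmorphXn/= -expRM_natl mul1r mulrN mulrA mulfV ?mul1r//.
  by rewrite pnatr_eq0 -lt0n.
have chmu z : charfun mu z = (expR (- jump_exponent a l (z ord0 i0)))%:C.
  by rewrite (charfun_axis _ (fun B _ => hmu B)) hV mul1r.
have cje : continuous (jump_exponent a l).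
  have [c1 _] := cfun_continuous V (@measurable_id _ _ setT).
  rewrite (_ : jump_exponent a l = fun u => - ln (Re (cfun V idfun u))); last first.
    by apply/funext => u; rewrite hV mul1r/= expRK opprK.
  move=> u; apply: (@continuousN _ _ _ (fun u => ln (Re (cfun V idfun u)))).
  apply: (@continuous_comp _ _ _ (fun u => Re (cfun V idfun u)) (@ln R)); first exact: c1.
  by apply: continuous_ln; rewrite hV/= expR_gt0.
have cum : is_cumulant mu (fun z => (- jump_exponent a l (z ord0 i0))%:C).
  split.
  - split => z /=; last exact: cst_continuous.
    apply: (@continuousN _ _ _ (fun z : 'rV[R]_d => jump_exponent a l (z ord0 i0))).
    apply: (@continuous_comp _ _ _ (fun z : 'rV[R]_d => z ord0 i0) (jump_exponent a l)).
      exact: coord_continuous.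
    exact: cje.
  - by rewrite mxE jump_exponent0 oppr0.
  - by move=> z; rewrite chmu cexpE/= cos0 sin0 mulr1 mulr0.
exists mu => //; split => //.
have [nu [nu1 nu2]] := symmetric_jump_measure_exists
  (fun k => ax (a k)) (fun k => ax (- a k)) l0.
exists nu, 0; split.
- split; first exact: trmx0.
  by move=> z; rewrite trmx0 mulmx0 dot0r.
- rewrite nu1 eseries0// => k _ _.
  have an x : x != 0 -> \d_(ax x) [set 0] = 0%E :> \bar R.
    move=> x0; rewrite diracE memNset// => /= h.
    by move: x0; rewrite -(dot_axis0 x) h dot0r eqxx.
  by rewrite !an ?oppr_eq0 ?gt_eqF// adde0 mule0.
- have mn : measurable_fun setT (fun v : 'rV[R]_d => (Num.min (enorm v ^+ 2) 1)%:E).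
    apply/measurable_EFinP; apply: measurable_minr; last exact: measurable_cst.
    by apply: measurable_funX; exact: (measurable_enorm (@measurable_id _ _ setT)).
  rewrite nu2//; last by move=> v; rewrite lee_fin; exact: trunc_sqr_ge0.
  rewrite (eq_eseriesr (g := fun k => (l k * trunc_sqr (a k))%:E)).
    by rewrite (eseries_EFin Scvg) ltry.
  move=> k _; rewrite !enorm_axis sqrrN -EFinD -EFinM /trunc_sqr; congr EFin.
  by field.
- move=> z; rewrite (cumulantE cum) trmx0 mulmx0 dot0r mulr0 oppr0 add0r.
  have -> : 0 +i* dot 0 z = 0 by rewrite /dot big1// => i _; rewrite mxE mul0r.
  rewrite addr0; apply: complex_eqP => /=.
  + transitivity (fine (\int[nu]_v - (1 - cos (dot z v))%:E)%E); last first.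
      congr fine; apply: eq_integral => v _.
      by rewrite -EFinN; congr EFin; rewrite /= expR0; ring.
    rewrite integral_ge0N; last by move=> v _; rewrite lee_fin one_sub_cos_ge0.
    rewrite nu2; [|by move=> v; rewrite lee_fin one_sub_cos_ge0|]; last first.
      apply/measurable_EFinP; apply: measurable_funB; first exact: measurable_cst.
      by case: (bmeas_cos (measurable_dot z (@measurable_id _ _ setT))).
    rewrite (eq_eseriesr (g := fun k => (l k * (1 - cos (a k * z ord0 i0)))%:E)).
      by rewrite (eseries_EFin (@jump_exponent_cvg _ _ _ l0 Scvg (z ord0 i0))).
    move=> k _; rewrite !dot_axis mulrN cosN -EFinD -EFinM [z _ _ * _]mulrC.
    by congr EFin; field.
  + pose g v : \bar R := (sin (dot z v) - dot z v / (1 + enorm v ^+ 2))%:E.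
    have mg : measurable_fun setT g.
      apply/measurable_EFinP; apply: measurable_funB.
        by case: (bmeas_sin (measurable_dot z (@measurable_id _ _ setT))).
      apply: measurable_funM; first exact: measurable_dot.
      rewrite (_ : (fun v => _) = (fun v => (1 + enorm v ^+ 2) `^ (-1))); last first.
        by apply/funext => v; rewrite powR_inv1// addr_ge0// sqr_ge0.
      apply: (measurableT_comp (f := fun x : R => x `^ (-1))); first exact: measurable_powR.
      apply: measurable_funD; first exact: measurable_cst.
      by apply: measurable_funX; exact: (measurable_enorm (@measurable_id _ _ setT)).
    transitivity (fine (\int[nu]_v g v)%E); last first.
      congr fine; apply: eq_integral => v _.
      by congr EFin; rewrite /= expR0; ring.
    rewrite integralE.
    have gN x : g (ax (- x)) = (- g (ax x))%E.
      by rewrite /g !dot_axis !enorm_axis sqrrN mulrN sinN -EFinN; congr EFin; ring.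
    have e : (\int[nu]_v g^\+ v = \int[nu]_v g^\- v)%E.
      rewrite !nu2//; [|exact: measurable_funeneg|exact: measurable_funepos].
      apply: eq_eseriesr => k _; congr (_ * _)%E.
      by rewrite !funeposE !funenegE !gN oppeK addeC.
    (* Also when both parts are infinite: [fine] sends the indeterminate
       difference to zero. *)
    rewrite e; case: (integral _ _ _) => //= r; by rewrite subrr.
Qed.

End jump_law_ID0.


(** * Consequences of the jump condition *)

Lemma fatou_bound d (T : measurableType d) (R : realType) (mu : {measure set T -> \bar R})
    (D : set T) (f_ : nat -> T -> R) (f : T -> R) (M : \bar R) : measurable D ->
  (forall n, measurable_fun D (f_ n)) -> measurable_fun D f ->
  (forall n x, D x -> 0 <= f_ n x) -> (forall x, D x -> 0 <= f x) ->
  {ae mu, forall x, D x -> f_ ^~ x @ \oo --> f x} ->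
  (exists N, forall n, (N <= n)%N -> (\int[mu]_(x in D) (f_ n x)%:E <= M)%E) ->
  (\int[mu]_(x in D) (f x)%:E <= M)%E.
Proof.
move=> mD mf_ mf f_0 f0 [A [mA A0 hA]] [N hN].
have mDA : measurable (D `\` A) by exact: measurableD.
rewrite (ge0_negligible_integral mA mD _ _ A0); last 2 first.
- exact/measurable_EFinP.
- by move=> x Dx; rewrite lee_fin f0.
pose g n x := (f_ (n + N)%N x)%:E.
have e x : (D `\` A) x -> limn_einf (g ^~ x) = (f x)%:E.
  move=> [Dx Ax]; apply: (cvg_limn_einf_sup _).1; apply: cvg_EFin; first exact: nearW.
  have h : f_ ^~ x @ \oo --> f x by apply: contrapT => h; apply: Ax; apply: hA => /(_ Dx).
  by rewrite -(cvg_shiftn N) in h.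
rewrite (_ : (\int[mu]_(x in D `\` A) _ = \int[mu]_(x in D `\` A) limn_einf (g ^~ x))%E); last first.
  by apply: eq_integral => x /set_mem h; rewrite e.
have mg n : measurable_fun (D `\` A) (g n).
  by apply: (measurable_funS mD); [exact: subDsetl|exact/measurable_EFinP].
apply: (le_trans (fatou mu mDA mg _)).
  by move=> n x [Dx _]; rewrite lee_fin f_0.
rewrite limn_einf_lim; apply: lime_le; first exact: is_cvg_einfs.
apply: nearW => n; apply: (@le_trans _ _ (\int[mu]_(x in D `\` A) g n x)%E).
  by apply: ereal_inf_lbound; exists n => //=.
apply: le_trans (hN (n + N)%N (leq_addl _ _)).
apply: ge0_subset_integral => //; first exact/measurable_EFinP.
by move=> x Dx; rewrite lee_fin f_0.
Qed.

Section necessity.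
Variables (R : realType) (a b : \bar R) (f : R -> R).
Hypothesis mf : measurable_fun (oitv a b) f.
Let D := oitv a b.
Let mD : measurable D := measurable_oitv a b.

Let G (t : R) : \bar R := (\int[lam]_(s in D) (1 - cos (t * f s))%:E)%E.

Let mtf t : measurable_fun D (fun s => t * f s).
Proof. by apply: measurable_funM => //; exact: measurable_cst. Qed.

Let mG t : measurable_fun D (fun s => 1 - cos (t * f s)).
Proof.
apply: measurable_funB; first exact: measurable_cst.
by apply: (measurableT_comp (f := @cos R)) => //; apply: continuous_measurable_fun; exact: continuous_cos.
Qed.

(** If no constant worked, there would be [t k] with
    [G (t k) > 4^k * trunc_sqr (t k)].  The intensities
    [l k = 2^-k / trunc_sqr (t k)] are admissible for these jump sizes, and
    [l k * G (t k) > 2^k] for all [k] would bound the integral from below. *)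
Let uniform_bound :
  (forall ak lk : nat -> R, (forall k, 0 < ak k) -> (forall k, 0 <= lk k) ->
     cvgn (series (fun k => lk k * trunc_sqr (ak k))) ->
     (\int[lam]_(s in D) (jump_exponent ak lk (f s))%:E < +oo)%E) ->
  exists K : R, forall t, 0 < t -> (G t <= (K * trunc_sqr t)%:E)%E.
Proof.
move=> H; apply: contrapT => /forallNP nK.
have /choice[t ht] : forall k : nat, exists t, 0 < t /\ ((4 ^+ k * trunc_sqr t)%:E < G t)%E.
  move=> k; have /existsNP[t /not_implyP[t0 /negP]] := nK (4 ^+ k).
  by rewrite -ltNge => h; exists t.
have w0 k : 0 < trunc_sqr (t k).
  by rewrite lt_min ltr01 andbT exprn_gt0//; case: (ht k).
pose l k := 2^-1 ^+ k / trunc_sqr (t k).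
have l0 k : 0 < l k by rewrite divr_gt0// exprn_gt0.
have S : cvgn (series (fun k => l k * trunc_sqr (t k))).
  rewrite (_ : (fun k => _) = geometric 1 2^-1).
    by apply: is_cvg_geometric_series; rewrite ger0_norm//; lra.
  by apply/funext => k; rewrite /geometric/= mul1r divfK// gt_eqF.
have := H t l (fun k => (ht k).1) (fun k => ltW (l0 k)) S.
set M := (\int[lam]_(s in D) _)%E => Moo.
have Mfin : M \is a fin_num.
  by rewrite ge0_fin_numE//; apply: integral_ge0 => s _; rewrite lee_fin; apply: jump_exponent_ge0 => // k; exact: ltW.
have je s : 0 <= jump_exponent t l s by apply: jump_exponent_ge0 => // k; exact: ltW.
have mje : measurable_fun D (fun s => jump_exponent t l (f s)).
  apply: (measurable_fun_cvg (h := fun n s => series (fun k => l k * (1 - cos (t k * f s))) n)).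
    by move=> n; apply: measurable_sum => k; apply: measurable_funM => //; exact: mG.
  by move=> s _; apply: jump_exponent_cvg => // k; exact: ltW.
have key k : ((2 ^+ k)%:E <= M)%E.
  apply: (@le_trans _ _ ((l k)%:E * G (t k))%E).
    apply: (@le_trans _ _ ((l k)%:E * (4 ^+ k * trunc_sqr (t k))%:E)%E); last first.
      by apply: lee_wpmul2l; [rewrite lee_fin ltW|apply: ltW; case: (ht k)].
    rewrite -EFinM lee_fin /l [leRHS](_ : _ = (2^-1 * 4) ^+ k).
      by rewrite (_ : 2^-1 * 4 = 2 :> R)//; field.
    by rewrite exprMn; field; rewrite gt_eqF.
  rewrite /G -ge0_integralZl//; last 2 first.
  - by apply/measurable_EFinP; exact: mG.
  - by rewrite lee_fin ltW.
  apply: ge0_le_integral => //.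
  - by move=> s _; rewrite mule_ge0 ?lee_fin ?one_sub_cos_ge0// ltW.
  - by apply: emeasurable_funM; [exact: measurable_cst|apply/measurable_EFinP; exact: mG].
  - by apply/measurable_EFinP; exact: mje.
  - move=> s _; rewrite -EFinM lee_fin.
    have nd : nondecreasing_seq (series (fun k => l k * (1 - cos (t k * f s)))).
      by apply: nondecreasing_series => j _ _; rewrite mulr_ge0 ?one_sub_cos_ge0// ltW.
    have cv := @jump_exponent_cvg _ _ _ (fun k => ltW (l0 k)) S (f s).
    apply: le_trans (nondecreasing_cvgn_le nd cv k.+1).
    rewrite /series/= big_nat_recr//= lerDr sumr_ge0// => j _.
    by rewrite mulr_ge0 ?one_sub_cos_ge0// ltW.
have := key (Num.truncn (fine M)).+1; rewrite -(fineK Mfin) lee_fin; apply/negP.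
rewrite -ltNge (lt_trans (truncnS_gt _))// -natrX ltr_nat.
by apply: ltn_expl.
Qed.

Let bound_ge0 K : (forall t, 0 < t -> (G t <= (K * trunc_sqr t)%:E)%E) -> 0 <= K.
Proof.
move=> HK; have : (0 <= (K * trunc_sqr 1)%:E)%E.
  apply: le_trans (HK 1 ltr01); apply: integral_ge0 => s _.
  by rewrite lee_fin one_sub_cos_ge0.
by rewrite lee_fin /trunc_sqr expr1n minxx mulr1.
Qed.

(** The truncation inequality for [n f] bounds the measure of [|f| >= 2 / n]
    uniformly in [n]. *)
Let bound_supp K : (forall t, 0 < t -> (G t <= (K * trunc_sqr t)%:E)%E) ->
  (\int[lam]_(s in D) (\1_[set t | f t != 0%R] s)%:E < +oo)%E.
Proof.
move=> HK; have tr1 t : trunc_sqr t <= 1 :> R by rewrite ge_min lexx orbT.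
have K0 := bound_ge0 HK.
pose g := f \_ D.
have mg : measurable_fun setT g by apply/(measurable_restrictT _ mD).
pose S n := [set x | (2 <= `|n.+1%:R * g x|)%R].
have mng n : measurable_fun setT (fun x => n.+1%:R * g x).
  by apply: measurable_funM => //; exact: measurable_cst.
have mS n : measurable (S n).
  by apply: measurable_ge; exact: measurable_fun_norm.
have lamS n : (lam (S n) <= 2%:E * K%:E)%E.
  apply: truncation_inequality; first exact: mng.
  move=> s /andP[s0 s1]; rewrite (_ : (\int[_]_w _)%E = G (s * n.+1%:R)).
    have [->|sn0] := eqVneq s 0.
      rewrite mul0r /G integral0_eq ?lee_fin// => x _.
      by rewrite mul0r cos0 subrr.
    have sp : 0 < s * n.+1%:R by rewrite mulr_gt0// lt_neqAle eq_sym sn0.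
    by apply: (le_trans (HK _ sp)); rewrite lee_fin ler_piMr.
  rewrite /G [RHS]integral_mkcond; apply: eq_integral => x _.
  rewrite /g /patch; case: ifP => _; first by rewrite mulrA.
  by rewrite !mulr0 cos0 subrr.
apply: (@le_lt_trans _ _ (2%:E * K%:E)%E); last by rewrite -EFinM ltry.
apply: (@fatou_bound _ _ _ lam D (fun n x => \1_(S n) x)
  (fun x => \1_[set t | f t != 0] x)) => //.
- by move=> n; apply: measurable_funTS; apply: measurable_indic; exact: mS.
- exact: measurable_supp.
- apply: aeW => x Dx; apply: cvg_near_cst; have [fx|fx] := eqVneq (f x) 0.
    have nf : ~ [set t | f t != 0] x by rewrite /= fx eqxx.
    apply: nearW => n; rewrite !indicE (memNset nf) memNset//.
    by rewrite /S/= /g /patch mem_set// fx mulr0 normr0; apply/negP; rewrite -ltNge.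
  have fx0 : 0 < `|f x| by rewrite normr_gt0.
  exists (Num.truncn (2 / `|f x|)) => // n /= hn.
  have nf : [set t | f t != 0] x by [].
  rewrite !indicE (mem_set nf) mem_set//.
  rewrite /S/= /g /patch mem_set// normrM ger0_norm// -ler_pdivrMr//.
  by apply/ltW/(lt_le_trans (truncnS_gt _)); rewrite ler_nat ltnS.
- exists 0%N => n _; rewrite integral_indic//; last exact: mS.
  apply: le_trans (lamS n); apply: le_measure; rewrite ?inE; [|exact: mS|exact: subIsetl].
  by apply: measurableI; [exact: mS|exact: mD].
Qed.

(** On [|f| <= 1 / t] the function [1 - cos (t f)] is at least [t^2 f^2 / 8], so the
    integral of [f^2] over this set is at most [8 K]; then [t] tends to zero. *)
Let bound_sqr K : (forall t, 0 < t -> (G t <= (K * trunc_sqr t)%:E)%E) ->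
  (\int[lam]_(s in D) (f s ^+ 2)%:E < +oo)%E.
Proof.
move=> HK; apply: (@le_lt_trans _ _ (8 * K)%:E); last exact: ltry.
pose I n : set R := [set y | `|y| <= n.+1%:R].
have mI n : measurable (I n).
  rewrite (_ : I n = `[- n.+1%:R, n.+1%:R]%classic); first exact: measurable_itv.
  by apply/seteqP; split => y; rewrite /I/= in_itv/= ler_norml.
have mfI n : measurable_fun D (fun x => f x ^+ 2 * \1_(I n) (f x)).
  apply: measurable_funM; first exact: measurable_funX.
  by apply: (measurableT_comp (f := \1_(I n) : R -> R)) => //; apply: measurable_indic; exact: mI.
apply: (@fatou_bound _ _ _ lam D (fun n x => f x ^+ 2 * \1_(I n) (f x))
  (fun x => f x ^+ 2)) => //.
- exact: measurable_funX.
- by move=> n x _; rewrite mulr_ge0 ?sqr_ge0.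
- by move=> x _; exact: sqr_ge0.
- apply: aeW => x Dx; apply: cvg_near_cst; exists (Num.truncn `|f x|) => // n /= hn.
  rewrite indicE mem_set ?mulr1// /I/=.
  by apply/ltW/(lt_le_trans (truncnS_gt _)); rewrite ler_nat ltnS.
- exists 0%N => n _; have N0 : n.+1%:R != 0 :> R by rewrite pnatr_eq0.
  pose t : R := n.+1%:R^-1; have t0 : 0 < t by rewrite invr_gt0.
  apply: (@le_trans _ _ ((8 * n.+1%:R ^+ 2)%:E * G t)%E).
    rewrite /G -ge0_integralZl//; last by apply/measurable_EFinP; exact: mG.
    apply: ge0_le_integral => //.
    - by move=> x _; rewrite lee_fin mulr_ge0 ?sqr_ge0.
    - by apply/measurable_EFinP; exact: mfI.
    - by apply: emeasurable_funM; [exact: measurable_cst|apply/measurable_EFinP; exact: mG].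
    - move=> x _; rewrite -EFinM lee_fin indicE; case: (boolP (f x \in I n)); last first.
        by move=> _; rewrite mulr0 !mulr_ge0 ?sqr_ge0 ?one_sub_cos_ge0.
      rewrite inE /I/= mulr1 => fx.
      have := @one_sub_cos_ge R (t * f x).
      rewrite normrM gtr0_norm// /t mulrC ler_pdivrMr// mul1r => /(_ fx) h.
      rewrite (_ : f x ^+ 2 = 8 * n.+1%:R ^+ 2 * ((f x * t) ^+ 2 / 8)); last first.
        by rewrite /t; move: (n.+1%:R : R) N0 => N N0; field.
      by rewrite [f x * t]mulrC; apply: ler_wpM2l; [rewrite mulr_ge0 ?sqr_ge0|exact: h].
  apply: (@le_trans _ _ ((8 * n.+1%:R ^+ 2)%:E * (K * t ^+ 2)%:E)%E).
    apply: lee_wpmul2l; first by rewrite lee_fin mulr_ge0// sqr_ge0.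
    apply: (le_trans (HK _ t0)); rewrite lee_fin ler_wpM2l//.
      exact: bound_ge0 HK.
    by rewrite ge_min lexx.
  rewrite -EFinM lee_fin /t exprVn [leLHS](_ : _ = 8 * K)//.
  by move: (n.+1%:R : R) N0 => N N0; field.
Qed.

Lemma necessity_of_jump_condition :
  (forall ak lk : nat -> R, (forall k, 0 < ak k) -> (forall k, 0 <= lk k) ->
     cvgn (series (fun k => lk k * trunc_sqr (ak k))) ->
     (\int[lam]_(s in D) (jump_exponent ak lk (f s))%:E < +oo)%E) ->
  (\int[lam]_(s in D) (\1_[set t | f t != 0%R] s)%:E < +oo)%E /\
  (\int[lam]_(s in D) (f s ^+ 2)%:E < +oo)%E.
Proof.
move=> /uniform_bound[K HK]; split; [exact: bound_supp HK|exact: bound_sqr HK].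
Qed.

End necessity.


(** * Essential integrability bounds the exponent *)

Section real_exponent.
Variables (R : realType) (d : nat) (mu : probability 'rV[R]_d R).
Variables (X : set_indexed_rvs R d) (HX : is_random_measure mu X).
Notation P := (rm_prob X).
Variables (i0 : 'I_d) (psi : R -> R).
Let e0 : 'rV[R]_d := delta_mx ord0 i0.
Hypothesis psi_cont : continuous psi.
Hypothesis psi_ge0 : forall x, 0 <= psi x.
Hypothesis Hpsi : forall B s, bounded_borel B ->
  rm_cfun X e0 B s = cexp ((fine (lam B))%:C * (- psi s)%:C).
Variables (a b : \bar R) (f : R -> R).
Hypothesis mf : measurable_fun (oitv a b) f.

Let cvg_in_prob_coord (u : nat -> rm_space X -> 'rV[R]_d) (Z : rm_space X -> 'rV[R]_d) :
  (forall n, measurable_fun setT (u n)) -> measurable_fun setT Z ->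
  cvg_in_prob \oo u Z ->
  forall e, 0 < e -> exists N, forall n, (N <= n)%N ->
     (P [set w | (e <= `|dot e0 (u n w) - dot e0 (Z w)|)%R] <= e%:E)%E.
Proof.
move=> mu_ mZ H e e_gt0; have [N _ hN] := H e e_gt0 _ (ereal_nbhs0_le e_gt0).
exists N => n Nn; apply: le_trans (hN n Nn); apply: prob_le.
- by apply: measurable_dist_ge; apply: measurable_dot.
- exact: measurable_enorm_ge.
- move=> w /=; rewrite !dot_delta => h; apply: (le_trans h).
  by have := coord_le_enorm (u n w - Z w) i0; rewrite !mxE.
Qed.

(** The approximating elementary integrals have characteristic functions
    [exp (- int psi (u g))]; a lower bound on the limit bounds these exponents
    eventually, and Fatou's lemma passes to [f]. *)
Lemma integral_cfun (J : set R -> {RV P >-> 'rV[R]_d}) B u :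
  is_integral a b f J -> inner_borel a b B ->
  exists r : R, [/\ 0 <= r, cfun P (fun w => dot e0 (J B w)) u = r%:C &
    expR (-1) < r -> (\int[lam]_(s in B) (psi (u * f s))%:E <= 1%:E)%E].
Proof.
move=> [h [hf hJ]] iB; have [mB BD _ _] := iB.
have bB : bounded_borel B by exact: inner_borel_bounded iB.
pose S n (j : 'I_(sf_size (h n))) := B `&` sf_set j.
have mS n j : measurable (S n j) by apply: measurableI => //; exact: sf_measurable.
have SB n j : S n j `<=` B by exact: subIsetl.
pose V n : rm_space X -> 'rV[R]_d := simple_integral (h n) B.
have msi n : measurable_fun setT (V n) by exact: (measurable_rm_comb (S n) (@sf_coef _ _ _ (h n))).
pose g n := comb_fun (S n) (@sf_coef _ _ _ (h n)).
pose A n := fine (\int[lam]_(s in B) (psi (u * g n s))%:E)%E.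
have cA n : cfun P (fun w => dot e0 (V n w)) u = (expR (- A n))%:C.
  have -> := cfun_comb_real (@sf_coef _ _ _ (h n)) bB (mS n) (@SB n) HX Hpsi u (fun=> erefl).
    by congr (expR (- fine _))%:C; apply: eq_integral => s _ /=; rewrite opprK.
  by move=> x /=; rewrite opprK.
have [c1 c2] := ccvg_cfun_prob u (fun n => measurable_dot e0 (msi n))
  (measurable_dot e0 (measurable_funPT (J B)))
  (cvg_in_prob_coord msi (measurable_funPT (J B)) (hJ B iB)).
set r := Re (cfun P _ u) in c1.
have {}c1 : (fun n => expR (- A n)) @ \oo --> r.
  by move: c1; rewrite (_ : (fun n => _) = (fun n => expR (- A n)))//; apply/funext => n; rewrite cA.
have im0 : Im (cfun P (fun w => dot e0 (J B w)) u) = 0.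
  have {}c2 : (fun _ : nat => 0 : R) @ \oo --> Im (cfun P (fun w => dot e0 (J B w)) u).
    by move: c2; rewrite (_ : (fun n => _) = (fun=> 0))//; apply/funext => n; rewrite cA.
  by have := cvg_lim (@norm_hausdorff _ _) c2; rewrite lim_cst// => <-.
exists r; split.
- by apply: (cvgr_to_ge c1); apply: nearW => n; exact: expR_ge0.
- by apply: complex_eqP.
move=> hr.
have gf x : B x -> forall n, g n x = sf_eval (h n) x.
  move=> Bx n; apply: eq_bigr => j _; congr (_ * _).
  by rewrite /S indicI /= indicE mem_set// mul1r.
have mg n : measurable_fun setT (g n).
  apply: measurable_sum => j; apply: measurable_funM; first exact: measurable_cst.
  by apply: measurable_indic; exact: mS.
have mpsi : measurable_fun setT psi by exact: continuous_measurable_fun.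
have mfB : measurable_fun B f.
  by apply: (measurable_funS _ BD mf); exact: measurable_oitv.
have mpg n : measurable_fun B (fun x => psi (u * g n x)).
  apply: measurableT_comp => //; apply: measurable_funM; first exact: measurable_cst.
  exact: measurable_funTS.
apply: (@fatou_bound _ _ _ lam B (fun n x => psi (u * g n x)) (fun x => psi (u * f x))) => //.
- apply: measurableT_comp => //; apply: measurable_funM => //; exact: measurable_cst.
- apply: (@filterS _ _ (ae_filter_ringOfSetsType (@lebesgue_measure R)) _ _ _ hf) => x hx Bx.
  apply: (@cvg_seq_continuous _ psi (fun n => u * g n x)); first exact: psi_cont.
  apply: cvgM; first exact: cvg_cst.
  by rewrite (_ : (fun n => g n x) = (fun n => sf_eval (h n) x));
    [exact: hx (BD x Bx)|apply/funext => n; rewrite gf].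
- have [N _ hN] := cvgr_gt _ c1 _ hr; exists N => n /hN /=.
  rewrite ltr_expR ltrN2 => An.
  have /fineK <- : (\int[lam]_(s in B) (psi (u * g n s))%:E)%E \is a fin_num.
    by rewrite [X in X \is a fin_num](ge0_integral_comb (@sf_coef _ _ _ (h n)) bB (mS n)
      (F := fun y => psi (u * y)) (fun y => psi_ge0 (u * y))).
  by rewrite lee_fin ltW.
Qed.


(** Near the ends of the interval the centred integrals have characteristic
    functions close to that of the limit, hence bounded below at small arguments;
    the centring only contributes a phase. *)
Lemma essential_bound : (a < b)%E -> essentially_integrable a b X f ->
  exists m : nat, (\int[lam]_(s in oitv a b) (psi (2^-1 ^+ m * f s))%:E <= 1%:E)%E.
Proof.
move=> ab [J [hJ [g [Z hZ]]]].
have [p [q [pq1 pq2 pq3 pq4]]] := exhaust_oitv ab.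
pose W n : rm_space X -> 'rV[R]_d := fun w => J `]p n, q n]%classic w - g (p n) (q n).
have mcst (v : 'rV[R]_d) : measurable_fun setT (fun _ : rm_space X => v).
  exact: measurable_cst.
have mW n : measurable_fun setT (W n).
  by apply: measurable_fun_rVB; [exact: measurable_funPT|exact: mcst].
have cW : cvg_in_prob \oo W Z.
  move=> e e_gt0 U /(hZ e e_gt0)[p0 [q0 [Dp0 Dq0 pq0 hU]]].
  have [q1 /andP[q01 q1b]] := ereal_dense (let: conj _ h := andP Dq0 in h).
  have Dq1 : oitv a b q1.
    by rewrite /oitv/= q1b andbT (lt_trans _ q01)//; case/andP: Dq0.
  have [N1 h1] := pq4 _ Dp0; have [N2 h2] := pq4 _ Dq1.
  exists (maxn N1 N2) => // n /=; rewrite geq_max => /andP[/h1/andP[hp _] /h2/andP[_ hq]].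
  have [Dp Dq _] := pq1 n; apply: (hU (p n) (q n)) => //.
  by rewrite lte_fin in q01; exact: lt_le_trans hq.
have [cZ _] := cfun_continuous (rm_prob X) (measurable_dot e0 (measurable_funPT Z)).
have Z0 : Re (cfun P (fun w => dot e0 (Z w)) 0) = 1.
  rewrite cfunE/= -[RHS](Rintegral_prob_cst P); apply: eq_Rintegral => w _.
  by rewrite mul0r cos0.
have lt1 : expR (-1) < Re (cfun P (fun w => dot e0 (Z w)) 0).
  by rewrite Z0 expR_lt1; lra.
have h2 : (fun m => 2^-1 ^+ m : R) @ \oo --> 0.
  by apply: cvg_expr; rewrite ger0_norm//; lra.
have h3 : (fun m => Re (cfun P (fun w => dot e0 (Z w)) (2^-1 ^+ m))) @ \oo -->
    Re (cfun P (fun w => dot e0 (Z w)) 0).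
  by apply: (@cvg_seq_continuous _ (fun s => Re (cfun P (fun w => dot e0 (Z w)) s))).
have [m _ hm] := cvgr_gt _ h3 _ lt1; have {}hm := hm m (leqnn m).
exists m; set u := 2^-1 ^+ m in hm *.
have [c1 _] := ccvg_cfun_prob u (fun n => measurable_dot e0 (mW n))
  (measurable_dot e0 (measurable_funPT Z)) (cvg_in_prob_coord mW (measurable_funPT Z) cW).
have [N _ hN] := cvgr_gt _ c1 _ hm.
have bound n : (N <= n)%N -> (\int[lam]_(s in `]p n, q n]%classic) (psi (u * f s))%:E <= 1%:E)%E.
  move=> /hN /= hn; have [Dp Dq _] := pq1 n.
  have [r [r0 cr hr]] := integral_cfun u hJ (inner_borel_itv Dp Dq).
  apply: hr; apply: (lt_le_trans hn).
  have ez : cfun P (fun w => dot e0 (W n w)) u =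
      cexp (0 +i* (- (u * dot e0 (g (p n) (q n))))) * r%:C.
    rewrite -cr /cfun -cintegralMl.
      congr cintegral; apply/funext => w; rewrite -cexpD; congr cexp.
      apply: complex_eqP; rewrite ?cReD ?cImD/= ?addr0// /W -scaleN1r dotDr dotZr.
      by ring.
    by apply: cbmeas_cfun; apply: measurable_dot; exact: measurable_funPT.
  rewrite [leLHS](congr1 (@complex.Re R) ez) cReM cexpE/= expR0 mul1r mulr0 subr0.
  by apply: ler_piMl => //; exact: cos_le1.
have mpsif : measurable_fun (oitv a b) (fun x => psi (u * f x)).
  apply: measurableT_comp; first exact: continuous_measurable_fun.
  by apply: measurable_funM => //; exact: measurable_cst.
have mI n : measurable (`]p n, q n]%classic : set R) by exact: measurable_itv.
apply: (@fatou_bound _ _ _ lam (oitv a b)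
  (fun n x => psi (u * f x) * \1_(`]p n, q n]%classic) x) (fun x => psi (u * f x))) => //.
- exact: measurable_oitv.
- move=> n; apply: measurable_funM; first exact: mpsif.
  apply: measurable_funTS.
  by apply: measurable_indic; exact: mI.
- by move=> n x _; rewrite mulr_ge0.
- apply: aeW => x Dx; apply: cvg_near_cst; have [N' hN'] := pq4 x Dx.
  by exists N' => // n /hN' hx; rewrite indicE mem_set ?mulr1//= in_itv/=.
- exists N => n /bound; apply: le_trans.
  have [Dp Dq _] := pq1 n; have [_ ID _ _] := inner_borel_itv Dp Dq.
  rewrite -{2}(setIidr ID) integral_mkcondr.
  rewrite le_eqVlt; apply/orP; left; apply/eqP; apply: eq_integral => x _.
  by rewrite /patch indicE; case: ifP => _; rewrite ?mulr1 ?mulr0.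
Qed.

End real_exponent.


(** * The equivalence *)

Lemma jump_exponent_double (R : realType) (a l : nat -> R) : (forall k, 0 <= l k) ->
  cvgn (series (fun k => l k * trunc_sqr (a k))) ->
  forall m x, jump_exponent a l x <= 4 ^+ m * jump_exponent a l (2^-1 ^+ m * x).
Proof.
move=> l0 S; have step x : jump_exponent a l (2 * x) <= 4 * jump_exponent a l x.
  have c1 := @jump_exponent_cvg _ _ _ l0 S (2 * x).
  have c2 : (fun n => 4 * series (fun k => l k * (1 - cos (a k * x))) n) @ \oo -->
      4 * jump_exponent a l x.
    by apply: cvgM; [exact: cvg_cst|exact: jump_exponent_cvg].
  apply: (ler_cvg_to c1 c2); apply: nearW => n.
  rewrite /series/= mulr_sumr; apply: ler_sum => k _.
  rewrite [leRHS]mulrCA ler_wpM2l// (_ : a k * (2 * x) = 2 * (a k * x)); last by ring.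
  exact: one_sub_cos_double.
elim=> [|m IH] x; first by rewrite !expr0 !mul1r.
apply: (le_trans (IH x)); rewrite exprSr -mulrA ler_wpM2l ?exprn_ge0//.
rewrite (_ : 2^-1 ^+ m * x = 2 * (2^-1 ^+ m.+1 * x)); first exact: step.
by rewrite exprS; field.
Qed.

Section equivalence.
Variables (R : realType) (d : nat) (d_gt0 : (0 < d)%N).
Variable X : probability 'rV[R]_d R -> set_indexed_rvs R d.
Hypothesis X_spec : forall mu, ID R d mu -> is_random_measure mu (X mu).
Variables (a b : \bar R) (a_lt_b : (a < b)%E) (f : R -> R).
Hypothesis mf : measurable_fun (oitv a b) f.

Let i0 : 'I_d := Ordinal d_gt0.
Let e0 : 'rV[R]_d := delta_mx ord0 i0.

Definition supp_sqr_finite : Prop :=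
  (\int[lebesgue_measure]_(s in oitv a b)
     (\1_[set t | f t != 0%R] s)%:E < +oo)%E /\
  (\int[lebesgue_measure]_(s in oitv a b) ((f s) ^+ 2)%:E < +oo)%E.

Lemma sufficient_D0 : supp_sqr_finite -> ID R d `<=` D0 X a b f.
Proof.
move=> [h1 h2] mu IDmu; have HX := X_spec IDmu; split => //.
  exact: (sufficient_locally_integrable HX mf h1 h2).
by move=> z; exact: (cumulant_integrable HX mf h1 h2 z).
Qed.

Lemma sufficient_D_es : supp_sqr_finite -> ID R d `<=` D_es X a b f.
Proof.
move=> [h1 h2] mu IDmu; have HX := X_spec IDmu; split => //; split.
  exact: (sufficient_locally_integrable HX mf h1 h2).
exact: (sufficient_essentially_integrable HX mf h1 h2 a_lt_b).
Qed.

Section one_jump_law.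
Variables (mu : probability 'rV[R]_d R) (IDmu : ID R d mu) (ak lk : nat -> R).
Hypothesis l0 : forall k, 0 <= lk k.
Hypothesis S : cvgn (series (fun k => lk k * trunc_sqr (ak k))).
Notation psi := (jump_exponent ak lk).
Hypothesis cum : is_cumulant mu (fun z => (- psi (z ord0 i0))%:C).

Let psi0 x : 0 <= psi x. Proof. exact: jump_exponent_ge0. Qed.

Let psi_exponent : continuous psi /\ forall B s, bounded_borel B ->
  rm_cfun (X mu) e0 B s = cexp ((fine (lam B))%:C * (- psi s)%:C).
Proof.
have [c [c1 c2 c0 cE]] := levy_exponent (X_spec IDmu) e0.
have cpsi s : c s = (- psi s)%:C.
  by rewrite -(cumulant_ray (X_spec IDmu) cum c1 c2 c0 cE) /e0 !mxE !eqxx mulr1.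
split; last by move=> B s bB; rewrite cE// cpsi.
rewrite (_ : psi = fun s => - Re (c s)); last by apply/funext => s; rewrite cpsi/= opprK.
by move=> s; apply: (@continuousN _ _ _ (fun s => Re (c s))); exact: c1.
Qed.

Let measurable_psif t : measurable_fun (oitv a b) (fun s => (psi (t * f s))%:E).
Proof.
apply/measurable_EFinP; apply: measurableT_comp.
  by apply: continuous_measurable_fun; case: psi_exponent.
by apply: measurable_funM => //; exact: measurable_cst.
Qed.

Lemma jump_condition_D0 : D0 X a b f mu ->
  (\int[lam]_(s in oitv a b) (psi (f s))%:E < +oo)%E.
Proof.
move=> [_ _ /(_ e0)]; rewrite (cumulantE cum); apply: le_lt_trans.
rewrite le_eqVlt; apply/orP; left; apply/eqP; apply: eq_integral => s _; congr EFin.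
rewrite /e0 !mxE !eqxx mulr1 /cmod/= expr0n addr0 sqrtr_sqr normrN.
by rewrite ger0_norm.
Qed.

Lemma jump_condition_D_es : D_es X a b f mu ->
  (\int[lam]_(s in oitv a b) (psi (f s))%:E < +oo)%E.
Proof.
move=> [_ [_ /essential_bound H]]; have [c1 c2] := psi_exponent.
have [m hm] := H _ (X_spec IDmu) i0 psi c1 psi0 c2 mf a_lt_b.
apply: (@le_lt_trans _ _ ((4 ^+ m)%:E * 1%:E)%E); last by rewrite mule1 ltry.
apply: (@le_trans _ _ ((4 ^+ m)%:E *
    \int[lam]_(s in oitv a b) (psi (2^-1 ^+ m * f s))%:E)%E); last first.
  by apply: lee_wpmul2l.
have mo : measurable (oitv a b) := measurable_oitv a b.
rewrite -ge0_integralZl//; [|exact: measurable_psif|by move=> s _; rewrite lee_fin].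
apply: ge0_le_integral => //.
- by move=> s _; rewrite lee_fin.
- by under eq_fun do rewrite -[f _]mul1r; exact: measurable_psif.
- by apply: emeasurable_funM; [exact: measurable_cst|exact: measurable_psif].
- by move=> s _; rewrite -EFinM lee_fin; exact: jump_exponent_double.
Qed.

End one_jump_law.

Lemma necessary_D0 : ID0 R d `<=` D0 X a b f -> supp_sqr_finite.
Proof.
move=> H; apply: (necessity_of_jump_condition mf) => ak lk a0 l0 S.
have [mu mu0 cum] := jump_law_ID0 i0 X_spec a0 l0 S.
exact: (jump_condition_D0 l0 S cum (H mu mu0)).
Qed.

Lemma necessary_D_es : ID0 R d `<=` D_es X a b f -> supp_sqr_finite.
Proof.
move=> H; apply: (necessity_of_jump_condition mf) => ak lk a0 l0 S.
have [mu mu0 cum] := jump_law_ID0 i0 X_spec a0 l0 S.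
exact: (jump_condition_D_es mu0.1 l0 S cum (H mu mu0)).
Qed.

End equivalence.

Theorem theorem6p1 (R : realType) (d : nat) (d_gt0 : (0 < d)%N)
  (X : probability 'rV[R]_d R -> set_indexed_rvs R d)
  (X_spec : forall mu, ID R d mu -> is_random_measure mu (X mu))
  (a b : \bar R) (a_lt_b : (a < b)%E)
  (f : R -> R) (f_meas : measurable_fun (oitv a b) f) :
  [<-> ID R d = D0 X a b f;
       ID R d = D_es X a b f;
       ID0 R d `<=` D0 X a b f;
       ID0 R d `<=` D_es X a b f;
       (\int[lebesgue_measure]_(s in oitv a b)
          (\1_[set t | f t != 0] s)%:E < +oo)%E /\
       (\int[lebesgue_measure]_(s in oitv a b) ((f s) ^+ 2)%:E < +oo)%E].
Proof.
have ID0S : ID0 R d `<=` ID R d by move=> mu [].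
have D0S : D0 X a b f `<=` ID R d by move=> mu [].
have DeS : D_es X a b f `<=` ID R d by move=> mu [].
have toD0 := sufficient_D0 X_spec f_meas.
have toDe := sufficient_D_es X_spec a_lt_b f_meas.
have ofD0 := necessary_D0 d_gt0 X_spec f_meas.
have ofDe := necessary_D_es d_gt0 X_spec a_lt_b f_meas.
tfae.
- move=> e; rewrite e in ID0S; apply/seteqP; split => //; exact/toDe/ofD0.
- move=> e; rewrite e in ID0S; apply: (subset_trans _ (toD0 (ofDe ID0S))).
  by rewrite e.
- by move=> /ofD0/toDe; apply: subset_trans.
- exact: ofDe.
- by move=> /toD0 h; apply/seteqP; split.
Qed.
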